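(* Suppose that the data are forward-Lipschitz and backward-regular (terms defined in the context). Then, for every $L\in\mathcal V$, if $X$ is the solution of the forward equation with input $L$ and $(Y,Z,A)\in\mathbb S^2\times\mathbb H^2\times\mathbb A^2$ is the solution of the reflected BSDE with input $L$, it holds that for all $0\le t\le T$, almost surely, $$Y_t=\operatorname*{ess\,sup}_{\hat L\in\mathcal V_t}\mathbb E\bigg[\int_t^Tf(s,X_s,\mathbb E[\bar f(s,X_s)L_s])\hat L_s\,ds-\int_{t^-}^Th\Big(s,X_s,\mathbb E\Big[\int_{0^-}^T\phi(s-r)dL_r\Big]\Big)d\hat L_s\,\bigg|\,\mathcal F_t\bigg],$$ where $\mathcal V_t=\{\hat L\in\mathcal V:\hat L_{t^-}=1\}$.
   Context: Fix $T>0$, integers $d,k,m\ge1$ and a real $q\ge4$. $(\Omega,\mathcal F,\mathbb P)$ is a complete probability space carrying a standard $m$-dimensional Brownian motion $W$ and a random variable $X_0:\Omega\to\mathbb R^d$ independent of $W$ with $\mathbb E[|X_0|^q]<\infty$; $\{\mathcal F_t\}_{t\in[0,T]}$ is the filtration generated by $X_0$ and $W$, augmented with all $\mathbb P$-null sets. Spaces (of equivalence classes; vector dimension clear from use): $\mathbb S^2$ = adapted continuous processes with $\mathbb E[\sup_{t}|Y_t|^2]<\infty$; $\mathbb H^2$ = progressively measurable processes with $\mathbb E[\int_0^T|Z_t|^2dt]<\infty$; $\mathbb A^2$ = real-valued non-decreasing processes $A\in\mathbb S^2$ with $A_0=0$; $\mathcal V\subset\mathbb H^2(\mathbb R)$ =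 classes admitting a representative $L$ that is $[0,1]$-valued, adapted, non-increasing, càdlàg with $L_T=0$. We set $L_{0^-}:=1$ and always use this representative. Integrals $\int_{t^-}^T\cdot\,dL_s$ include the jump $L_t-L_{t^-}$ at time $t$ (for $t=0$, integrands take at $0^-$ their value at $0$). Data: measurable functions $b:[0,T]\times\mathbb R^d\times\mathbb R^k\to\mathbb R^d$, $\bar b:[0,T]\times\mathbb R^d\to\mathbb R^k$, $\sigma:[0,T]\times\mathbb R^d\times\mathbb R^k\to\mathbb R^{d\times m}$, $\bar\sigma:[0,T]\times\mathbb R^d\to\mathbb R^k$, $f:[0,T]\times\mathbb R^d\times\mathbb R^k\to\mathbb R$, $\bar f:[0,T]\times\mathbb R^d\to\mathbb R^k$, $h:[0,T]\times\mathbb R^d\times\mathbb R\to\mathbb R$, $\phi:[-T,T]\to\mathbb R$. The data are: - forward-Lipschitz if for some $K\ge0$: $|b(t,x,m)-b(t,x',m')|+|\sigma(t,x,m)-\sigma(t,x',m')|\le K(|x-x'|+|m-m'|)$, $|\bar b(t,x)-\bar b(t,x')|+|\bar\sigma(t,x)-\bar\sigma(t,x')|\le K|x-x'|$, $|b(t,0,0)|+|\sigma(t,0,0)|+|\bar b(t,0)|+|\bar\sigma(t,0)|\le K$ for all arguments; - backward-regular if for some $K\ge0$, $r\in[1,q/2)$: $|f(t,x,m')-f(t,x,m)|\le K|m'-m|$, $|f(t,x,0)|+|h(t,x,0)|+|\bar f(t,x)|\le K(1+|x|^r)$, $|h(t,x,w)-h(t,x,w')|\le K|w-w'|$ for all arguments,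 $h$ is jointly continuous and $\phi\in\mathcal C^1([-T,T])$. Forward equation with input $L\in\mathcal V$: $X_t=X_0+\int_0^tb(s,X_s,\mathbb E[\bar b(s,X_s)L_s])ds+\int_0^t\sigma(s,X_s,\mathbb E[\bar\sigma(s,X_s)L_s])dW_s$, $t\in[0,T]$. Reflected BSDE with input $L$: with $X$ the solution of the forward equation with input $L$ and $\xi_t:=h(t,X_t,\mathbb E[\int_{0^-}^T\phi(t-s)dL_s])$, find $(Y,Z,A)\in\mathbb S^2\times\mathbb H^2\times\mathbb A^2$ with $$Y_t=\xi_T+\int_t^Tf(s,X_s,\mathbb E[\bar f(s,X_s)L_s])ds+A_T-A_t-\int_t^T(Z_s,dW_s),\quad Y_t\ge\xi_t,\ 0\le t\le T,\quad\int_0^T(Y_t-\xi_t)dA_t=0.$$ For forward-Lipschitz, backward-regular data both problems have a unique solution for every $L\in\mathcal V$. *)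

(* Defs.v *)
From HB Require Import structures.
From mathcomp Require Import all_boot all_order all_algebra.
From mathcomp Require Import all_classical all_reals all_analysis.
From mathcomp Require Import measurable_realfun.

Set Implicit Arguments.
Unset Strict Implicit.
Unset Printing Implicit Defensive.

Import Order.TTheory GRing.Theory Num.Theory.
Import numFieldNormedType.Exports.

Local Open Scope classical_set_scope.
Local Open Scope ring_scope.

(* Vectors of R^n are row vectors.  Processes are functions of a time in R and
   an outcome; only their values at times in [0, T] are ever constrained or
   used.  Likewise the coefficients are only constrained at times in [0, T]
   (resp. on [-T, T] for phi).
   Classes of processes are handled through representatives: the path
   properties defining S^2, A^2 and V are required for every outcome, whereas
   equations and inequalities between random quantities hold almost surely. *)

(* Euclidean norm of a vector, Frobenius norm of a matrix; the norm `|_| of the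
   library on matrices is the maximum norm. *)
Definition enorm (R : realType) (a b : nat) (x : 'M[R]_(a, b)) : R :=
  Num.sqrt (\sum_i \sum_j x i j ^+ 2).

Definition vec1 (R : realType) (x : R) : 'rV[R]_1 := const_mx x.

(* Measurability of matrix-valued maps, for the Borel sigma-algebra of the
   matrices. *)
Definition mx_measurable (R : realType) (disp : measure_display)
    (U : measurableType disp) (a b : nat) (D : set U) (g : U -> 'M[R]_(a, b)) :=
  forall i j, measurable_fun D (fun u => g u i j : R).

(* A product of pointed topological spaces is one, as needed to equip it with
   its Borel sigma-algebra. *)
HB.instance Definition _ (U V : ptopologicalType) := Pointed.on (U * V)%type.

(* Measurability for the Borel sigma-algebra of a topological space U. *)
Definition borel_fun (R : realType) (U : ptopologicalType) (D : set U)
    (g : U -> R) :=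
  measurable_fun (D : set (g_sigma_algebraType (@open U)))
    (g : g_sigma_algebraType (@open U) -> R).

Definition borel_mx (R : realType) (U : ptopologicalType) (a b : nat)
    (D : set U) (g : U -> 'M[R]_(a, b)) :=
  forall i j, borel_fun D (fun u => g u i j).

Section stieltjes.
Variable R : realType.

(* Lebesgue-Stieltjes measure of a bare function; F is meant to be
   nondecreasing and right-continuous, and the zero measure is a dummy value
   otherwise. *)
Definition stieltjes (F : R -> R) :
    {measure set (measurableTypeR R) -> \bar R} :=
  match pselect (exists G : cumulative R R, (G : R -> R) = F) with
  | left h => lebesgue_stieltjes_measure (projT1 (cid h))
  | right _ => mzero
  end.

(* For a path l : [0, T] -> [0, 1], nonincreasing and cadlag with l_T = 0,
   the measure -dl on [0, T].  The convention l_{0-} = 1 is the value 0 of the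
   distribution function on the negative reals, which gives mass 1 - l_0 to
   the point 0, and in general mass l_{t-} - l_t to the point t. *)
Definition neg_dmeasure (T : R) (l : R -> R) :=
  stieltjes (fun s => if s < 0 then 0 else 1 - l (Num.min s T)).

(* The integral of g_s dl_s from t- to T, which includes the jump at t. *)
Definition int_d (T t : R) (l g : R -> R) : R :=
  - (\int[neg_dmeasure T l]_(s in `[t, T]) g s).

(* The measure da on [0, T] of a continuous nondecreasing path a. *)
Definition dmeasure (T : R) (a : R -> R) :=
  stieltjes (fun s => a (Num.max 0 (Num.min s T))).

(* l_{t-}, with the convention l_{0-} = 1. *)
Definition left_value (l : R -> R) (t : R) : R :=
  if t == 0 then 1 else lim (l s @[s --> t^'-]).

End stieltjes.

Section probability.
Variables (R : realType) (disp : measure_display) (Omega : measurableType disp).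
Variable P : probability Omega R.

(* A family generating the sigma-algebra of (X_i), i in D. *)
Definition rv_gens (I : Type) (n : nat) (D : set I)
    (X : I -> Omega -> 'rV[R]_n) : set (set Omega) :=
  \bigcup_(i in D) \bigcup_(j : 'I_n)
    preimage_set_system setT (fun w => X i w ord0 j : R) measurable.

Definition indep_gens (G H : set (set Omega)) :=
  forall A B, <<s G>> A -> <<s H>> B -> P (A `&` B) = (P A * P B)%E.

Definition random_vector (n : nat) (X : Omega -> 'rV[R]_n) :=
  mx_measurable setT X.

(* Standard m-dimensional Brownian motion on [0, T]. *)
Definition brownian_motion (T : R) (m : nat) (W : R -> Omega -> 'rV[R]_m) :=
  [/\ forall t : R, t \in `[0, T] -> random_vector (W t),
      {ae P, forall w, W 0 w = 0},
      {ae P, forall w, {within `[0, T], continuous (fun t => W t w)}},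
      forall s t : R, 0 <= s -> s < t -> t <= T ->
        indep_gens (rv_gens [set tt] (fun _ w => W t w - W s w))
                   (rv_gens `[0, s] W) &
      forall s t : R, 0 <= s -> s < t -> t <= T ->
        forall B : 'I_m -> set (measurableTypeR R),
        (forall j, measurable (B j)) ->
        P [set w | forall j, B j ((W t w - W s w) ord0 j)] =
        (\prod_(j < m) normal_prob 0 (Num.sqrt (t - s)) (B j))%E].

(* V is a version of the conditional expectation of G given the sigma-algebra
   generated by C.  For integrable G this is the usual notion (V is then
   integrable as well); integrability of G is not demanded here, so that no G
   is discarded by the definition. *)
Definition is_cond_exp (C : set (set Omega)) (G : Omega -> R)
    (V : Omega -> \bar R) :=
  measurable_fun setT (V : g_sigma_algebraType C -> \bar R) /\
  forall A, <<s C>> A ->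
    (\int[P]_(w in A) V w = \int[P]_(w in A) (G w)%:E)%E.

(* Essential supremum of a family S of random variables: the least, up to
   null sets, of its almost sure upper bounds.  (The library's ess_sup is the
   essential supremum of a single function.) *)
Definition is_family_ess_sup (S : set (Omega -> \bar R)) (H : Omega -> \bar R) :=
  [/\ measurable_fun setT H,
      forall V, S V -> {ae P, forall w, (V w <= H w)%E} &
      forall H', measurable_fun setT H' ->
        (forall V, S V -> {ae P, forall w, (V w <= H' w)%E}) ->
        {ae P, forall w, (H w <= H' w)%E}].

End probability.

Section processes.
Variables (R : realType) (disp : measure_display) (Omega : measurableType disp).
Variables (P : probability Omega R) (T : R) (d m : nat).
Variables (X0 : Omega -> 'rV[R]_d) (W : R -> Omega -> 'rV[R]_m).

Local Notation leb := (@lebesgue_measure R).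

(* A generating family of F_t. *)
Definition filt (t : R) : set (set Omega) :=
  rv_gens [set tt] (fun _ => X0) `|` rv_gens `[0, t] W
    `|` [set N | P.-negligible N].

Definition filt_measurable (n : nat) (t : R) (x : Omega -> 'rV[R]_n) :=
  @mx_measurable R _ (g_sigma_algebraType (filt t)) _ _ setT x.

Definition adapted (n : nat) (X : R -> Omega -> 'rV[R]_n) :=
  forall t : R, t \in `[0, T] -> filt_measurable t (X t).

Definition progressive (n : nat) (X : R -> Omega -> 'rV[R]_n) :=
  forall t : R, t \in `[0, T] ->
    mx_measurable (`[0, t] `*` setT)
      (fun p : measurableTypeR R * g_sigma_algebraType (filt t) => X p.1 p.2).

Definition continuous_paths (n : nat) (X : R -> Omega -> 'rV[R]_n) :=
  forall w, {within `[0, T], continuous (fun t => X t w)}.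

Definition in_S2 (n : nat) (X : R -> Omega -> 'rV[R]_n) :=
  [/\ adapted X, continuous_paths X &
      (\int[P]_w ereal_sup [set (enorm (X t w) ^+ 2)%:E | t in `[0%R, T]]
         < +oo)%E].

Definition in_H2 (n : nat) (Z : R -> Omega -> 'rV[R]_n) :=
  progressive Z /\
  (\int[P]_w \int[leb]_(t in `[0%R, T]) (enorm (Z t w) ^+ 2)%:E < +oo)%E.

Definition in_A2 (A : R -> Omega -> R) :=
  [/\ in_S2 (fun t w => vec1 (A t w)),
      forall w, {in `[0, T] &, {homo (A ^~ w) : s t / s <= t}} &
      forall w, A 0 w = 0].

Definition in_V (L : R -> Omega -> R) :=
  [/\ in_H2 (fun t w => vec1 (L t w)),
      adapted (fun t w => vec1 (L t w)),
      forall w (t : R), t \in `[0, T] -> 0 <= L t w <= 1,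
      forall w, {in `[0, T] &, {homo (L ^~ w) : s t / s <= t >-> t <= s}} &
      [/\ forall w (t : R), 0 <= t -> t < T -> L s w @[s --> t^'+] --> L t w,
          forall w (t : R), 0 < t -> t <= T -> cvg (L s w @[s --> t^'-]) &
          forall w, L T w = 0]].

Definition in_V_at (t : R) (L : R -> Omega -> R) :=
  in_V L /\ {ae P, forall w, left_value (L ^~ w) t = 1}.

(* Simple integrands sum_i z_i 1_{(u_i, u_{i+1}]} with 0 = u_0 < ... < u_N = T
   and z_i bounded and F_{u_i}-measurable. *)
Record simple_integrand := SimpleIntegrand {
  si_size : nat;
  si_grid : nat -> R;
  si_coef : nat -> Omega -> 'rV[R]_m;
  si_grid0 : si_grid 0%N = 0;
  si_gridT : si_grid si_size = T;
  si_grid_lt : forall i, (i < si_size)%N -> si_grid i < si_grid i.+1;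
  si_coef_measurable : forall i, (i < si_size)%N ->
    filt_measurable (si_grid i) (si_coef i);
  si_coef_bounded : forall i, (i < si_size)%N ->
    exists M : R, forall w, enorm (si_coef i w) <= M }.

Definition si_process (S : simple_integrand) (t : R) (w : Omega) : 'rV[R]_m :=
  \sum_(i < si_size S | si_grid S i < t <= si_grid S i.+1) si_coef S i w.

Definition si_integral (S : simple_integrand) (t : R) (w : Omega) : R :=
  \sum_(i < si_size S) \sum_(j < m) si_coef S i w ord0 j *
    (W (Num.min (si_grid S i.+1) t) w - W (Num.min (si_grid S i) t) w) ord0 j.

(* I is a continuous version of the Ito integral of (Z, dW), for Z in H^2. *)
Definition is_ito_integral (Z : R -> Omega -> 'rV[R]_m) (I : R -> Omega -> R) :=
  [/\ in_H2 Z,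
      adapted (fun t w => vec1 (I t w)),
      continuous_paths (fun t w => vec1 (I t w)) &
      exists S : nat -> simple_integrand,
        (\int[P]_w \int[leb]_(t in `[0%R, T])
            (enorm (si_process (S n) t w - Z t w) ^+ 2)%:E)%E
          @[n --> \oo] --> 0%E /\
        forall t : R, t \in `[0, T] ->
          (\int[P]_w ((si_integral (S n) t w - I t w) ^+ 2)%:E)%E
            @[n --> \oo] --> 0%E].

End processes.

Record data (R : realType) (d k m : nat) := Data {
  c_b : R -> 'rV[R]_d -> 'rV[R]_k -> 'rV[R]_d;
  c_bbar : R -> 'rV[R]_d -> 'rV[R]_k;
  c_sigma : R -> 'rV[R]_d -> 'rV[R]_k -> 'M[R]_(d, m);
  c_sigmabar : R -> 'rV[R]_d -> 'rV[R]_k;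
  c_f : R -> 'rV[R]_d -> 'rV[R]_k -> R;
  c_fbar : R -> 'rV[R]_d -> 'rV[R]_k;
  c_h : R -> 'rV[R]_d -> R -> R;
  c_phi : R -> R }.

Section data_assumptions.
Variables (R : realType) (T q : R) (d k m : nat) (D : data R d k m).

Let dom2 : set (R * 'rV[R]_d) := `[0, T] `*` setT.
Let dom3 : set (R * 'rV[R]_d * 'rV[R]_k) := `[0, T] `*` setT `*` setT.
Let dom3h : set (R * 'rV[R]_d * R) := `[0, T] `*` setT `*` setT.

Definition measurable_data :=
  [/\ borel_mx dom3 (fun p => c_b D p.1.1 p.1.2 p.2),
      borel_mx dom2 (fun p => c_bbar D p.1 p.2),
      borel_mx dom3 (fun p => c_sigma D p.1.1 p.1.2 p.2) &
      borel_mx dom2 (fun p => c_sigmabar D p.1 p.2)] /\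
  [/\ borel_fun dom3 (fun p => c_f D p.1.1 p.1.2 p.2),
      borel_mx dom2 (fun p => c_fbar D p.1 p.2),
      borel_fun dom3h (fun p => c_h D p.1.1 p.1.2 p.2) &
      borel_fun `[- T, T] (c_phi D)].

Definition forward_lipschitz := exists2 K : R, 0 <= K &
  [/\ forall t : R, t \in `[0, T] -> forall x x' z z',
        enorm (c_b D t x z - c_b D t x' z')
        + enorm (c_sigma D t x z - c_sigma D t x' z')
          <= K * (enorm (x - x') + enorm (z - z')),
      forall t : R, t \in `[0, T] -> forall x x',
        enorm (c_bbar D t x - c_bbar D t x')
        + enorm (c_sigmabar D t x - c_sigmabar D t x') <= K * enorm (x - x') &
      forall t : R, t \in `[0, T] ->
        enorm (c_b D t 0 0) + enorm (c_sigma D t 0 0)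
        + enorm (c_bbar D t 0) + enorm (c_sigmabar D t 0) <= K].

Definition C1_phi :=
  [/\ {within `[- T, T], continuous (c_phi D)} &
      exists2 dphi : R -> R, {within `[- T, T], continuous dphi} &
        forall t : R, - T < t < T -> is_derive t 1 (c_phi D) (dphi t)].

Definition backward_regular :=
  (exists K r : R, [/\ 0 <= K, 1 <= r, r < q / 2 &
    [/\ forall t : R, t \in `[0, T] -> forall x z z',
          `|c_f D t x z' - c_f D t x z| <= K * enorm (z' - z),
        forall t : R, t \in `[0, T] -> forall x,
          `|c_f D t x 0| + `|c_h D t x 0| + enorm (c_fbar D t x)
            <= K * (1 + enorm x `^ r) &
        forall t : R, t \in `[0, T] -> forall x y y',
          `|c_h D t x y - c_h D t x y'| <= K * `|y - y'|]]) /\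
  {within dom3h, continuous (fun p => c_h D p.1.1 p.1.2 p.2)} /\
  C1_phi.

End data_assumptions.

Section equations.
Variables (R : realType) (disp : measure_display) (Omega : measurableType disp).
Variables (P : probability Omega R) (T : R) (d k m : nat).
Variables (X0 : Omega -> 'rV[R]_d) (W : R -> Omega -> 'rV[R]_m).
Variable D : data R d k m.

Local Notation leb := (@lebesgue_measure R).

Definition mean_field (g : R -> 'rV[R]_d -> 'rV[R]_k)
    (X : R -> Omega -> 'rV[R]_d) (L : R -> Omega -> R) (s : R) : 'rV[R]_k :=
  \row_j \int[P]_w (g s (X s w) ord0 j * L s w).

Definition forward_solution (L : R -> Omega -> R)
    (X : R -> Omega -> 'rV[R]_d) :=
  in_S2 P T X0 W X /\
  exists I : 'I_d -> R -> Omega -> R,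
    (forall j, is_ito_integral P T X0 W
      (fun s w => row j (c_sigma D s (X s w) (mean_field (c_sigmabar D) X L s)))
      (I j)) /\
    {ae P, forall w, forall t : R, t \in `[0, T] -> forall j,
      X t w ord0 j = X0 w ord0 j
        + \int[leb]_(s in `[0, t])
            c_b D s (X s w) (mean_field (c_bbar D) X L s) ord0 j
        + I j t w}.

Definition running (L : R -> Omega -> R) (X : R -> Omega -> 'rV[R]_d)
    (s : R) (w : Omega) : R :=
  c_f D s (X s w) (mean_field (c_fbar D) X L s).

Definition obstacle (L : R -> Omega -> R) (X : R -> Omega -> 'rV[R]_d)
    (t : R) (w : Omega) : R :=
  c_h D t (X t w)
    (\int[P]_w' int_d T 0 (L ^~ w') (fun s => c_phi D (t - s))).

Definition reflected_solution (L : R -> Omega -> R)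
    (X : R -> Omega -> 'rV[R]_d) (Y : R -> Omega -> R)
    (Z : R -> Omega -> 'rV[R]_m) (A : R -> Omega -> R) :=
  [/\ in_S2 P T X0 W (fun t w => vec1 (Y t w)),
      in_H2 P T X0 W Z,
      in_A2 P T X0 W A,
      exists2 I : R -> Omega -> R, is_ito_integral P T X0 W Z I &
        {ae P, forall w, forall t : R, t \in `[0, T] ->
          Y t w = obstacle L X T w
            + \int[leb]_(s in `[t, T]) running L X s w
            + A T w - A t w - (I T w - I t w)} &
      {ae P, forall w, forall t : R, t \in `[0, T] -> obstacle L X t w <= Y t w} /\
      {ae P, forall w,
        (\int[dmeasure T (A ^~ w)]_(t in `[0%R, T])
           (Y t w - obstacle L X t w)%:E = 0)%E}].

Definition stopping_reward (L : R -> Omega -> R) (X : R -> Omega -> 'rV[R]_d)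
    (t : R) (Lh : R -> Omega -> R) (w : Omega) : R :=
  \int[leb]_(s in `[t, T]) (running L X s w * Lh s w)
  - int_d T t (Lh ^~ w) (fun s => obstacle L X s w).

End equations.

(* Main.v *)
(* Let [Lh] be an admissible control at time t and mu = - d Lh, a measure of mass
   one on [t, T].  Exchanging the order of integration, the reward of [Lh] is the
   mu-integral of u |-> int_t^u f ds + xi_u, with xi the obstacle.  The reflected
   equation between t and u turns this integrand into
     Y_t - (Y_u - xi_u) - (A_u - A_t) + (I_u - I_t),
   with I the Ito integral of Z.  The middle terms are nonpositive, and the last
   one contributes a variable with null conditional expectation given F_t: it is
   the limit of sum_i (I_{u_{i+1}} - I_{u_i}) Lh_{u_i}, by dominated convergence,
   the equation itself bounding I by Y, A and int |f| ds.  Hence Y_t is an upper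
   bound.  It is attained by Lh = 1_[0, tau), tau being the first time after t at
   which Y meets xi, as A does not increase on [t, tau].

   The domination needs sup_s E|X_s|^r < oo for r < q / 2, whereas only
   E sup_s |X_s|^2 < oo is given.  With M the maximum of |X| over a grid of
   [a, a + delta] and E_i the event that the running maximum at the i-th time is
   in (lam, 3 lam], the sum of the 1_{E_i} (X_{t_{i+1}} - X_{t_i}) exceeds about
   2 lam as soon as |X_a| <= lam and M > 3 lam.  Its second moment yields the
   good-lambda inequality
     P(M > 3 lam) <= P(|X_a| > lam) + kappa delta P(M > lam) + o(1),
   summed over lam = 3^k with weights 3^(r k), and iterated from the q-th moment
   of X_0.

   The second moment of N(0, s^2) is only bounded by 8 s^2, so that the Ito
   isometry appears as an inequality with a non-optimal constant. *)

Require Import Defs.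
From HB Require Import structures.
From mathcomp Require Import all_boot all_order all_algebra.
From mathcomp Require Import all_classical all_reals all_analysis.
From mathcomp Require Import measurable_realfun.
From mathcomp Require Import ring lra.

Set Implicit Arguments.
Unset Strict Implicit.
Unset Printing Implicit Defensive.

Import Order.TTheory GRing.Theory Num.Theory.
Import numFieldNormedType.Exports.

Local Open Scope classical_set_scope.
Local Open Scope ring_scope.

(** * Integrals and Gaussian moments *)

(** Of the Ito integral only two facts are extracted: mean zero against square-integrable weights
    known at the left end of the window, and a one-sided energy bound with bounded weights of that
    kind. This is why the moments come from sums over grids, whose weights are known at the left end
    of each step, and why the good-lambda inequality concerns grid maxima. Truncating the sum over k
    keeps every quantity finite, so that the term with M can be absorbed into the left-hand side
    once 3^r kappa delta <= 1/2; the bounds obtained are uniform in the truncation. Integrability of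
    the reward is not established for a general control. The upper bound therefore tests V on the
    F_t-set where V >= Y_t + 1/(n+1) and compares integrals by monotonicity alone. Pathwise
    identities hold off a null set, which belongs to F_t by augmentation and can be cut out of every
    test set. Riemann sums do the work for Stieltjes integrals: they give measurability in the
    outcome, the exchange of the order of integration and, after summation by parts, adapted weights
    for the integral of I. *)

Section integral_extra.
Context d (T : measurableType d) (R : realType).
Implicit Types mu : {measure set T -> \bar R}.
Local Open Scope ereal_scope.

Import HBNNSimple.

(* The integral is a difference of suprema over simple functions, so that
   monotonicity needs no measurability. *)
Lemma le_integral_nomeas mu (D : set T) (f g : T -> \bar R) :
  (forall x, D x -> f x <= g x) ->
  \int[mu]_(x in D) f x <= \int[mu]_(x in D) g x.
Proof.
move=> fg.
have fgD x : (f \_ D) x <= (g \_ D) x.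
  by rewrite !patchE; case: ifPn => // /set_mem /fg.
rewrite /integral; apply: leeB; apply: le_ereal_sup => _ [h hu <-];
  exists h => // x; apply: le_trans (hu x) _.
- by rewrite !funeposE ge_max !le_max (fgD x) /= lexx orbT.
- by rewrite !funenegE ge_max !le_max lexx orbT andbT leeN2 fgD.
Qed.

(** Simple functions reduce the claim to their level sets, and monotone convergence does the rest.
    It turns [normal_prob], known on sets, into integration against [normal_pdf]. *)
Lemma ge0_integral_density (nu mu : {measure set T -> \bar R}) (p : T -> R) :
  measurable_fun setT p -> (forall x, (0 <= p x)%R) ->
  (forall A, measurable A -> nu A = \int[mu]_(x in A) (p x)%:E) ->
  forall f : T -> \bar R, measurable_fun setT f -> (forall x, 0 <= f x) ->
  \int[nu]_x f x = \int[mu]_x (f x * (p x)%:E).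
Proof.
move=> mp p0 nuE f mf f0.
pose f_ := nnsfun_approx measurableT mf.
have f_cvg x : (fun n => (f_ n x)%:E) @ \oo --> f x by apply: cvg_nnsfun_approx.
have f_nd x : nondecreasing_seq (fun n => f_ n x).
  by move=> a b ab; exact/lefP/nd_nnsfun_approx.
transitivity (limn (fun n => \int[nu]_x (f_ n x)%:E)).
  rewrite -monotone_convergence//.
  - by apply: eq_integral => x _; apply/esym/cvg_lim.
  - by move=> n; exact/measurable_EFinP/measurable_funP.
  - by move=> n x _; rewrite lee_fin.
  - by move=> x _ a b ab; rewrite lee_fin f_nd.
transitivity (limn (fun n => \int[mu]_x ((f_ n x)%:E * (p x)%:E))); last first.
  rewrite -monotone_convergence//.
  - apply: eq_integral => x _; apply/cvg_lim => //.
    by apply: cvgeZr => //; exact: f_cvg.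
  - by move=> n; apply/measurable_EFinP/measurable_funM => //; exact/measurable_funP.
  - by move=> n x _; rewrite mule_ge0 // lee_fin.
  - by move=> x _ a b ab; rewrite lee_wpmul2r// lee_fin// f_nd.
congr (limn _); apply/funext => n.
have mfn r : measurable (f_ n @^-1` [set r]) by [].
transitivity (\sum_(r \in range (f_ n))
    \int[mu]_x (r * \1_(f_ n @^-1` [set r]) x * p x)%:E).
  rewrite integralT_nnsfun sintegralE; apply: eq_fsbigr => r rf.
  rewrite nuE// integral_mkcond.
  have r0 : (0 <= r)%R by move/set_mem: rf => -[x _ <-].
  rewrite -ge0_integralZl//; last first.
  - move=> x _; rewrite patchE; case: ifP => // _; by rewrite lee_fin.
  - apply/(measurable_restrictT _ _).1 => //. exact/measurable_EFinP/measurable_funTS.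
  apply: eq_integral => x _; rewrite patchE indicE.
  by case: ifP => _; rewrite ?mule0 ?mulr0 ?mul0r ?mulr1.
rewrite -ge0_integral_fsum//.
- apply: eq_integral => x _; rewrite fsumEFin// [in RHS]fimfunE -EFinM; congr EFin.
  rewrite !fsbig_finite//= mulr_suml.
  by [].
- move=> r; apply/measurable_EFinP/measurable_funM => //; exact: measurable_funM.
- move=> r x _. rewrite lee_fin mulr_ge0//.
  by have := nnfun_muleindic_ge0 (f_ n) r x; rewrite lee_fin.
Qed.


End integral_extra.

Section normal_moments.
Variable R : realType.
Local Notation leb := (@lebesgue_measure R).
Implicit Types s : R.

Lemma ge0_integral_normal_prob s (f : R -> \bar R) :
  measurable_fun setT f -> (forall x, 0 <= f x)%E ->
  (\int[normal_prob 0 s]_x f x = \int[leb]_x (f x * (normal_pdf 0 s x)%:E))%E.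
Proof.
move=> mf f0; apply: ge0_integral_density => //.
- exact: measurable_normal_pdf.
- by move=> x; exact: normal_pdf_ge0.
Qed.

Lemma normal_pdfN s x : s != 0 -> normal_pdf 0 s (- x) = normal_pdf 0 s x :> R.
Proof. by move=> s0; rewrite !normal_pdfE// /normal_fun !subr0 sqrrN. Qed.

(** Origin of the constant 8. With y = x^2 / (8 s^2), doubling the deviation halves the peak and
    turns exp(-4y) into exp(-y); the claim becomes 2y <= exp(3y), which follows from 1 + 3y <=
    exp(3y). *)
Lemma sqr_normal_pdf_le s x : 0 < s ->
  x ^+ 2 * normal_pdf 0 s x <= 8 * s ^+ 2 * normal_pdf 0 (2 * s) x.
Proof.
move=> s0; have sN0 : s != 0 by rewrite gt_eqF.
rewrite !normal_pdfE ?mulf_neq0 ?pnatr_eq0// /normal_fun subr0.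
have -> : normal_peak s = 2 * normal_peak (2 * s).
  rewrite /normal_peak.
  have -> : (2 * s) ^+ 2 * pi *+ 2 = 2 ^+ 2 * (s ^+ 2 * pi *+ 2).
    by move: (pi : R) => c; ring.
  rewrite [in RHS]sqrtrM ?sqr_ge0// sqrtr_sqr ger0_norm// invfM mulrA.
  by rewrite divff ?mul1r// pnatr_eq0.
set y := x ^+ 2 / (8 * s ^+ 2).
have y0 : 0 <= y by rewrite divr_ge0 ?sqr_ge0// mulr_ge0// sqr_ge0.
have -> : - x ^+ 2 / ((2 * s) ^+ 2 *+ 2) = - y.
  by rewrite /y -mulr_natr; field.
have -> : - x ^+ 2 / (s ^+ 2 *+ 2) = - y + (- (3 * y)).
  by rewrite /y -mulr_natr; field.
have -> : x ^+ 2 = 8 * s ^+ 2 * y by rewrite /y; field.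
rewrite expRD !expRN.
have := expR_ge1Dx (3 * y); have := expR_gt0 (3 * y); have := expR_gt0 y.
set e := expR y; set e3 := expR (3 * y) => ey0 e30 e3ge.
have -> : 8 * s ^+ 2 * y * (2 * normal_peak (2 * s) * (e^-1 / e3))
    = (8 * s ^+ 2 * (normal_peak (2 * s) * e^-1)) * (2 * y / e3) by ring.
rewrite ler_piMr//.
  by rewrite !mulr_ge0 ?sqr_ge0 ?normal_peak_ge0 ?invr_ge0// ltW.
rewrite ler_pdivrMr// mul1r; lra.
Qed.

Lemma normal_second_moment s : 0 < s ->
  (\int[normal_prob 0 s]_x (x ^+ 2)%:E <= (8 * s ^+ 2)%:E)%E.
Proof.
move=> s0.
rewrite ge0_integral_normal_prob//; last 2 first.
- by apply/measurable_EFinP; exact: exprn_measurable.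
- by move=> x; rewrite lee_fin sqr_ge0.
apply: (@le_trans _ _ (\int[leb]_x ((8 * s ^+ 2)%:E * (normal_pdf 0 (2 * s) x)%:E))%E).
  by apply: le_integral_nomeas => x _; rewrite -!EFinM lee_fin sqr_normal_pdf_le.
rewrite ge0_integralZl//.
- by rewrite integral_normal_pdf mule1.
- by apply/measurable_EFinP; exact: measurable_normal_pdf.
- by move=> x _; rewrite lee_fin normal_pdf_ge0.
- by rewrite lee_fin mulr_ge0// sqr_ge0.
Qed.

(** Reflection preserves both Lebesgue measure and the density. This symmetry, rather than the
    computation of a first moment, is what centres the Brownian increments. *)
Lemma normal_prob_sym s : s != 0 -> forall f : R -> \bar R,
  measurable_fun setT f -> (forall x, 0 <= f x)%E ->
  (\int[normal_prob 0 s]_x f x = \int[normal_prob 0 s]_x f (- x)%R)%E.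
Proof.
move=> s0 f mf f0.
have mN : measurable_fun setT (-%R : measurableTypeR R -> measurableTypeR R).
  exact: oppr_measurable.
have mp : measurable_fun setT (fun x : R => (normal_pdf 0 s x)%:E).
  by apply/measurable_EFinP; exact: measurable_normal_pdf.
rewrite !ge0_integral_normal_prob//; last exact: measurableT_comp.
pose g (x : R) := (f x * (normal_pdf 0 s x)%:E)%E.
have mg : measurable_fun (setT : set (measurableTypeR R)) g by exact: emeasurable_funM.
have g0 : {in (setT : set (measurableTypeR R)), forall x, (0 <= g x)%E}.
  by move=> x _; rewrite mule_ge0// lee_fin normal_pdf_ge0.
have H := ge0_integral_pushforward mN leb measurableT mg g0.
transitivity (\int[leb]_x g x)%E; first by [].
transitivity (\int[pushforward leb (-%R : measurableTypeR R -> measurableTypeR R)]_y g y)%E.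
  by apply: eq_measure_integral => A mA _; apply/esym; exact: lebesgue_measureN.
rewrite {}H preimage_setT; apply: eq_integral => x _ /=.
by rewrite /g normal_pdfN.
Qed.

End normal_moments.

(** * Filtration and Brownian increments *)

Section filtration.
Variables (R : realType) (disp : measure_display) (Omega : measurableType disp).
Variables (P : probability Omega R) (T : R) (d m : nat).
Variables (X0 : Omega -> 'rV[R]_d) (W : R -> Omega -> 'rV[R]_m).
Hypothesis cP : measure_is_complete P.
Hypothesis bmW : brownian_motion P T W.
Hypothesis rX0 : random_vector X0.
Hypothesis iX0 : indep_gens P (rv_gens [set tt] (fun _ => X0)) (rv_gens `[0, T] W).

Local Notation filt := (filt P X0 W).

Lemma rv_gens_measurable (I : Type) (n : nat) (D : set I)
    (X : I -> Omega -> 'rV[R]_n) :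
  (forall i, D i -> random_vector (X i)) -> rv_gens D X `<=` measurable.
Proof.
move=> mX _ [i Di [j _ [B mB <-]]].
exact: mX.
Qed.

Lemma rv_gens_preimage (I : Type) (n : nat) (D : set I)
    (X : I -> Omega -> 'rV[R]_n) i j (B : set (measurableTypeR R)) :
  D i -> measurable B -> <<s rv_gens D X >> ((fun w => X i w ord0 j) @^-1` B).
Proof.
move=> Di mB; apply: sub_sigma_algebra; exists i => //; exists j => //.
by exists B => //; rewrite setTI.
Qed.

Lemma rv_gens_fun (I : Type) (n : nat) (D : set I)
    (X : I -> Omega -> 'rV[R]_n) i j : D i ->
  measurable_fun (setT : set (g_sigma_algebraType (rv_gens D X)))
    (fun w => X i w ord0 j : measurableTypeR R).
Proof. by move=> Di _ B mB; rewrite setTI; exact: rv_gens_preimage. Qed.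

Lemma filt_gens_measurable t : t <= T -> filt t `<=` measurable.
Proof.
move=> tT; rewrite /Defs.filt => A [[|]|].
- by apply: rv_gens_measurable => ? _.
- apply: rv_gens_measurable => s /=; rewrite in_itv/= => /andP[s0 st].
  by case: bmW => H _ _ _ _; apply: H; rewrite in_itv/= s0 (le_trans st).
- exact: cP.
Qed.

Lemma filt_measurable_set t A : t <= T -> <<s filt t >> A -> measurable A.
Proof.
move=> tT; apply: smallest_sub; first exact: sigma_algebra_measurable.
exact: filt_gens_measurable.
Qed.

Lemma filt_mono s t : s <= t -> <<s filt s >> `<=` <<s filt t >>.
Proof.
move=> st; apply: sub_sigma_algebra2 => A [[|]|]; [by left; left| |by right].
move=> [u /=]; rewrite in_itv/= => /andP[u0 us] H; left; right; exists u => //=.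
by rewrite in_itv/= u0 (le_trans us).
Qed.

Lemma filt_negligible t N : P.-negligible N -> <<s filt t >> N.
Proof. by move=> ?; apply: sub_sigma_algebra; right. Qed.

Section filt_fun.
Context d' (U : measurableType d').

Lemma filt_measurable_fun t (f : Omega -> U) : t <= T ->
  measurable_fun (setT : set (g_sigma_algebraType (filt t))) f ->
  measurable_fun setT f.
Proof.
move=> tT mf _ B mB; apply: (filt_measurable_set tT).
by have := mf measurableT B mB.
Qed.

Lemma filt_fun_mono s t (f : Omega -> U) : s <= t ->
  measurable_fun (setT : set (g_sigma_algebraType (filt s))) f ->
  measurable_fun (setT : set (g_sigma_algebraType (filt t))) f.
Proof.
move=> st mf _ B mB; apply: (filt_mono st).
by have := mf measurableT B mB.
Qed.

End filt_fun.

Lemma filt_W s t j : 0 <= s -> s <= t ->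
  measurable_fun (setT : set (g_sigma_algebraType (filt t)))
    (fun w => W s w ord0 j).
Proof.
move=> s0 st _ B mB; rewrite setTI.
have : <<s rv_gens `[0, t] W >> ((fun w => W s w ord0 j) @^-1` B).
  by apply: rv_gens_preimage => //; rewrite /= in_itv/= s0.
by apply: sub_sigma_algebra2 => A HA; left; right.
Qed.

Section increment.
Variables (s t : R) (j : 'I_m).
Hypotheses (s0 : 0 <= s) (st : s < t) (tT : t <= T).
Let Delta w := (W t w - W s w) ord0 j.

Lemma increment_measurable : measurable_fun setT (Delta : Omega -> measurableTypeR R).
Proof.
rewrite /Delta; under eq_fun do rewrite !mxE.
case: bmW => H _ _ _ _.
by apply: measurable_funB; apply: H; rewrite in_itv/= ?s0 ?tT ?andbT//
  ?(le_trans s0) ?(le_trans _ tT)// ltW.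
Qed.

Lemma increment_law (B : set (measurableTypeR R)) : measurable B ->
  P (Delta @^-1` B) = normal_prob 0 (Num.sqrt (t - s)) B.
Proof.
move=> mB; case: bmW => _ _ _ _ /(_ s t s0 st tT).
move=> /(_ (fun i => if i == j then B else setT)) H.
have /H : forall i, measurable (if i == j then B else setT).
  by move=> i; case: ifP.
rewrite (bigD1 j)//= eqxx big1 ?mule1; last first.
  by move=> i /negbTE ->; rewrite probability_setT.
move=> <-; congr (P _); apply/seteqP; split => w /=.
  by move=> Bw i; case: eqP => // ->.
by move=> /(_ j); rewrite eqxx.
Qed.

(* Up to null sets, F_s is generated by the pi-system of the intersections of
   an event of X0 and an event of (W_r), r <= s. *)
Lemma increment_indep A (B : set (measurableTypeR R)) :
  <<s filt s >> A -> measurable B ->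
  P (A `&` Delta @^-1` B) = (P A * P (Delta @^-1` B))%E.
Proof.
move=> FA mB; set D := Delta @^-1` B.
have sT : s <= T by apply: (le_trans (ltW st)).
have mD : measurable D.
  by rewrite -[D]setTI; exact: increment_measurable.
pose S0 := <<s rv_gens [set tt] (fun _ => X0) >>.
pose S1 := <<s rv_gens `[0, s] W >>.
have mS0 : S0 `<=` measurable.
  apply: smallest_sub; first exact: sigma_algebra_measurable.
  exact: rv_gens_measurable.
have sub1 : S1 `<=` <<s rv_gens `[0, T] W >>.
  apply: sub_sigma_algebra2 => C [u /= us HC]; exists u => //=.
  by move: us; rewrite !in_itv/= => /andP[-> /le_trans ->].
have mS : <<s rv_gens `[0, T] W >> `<=` measurable.
  apply: smallest_sub; first exact: sigma_algebra_measurable.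
  by apply: rv_gens_measurable; case: bmW.
have DT : <<s rv_gens `[0, T] W >> D.
  have h u : 0 <= u -> u <= T -> measurable_fun
     (setT : set (g_sigma_algebraType (rv_gens `[0, T] W))) (fun w => W u w ord0 j).
    by move=> u0 uT; apply: rv_gens_fun; rewrite /= in_itv/= u0.
  have /(_ measurableT B mB) : measurable_fun
     (setT : set (g_sigma_algebraType (rv_gens `[0, T] W)))
     (Delta : _ -> measurableTypeR R).
    rewrite (_ : Delta = fun w => W t w ord0 j - W s w ord0 j); last first.
      by apply/funext => w; rewrite /Delta !mxE.
    by apply: measurable_funB; apply: h => //; apply: (le_trans s0); exact: ltW.
  by rewrite setTI.
have Ds : <<s rv_gens [set tt] (fun _ w => W t w - W s w) >> D.
  by have := @rv_gens_preimage unit m [set tt] (fun _ w => W t w - W s w) tt j B erefl mB.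
have ind1 A1 : S1 A1 -> P (A1 `&` D) = (P A1 * P D)%E.
  move=> SA1; case: bmW => _ _ _ /(_ s t s0 st tT D A1 Ds SA1) + _.
  by rewrite setIC muleC.
(* Independence of X0 is applied to the event A1 [&] D of the whole path of W; only then is D split
   off A1. *)
have ind0 A0 A1 : S0 A0 -> S1 A1 -> P (A0 `&` A1 `&` D) = (P (A0 `&` A1) * P D)%E.
  move=> SA0 SA1; rewrite -setIA (iX0 SA0); last first.
    exact: (@measurableI _ (g_sigma_algebraType (rv_gens `[0, T] W)) _ _ (sub1 _ SA1) DT).
  by rewrite ind1// (iX0 SA0 (sub1 _ SA1)) muleA.
pose sd (U V : set Omega) := (U `\` V) `|` (V `\` U).
pose Pi : set (set Omega) := [set A | exists A0 A1, [/\ S0 A0, S1 A1 &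
   P.-negligible (sd A (A0 `&` A1))]].
(* By completeness, a negligible symmetric difference changes neither measurability nor, in [sd_P],
   the probability of any trace. *)
have sd_meas U V : measurable V -> P.-negligible (sd U V) -> measurable U.
  move=> mV nUV.
  have -> : U = (V `\` (V `\` U)) `|` (U `\` V).
    apply/seteqP; split => w /=; have [] := pselect (V w); have [] := pselect (U w); tauto.
  apply: measurableU.
    apply: measurableD => //; apply: cP; apply: negligibleS nUV => w; by right.
  by apply: cP; apply: negligibleS nUV => w; left.
have sd_P U V Z : measurable V -> P.-negligible (sd U V) -> measurable Z ->
    P (U `&` Z) = P (V `&` Z).
  move=> mV nUV mZ; have mU := sd_meas _ _ mV nUV.
  apply/eqP; rewrite eq_le; apply/andP; split.
    rewrite -[leRHS]adde0 -(measure_negligible _ nUV)//; last exact: cP.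
    apply: le_trans (measureU2 _ _ _).
    - apply: le_measure; rewrite ?inE; [exact: measurableI| |].
        by apply: measurableU; [exact: measurableI|exact: cP].
      move=> w [Uw Zw]; have [Vw|nVw] := pselect (V w); first by left.
      by right; left.
    - exact: measurableI.
    - exact: cP.
  rewrite -[leRHS]adde0 -(measure_negligible _ nUV)//; last exact: cP.
  apply: le_trans (measureU2 _ _ _).
  - apply: le_measure; rewrite ?inE; [exact: measurableI| |].
      by apply: measurableU; [exact: measurableI|exact: cP].
    move=> w [Vw Zw]; have [Uw|nUw] := pselect (U w); first by left.
    by right; right.
  - exact: measurableI.
  - exact: cP.
have mPi : Pi `<=` measurable.
  move=> U [A0 [A1 [SA0 SA1 n]]]; apply: sd_meas n; apply: measurableI; first exact: mS0.
  by apply: mS; exact: sub1.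
have PiT : Pi setT.
  exists setT, setT; split.
  - exact: (@measurableT _ (g_sigma_algebraType _)).
  - exact: (@measurableT _ (g_sigma_algebraType _)).
  - rewrite setTI /sd setDv setU0; exact: negligible_set0.
have PiI : setI_closed Pi.
  move=> U V [A0 [A1 [SA0 SA1 nA]]] [B0 [B1 [SB0 SB1 nB]]].
  exists (A0 `&` B0), (A1 `&` B1); split.
  - exact: (@measurableI _ (g_sigma_algebraType (rv_gens [set tt] (fun _ => X0)))).
  - exact: (@measurableI _ (g_sigma_algebraType (rv_gens `[0, s] W))).
  - apply: negligibleS (negligibleU nA nB) => w /=.
    rewrite /sd /=; have [] := pselect (U w); have [] := pselect (V w);
    have [] := pselect (A0 w); have [] := pselect (A1 w);
    have [] := pselect (B0 w); have [] := pselect (B1 w); tauto.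
have filtPi : filt s `<=` Pi.
  move=> C [[HC|HC]|HC].
  - exists C, setT; split; [exact: sub_sigma_algebra| |].
      exact: (@measurableT _ (g_sigma_algebraType _)).
    by rewrite setIT /sd setDv setU0; exact: negligible_set0.
  - exists setT, C; split; [| exact: sub_sigma_algebra|].
      exact: (@measurableT _ (g_sigma_algebraType _)).
    by rewrite setTI /sd setDv setU0; exact: negligible_set0.
  - exists set0, setT; split.
    + exact: (@measurable0 _ (g_sigma_algebraType _)).
    + exact: (@measurableT _ (g_sigma_algebraType _)).
    + by rewrite set0I /sd setD0 set0D setU0.
(* Both sides of the claim are finite measures in A: the restriction of P to D, and P scaled by P D.
   They agree on the pi-system, hence on the sigma-algebra it generates. *)
have PD0 : 0 <= fine (P D) by rewrite fine_ge0.
have PDE : P D = (fine (P D))%:E by rewrite fineK// fin_num_measure.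
have scaleE U : (mscale (NngNum PD0) P U = P U * P D)%E.
  by rewrite /mscale /= -PDE muleC.
rewrite -scaleE.
have -> : P (A `&` D) = mrestr P mD A by [].
apply: (@g_sigma_algebra_measure_unique _ R Omega Pi mPi (fun=> setT)) => //.
- by rewrite bigcup_const//; exists 0%N.
- move=> U [A0 [A1 [SA0 SA1 n]]]; rewrite [RHS]scaleE; change (P (U `&` D) = P U * P D)%E.
  have mA : measurable (A0 `&` A1).
    by apply: measurableI; [exact: mS0|apply: mS; exact: sub1].
  rewrite (sd_P _ _ _ mA n mD) ind0//.
  by have := sd_P _ _ _ mA n measurableT; rewrite !setIT => ->.
- move=> _; apply: le_lt_trans (ltry 1%R); apply: probability_le1; exact: measurableI.
- by apply: (sub_sigma_algebra2 filtPi) FA.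
Qed.

(** Independence makes the joint law of [eta] and the increment a product measure; Tonelli then
    integrates out the Gaussian with [eta] frozen. *)
Lemma integral_increment (eta : Omega -> measurableTypeR R)
    (g : measurableTypeR R * measurableTypeR R -> \bar R) :
  measurable_fun (setT : set (g_sigma_algebraType (filt s))) eta ->
  measurable_fun setT g -> (forall z, 0 <= g z)%E ->
  (\int[P]_w g (eta w, Delta w) =
   \int[P]_w \int[normal_prob 0 (Num.sqrt (t - s))]_y g (eta w, y))%E.
Proof.
move=> meta mg g0.
have sT : s <= T by apply: (le_trans (ltW st)).
have meta' : measurable_fun setT eta by exact: (filt_measurable_fun sT).
have mD := increment_measurable.
have mpair : measurable_fun setT (fun w => (eta w, Delta w : measurableTypeR R)).
  exact/measurable_fun_pair.
pose N := normal_prob 0 (Num.sqrt (t - s)) : {measure set (measurableTypeR R) -> \bar R}.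
pose eta_ : {mfun Omega >-> measurableTypeR R} := mfun_Sub (mem_set meta').
pose pair_ : {mfun Omega >-> (measurableTypeR R * measurableTypeR R)%type} :=
  mfun_Sub (mem_set mpair).
have law := @product_measure_unique _ _ _ _ R (distribution P eta_)
  (normal_prob 0 (Num.sqrt (t - s))) (distribution P pair_).
have {}law : forall X, measurable X ->
    ((distribution P eta_) \x (normal_prob 0 (Num.sqrt (t - s))))%E X = distribution P pair_ X.
  apply: law => A B mA mB; rewrite /distribution /pushforward/=.
  rewrite -(increment_law mB) -increment_indep//; last first.
    by rewrite -[_ @^-1` _]setTI; exact: meta.
rewrite -(ge0_integral_pushforward mpair P measurableT mg)//; last first.
transitivity (\int[distribution P pair_]_z g z)%E; first by [].
transitivity (\int[distribution P eta_ \x normal_prob 0 (Num.sqrt (t - s))]_z g z)%E.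
  by apply: eq_measure_integral => A mA _; apply/esym; exact: law.
rewrite fubini_tonelli1//.
rewrite (ge0_integral_pushforward meta' P measurableT)//.
- exact: measurable_fun_fubini_tonelli_F.
- by move=> x _; apply: integral_ge0 => y _.
Qed.

Lemma increment_second_moment (eta : Omega -> R) :
  measurable_fun (setT : set (g_sigma_algebraType (filt s))) eta ->
  (\int[P]_w ((eta w * Delta w) ^+ 2)%:E <=
   (8 * (t - s))%:E * \int[P]_w (eta w ^+ 2)%:E)%E.
Proof.
move=> meta.
have ts0 : 0 < Num.sqrt (t - s) by rewrite sqrtr_gt0 subr_gt0.
have meta' : measurable_fun setT eta.
  by apply: (filt_measurable_fun _ meta); exact: (le_trans (ltW st)).
have := @integral_increment eta (fun z => ((z.1 * z.2 : R) ^+ 2)%:E) meta.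
move=> ->; last 2 first.
- apply/measurable_EFinP; apply: measurable_funX.
  by apply: measurable_funM; [exact: measurable_fst|exact: measurable_snd].
- by move=> z; rewrite lee_fin sqr_ge0.
rewrite -ge0_integralZl//.
- apply: le_integral_nomeas => w _ /=.
  under eq_integral do rewrite exprMn EFinM.
  rewrite ge0_integralZl//.
  + rewrite [leRHS]muleC lee_wpmul2l// ?lee_fin ?sqr_ge0//.
    apply: le_trans (normal_second_moment ts0) _.
    by rewrite lee_fin sqr_sqrtr// subr_ge0 ltW.
  + by apply/measurable_EFinP; exact: exprn_measurable.
  + by move=> x _; rewrite lee_fin sqr_ge0.
  + by rewrite lee_fin sqr_ge0.
- by apply/measurable_EFinP; exact: measurable_funX.
- by move=> w _; rewrite lee_fin sqr_ge0.
- by rewrite lee_fin mulr_ge0// subr_ge0 ltW.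
Qed.

(** The positive and the negative part of the product have the same integral, the Gaussian law being
    symmetric; integrability excludes the difference of two infinities. *)
Lemma increment_mean (eta : Omega -> R) :
  measurable_fun (setT : set (g_sigma_algebraType (filt s))) eta ->
  P.-integrable setT (fun w => (eta w * Delta w)%:E) ->
  (\int[P]_w (eta w * Delta w)%:E = 0)%E.
Proof.
move=> meta ieta.
have ts0 : 0 < Num.sqrt (t - s) by rewrite sqrtr_gt0 subr_gt0.
pose g (z : R * R) := (Num.max (z.1 * z.2) 0)%:E.
have mg : measurable_fun (setT : set (measurableTypeR R * measurableTypeR R)) g.
  apply/measurable_EFinP; apply: measurable_maxr => //.
  by apply: measurable_funM; [exact: measurable_fst|exact: measurable_snd].
rewrite integralE.
have -> : (\int[P]_w ((fun w => (eta w * Delta w)%:E)^\+)%E w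
   = \int[P]_w g (eta w, Delta w))%E.
  by apply: eq_integral => w _; rewrite funeposE /g /= EFin_max.
have gE : (\int[P]_w ((fun w => (eta w * Delta w)%:E)^\-)%E w
   = \int[P]_w g (eta w, Delta w))%E.
  transitivity (\int[P]_w g ((- eta w)%R, Delta w))%E.
    by apply: eq_integral => w _; rewrite funenegE /g /= EFin_max mulNr.
  have g0 z : (0 <= g z)%E by rewrite lee_fin le_max lexx orbT.
  rewrite !integral_increment//; last exact: measurableT_comp.
  apply: eq_integral => w _.
  rewrite [RHS]normal_prob_sym ?gt_eqF//.
  - by apply: eq_integral => y _; rewrite /g /= mulrN mulNr.
  - apply/measurable_EFinP; apply: measurable_maxr => //.
    by apply: measurable_funM; [exact: measurable_cst|exact: measurable_id].
rewrite gE subee// -gE.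
exact: integrable_neg_fin_num.
Qed.

End increment.
End filtration.

(** * Square-integrable random variables *)

Lemma cvge0_lt (R : realType) (u : nat -> \bar R) (e : R) : 0 < e ->
  (u n @[n --> \oo] --> 0)%E -> \forall n \near \oo, (u n < e%:E)%E.
Proof.
by move=> e0 u0; have := u0 _ (@nbhs_open_ereal_lt R 0 (fun=> e) e0).
Qed.

Section integrable_EFin.
Context d (T : measurableType d) (R : realType) (mu : {measure set T -> \bar R}).
Variable D : set T.
Hypothesis mD : measurable D.
Implicit Types f g : T -> R.

Lemma integrable_EFinD f g : mu.-integrable D (fun x => (f x)%:E) ->
  mu.-integrable D (fun x => (g x)%:E) ->
  mu.-integrable D (fun x => (f x + g x)%:E).
Proof. by move=> /(integrableD mD) /[apply]; apply: eq_integrable. Qed.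

Lemma integrable_EFinB f g : mu.-integrable D (fun x => (f x)%:E) ->
  mu.-integrable D (fun x => (g x)%:E) ->
  mu.-integrable D (fun x => (f x - g x)%:E).
Proof. by move=> /(integrableB mD) /[apply]; apply: eq_integrable. Qed.

Lemma integrable_EFinZl (c : R) f : mu.-integrable D (fun x => (f x)%:E) ->
  mu.-integrable D (fun x => (c * f x)%:E).
Proof. by move=> /(integrableZl mD c); apply: eq_integrable. Qed.

Lemma integrable_EFin_sum (I : Type) (r : seq I) (p : pred I) (F : I -> T -> R) :
  (forall i, p i -> mu.-integrable D (fun x => (F i x)%:E)) ->
  mu.-integrable D (fun x => (\sum_(i <- r | p i) F i x)%:E).
Proof.
move=> iF; have := integrable_sum mD r iF; apply: eq_integrable => // x _.
by rewrite sumEFin.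
Qed.

Lemma Rintegral_sum (I : Type) (r : seq I) (p : pred I) (F : I -> T -> R) :
  (forall i, p i -> mu.-integrable D (fun x => (F i x)%:E)) ->
  \int[mu]_(x in D) (\sum_(i <- r | p i) F i x) =
  \sum_(i <- r | p i) \int[mu]_(x in D) F i x.
Proof.
move=> iF; elim: r => [|i r IH].
  by rewrite big_nil; under eq_Rintegral do rewrite big_nil;
    rewrite /Rintegral integral0.
rewrite big_cons; case: (boolP (p i)) => pi_;
  under eq_Rintegral do rewrite big_cons ?pi_ ?(negbTE pi_); last exact: IH.
rewrite RintegralD ?IH//; first exact: iF.
exact: integrable_EFin_sum.
Qed.

Lemma le_integrable_EFin f g : measurable_fun D f ->
  (forall x, D x -> `|f x| <= g x) -> mu.-integrable D (fun x => (g x)%:E) ->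
  mu.-integrable D (fun x => (f x)%:E).
Proof.
move=> mf fg; apply: le_integrable => //; first exact/measurable_EFinP.
by move=> x Dx; rewrite !abse_EFin lee_fin (le_trans (fg _ Dx))// ler_norm.
Qed.

End integrable_EFin.

Section square_integrable.
Context (R : realType) (disp : measure_display) (Omega : measurableType disp).
Variable P : probability Omega R.
Implicit Types f g : Omega -> R.

Definition sqint f :=
  measurable_fun setT f /\ (\int[P]_w (f w ^+ 2)%:E < +oo)%E.

Lemma sqint_sqr f : sqint f -> P.-integrable setT (fun w => (f w ^+ 2)%:E).
Proof.
move=> [mf f2]; apply/integrableP; split.
  by apply/measurable_EFinP; exact: measurable_funX.
by under eq_integral do rewrite gee0_abs ?lee_fin ?sqr_ge0//.
Qed.

Lemma sqintP f : measurable_fun setT f ->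
  P.-integrable setT (fun w => (f w ^+ 2)%:E) -> sqint f.
Proof.
move=> mf /integrableP[_ f2]; split => //; apply: le_lt_trans f2.
by apply: le_integral_nomeas => w _; rewrite gee0_abs// lee_fin sqr_ge0.
Qed.

Lemma sqint_le f g : measurable_fun setT g -> sqint f ->
  (forall w, `|g w| <= `|f w|) -> sqint g.
Proof.
move=> mg [mf f2] gf; split => //; apply: le_lt_trans f2.
apply: le_integral_nomeas => w _; rewrite lee_fin -[leLHS]ger0_norm ?sqr_ge0//.
by rewrite -[leRHS]ger0_norm ?sqr_ge0// !normrX lerXn2r ?nnegrE.
Qed.

Lemma sqintM f g : sqint f -> sqint g ->
  P.-integrable setT (fun w => (f w * g w)%:E).
Proof.
move=> sf sg.
apply: (@le_integrable_EFin _ _ _ _ _ _ _ (fun w => f w ^+ 2 + g w ^+ 2)) => //.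
- by apply/measurable_funM; [exact: sf.1|exact: sg.1].
- move=> w _; rewrite ler_norml.
  by have := sqr_ge0 (f w - g w); have := sqr_ge0 (f w + g w); rewrite sqrrB sqrrD; nra.
- by apply: integrable_EFinD => //; exact: sqint_sqr.
Qed.

Lemma sqint_cst (c : R) : sqint (fun=> c).
Proof.
split => //; rewrite integral_cst//.
apply: lte_mul_pinfty; rewrite ?lee_fin ?sqr_ge0//.
exact: (le_lt_trans (probability_le1 P measurableT) (ltry 1%R)).
Qed.

Lemma sqint_integrable f : sqint f -> P.-integrable setT (fun w => (f w)%:E).
Proof.
move=> sf; have := sqintM sf (sqint_cst 1).
by under eq_fun do rewrite mulr1.
Qed.

Lemma sqintD f g : sqint f -> sqint g -> sqint (fun w => f w + g w).
Proof.
move=> sf sg; apply: sqintP.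
  by apply: measurable_funD; [exact: sf.1|exact: sg.1].
apply: (@le_integrable_EFin _ _ _ _ _ _ _ (fun w => 2 * f w ^+ 2 + 2 * g w ^+ 2)) => //.
- by apply/measurable_funX/measurable_funD; [exact: sf.1|exact: sg.1].
- move=> w _; rewrite ger0_norm ?sqr_ge0//.
  by have := sqr_ge0 (f w - g w); rewrite sqrrB sqrrD; nra.
- by apply: integrable_EFinD => //; apply: integrable_EFinZl => //; exact: sqint_sqr.
Qed.

Lemma sqint_bounded f g (M : R) : sqint f -> measurable_fun setT g ->
  (forall w, `|g w| <= M) -> sqint (fun w => g w * f w).
Proof.
move=> sf mg gM; apply: sqintP.
  by apply: measurable_funM => //; exact: sf.1.
(* A probability space is not empty, so M bounds an absolute value at some outcome. *)
have M0 : 0 <= M.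
  have [[w _]|/set0P/negP/negPn/eqP e] := pselect ((setT : set Omega) !=set0).
    by apply: le_trans (gM w).
  have := @probability_setT _ _ _ P; rewrite e measure0 => /eqP.
  by rewrite eqe eq_sym oner_eq0.
apply: (@le_integrable_EFin _ _ _ _ _ _ _ (fun w => M ^+ 2 * f w ^+ 2)) => //.
- by apply/measurable_funX/measurable_funM => //; exact: sf.1.
- move=> w _; rewrite ger0_norm ?sqr_ge0// exprMn ler_wpM2r ?sqr_ge0//.
  by rewrite -real_normK ?num_real// lerXn2r ?nnegrE.
- by apply: integrable_EFinZl => //; exact: sqint_sqr.
Qed.

Lemma sqintZ (c : R) f : sqint f -> sqint (fun w => c * f w).
Proof. by move=> sf; exact: (@sqint_bounded _ (fun=> c) `|c|). Qed.

Lemma sqintB f g : sqint f -> sqint g -> sqint (fun w => f w - g w).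
Proof.
move=> sf sg; have := sqintD sf (sqintZ (-1) sg).
by under eq_fun do rewrite mulN1r.
Qed.

Lemma sqint_sum (I : Type) (r : seq I) (p : pred I) (F : I -> Omega -> R) :
  (forall i, p i -> sqint (F i)) -> sqint (fun w => \sum_(i <- r | p i) F i w).
Proof.
move=> sF; elim: r => [|i r IH].
  by under eq_fun do rewrite big_nil; exact: sqint_cst.
case: (boolP (p i)) => pi_;
  under eq_fun do rewrite big_cons ?pi_ ?(negbTE pi_); last exact: IH.
by apply: sqintD => //; exact: sF.
Qed.

Lemma sqint_sum_orthogonal (F : nat -> Omega -> R) n :
  (forall i, (i < n)%N -> sqint (F i)) ->
  (forall i j, (i < j)%N -> (j < n)%N -> \int[P]_w (F i w * F j w) = 0) ->
  \int[P]_w ((\sum_(i < n) F i w) ^+ 2) = \sum_(i < n) \int[P]_w (F i w ^+ 2).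
Proof.
elim: n => [|n IH] sF oF.
  rewrite big_ord0; under eq_Rintegral do rewrite big_ord0 expr0n/=.
  by rewrite Rintegral_cst// mul0r.
have sFn : sqint (F n) by exact: sF.
have sS : sqint (fun w => \sum_(i < n) F i w).
  by apply: sqint_sum => i _; apply: sF; rewrite ltnS ltnW.
under eq_Rintegral do rewrite big_ord_recr/= sqrrD addrAC.
rewrite RintegralD//; last 2 first.
- by apply: integrable_EFinD => //; exact: sqint_sqr.
- have := integrable_EFinZl measurableT 2 (sqintM sS sFn).
  by apply: eq_integrable => // w _; rewrite mulr_natl.
rewrite RintegralD//; [|exact: sqint_sqr|exact: sqint_sqr].
rewrite big_ord_recr/= IH//; last 2 first.
- by move=> i ni; apply: sF; exact: ltnW.
- by move=> i j ij jn; apply: oF => //; exact: ltnW.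
under [X in _ + X]eq_Rintegral do rewrite -mulr_natl.
rewrite RintegralZl//; last exact: sqintM.
under [X in _ * X]eq_Rintegral do rewrite mulr_suml.
suff -> : \int[P]_w (\sum_(i < n) F i w * F n w) = 0 by rewrite mulr0 addr0.
have intF (i : 'I_n) : P.-integrable setT (fun w => (F i w * F n w)%:E).
  by apply: sqintM => //; apply: sF; exact: (ltn_trans (ltn_ord i)).
by rewrite Rintegral_sum// big1// => i _; exact: oF.
Qed.

(** Cauchy-Schwarz in the form |ab| <= c a^2 + b^2 / c: c is taken small for the fixed factor, and
    the vanishing factor then absorbs 1 / c. *)
Lemma sqint_mul_cvg0 f (g : nat -> Omega -> R) : sqint f ->
  (forall n, sqint (g n)) ->
  (\int[P]_w (g n w ^+ 2)%:E @[n --> \oo] --> 0)%E ->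
  \int[P]_w (f w * g n w) @[n --> \oo] --> (0 : R).
Proof.
move=> sf sg g0; apply/cvgr0Pnorm_le => /= e e0.
have f2 : 0 <= fine (\int[P]_w (f w ^+ 2)%:E)%E.
  by rewrite fine_ge0// integral_ge0// => w _; rewrite lee_fin sqr_ge0.
set F := fine _ in f2.
pose c : R := e / (2 * (F + 1)).
have c0 : 0 < c by rewrite divr_gt0// mulr_gt0// ltr_wpDl.
have cF : c * F <= e / 2.
  rewrite /c mulrAC ler_pdivrMr ?mulr_gt0// ?ltr_wpDl//. by nra.
have ce0 : 0 < c * (e / 2) by rewrite mulr_gt0// divr_gt0.
have := cvge0_lt ce0 g0.
apply: filterS => n gn.
have ifg := sqintM sf (sg n).
rewrite -lee_fin EFin_normr_Rintegral//.
apply: (le_trans (le_abse_integral P measurableT (measurable_int _ ifg))).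
apply: (@le_trans _ _ (\int[P]_w (c%:E * (f w ^+ 2)%:E + (c^-1)%:E * (g n w ^+ 2)%:E))%E).
  apply: le_integral_nomeas => w _; rewrite -!EFinM -EFinD abse_EFin lee_fin.
  set a := f w; set b := g n w.
  have -> : c^-1 * b ^+ 2 = c * (c^-1 * b) ^+ 2 by field; rewrite gt_eqF.
  have -> : a * b = c * (a * (c^-1 * b)) by field; rewrite gt_eqF.
  rewrite -mulrDr normrM gtr0_norm// ler_pM2l//.
  set b' := _ * b; rewrite ler_norml; have := sqr_ge0 (a - b'); have := sqr_ge0 (a + b').
  rewrite sqrrB sqrrD; have := sqr_ge0 a; have := sqr_ge0 b'; nra.
rewrite ge0_integralD//; last 4 first.
- by move=> w _; rewrite mule_ge0// lee_fin ?sqr_ge0// ltW.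
- by apply: measurable_funeM; exact: measurable_int (sqint_sqr sf).
- by move=> w _; rewrite mule_ge0// lee_fin ?sqr_ge0// invr_ge0 ltW.
- by apply: measurable_funeM; exact: measurable_int (sqint_sqr (sg n)).
rewrite !integralZl//; [|exact: sqint_sqr|exact: sqint_sqr].
have -> : e%:E = ((e / 2)%:E + (e / 2)%:E)%E by rewrite -EFinD -splitr.
apply: leeD.
  rewrite -[X in (_ * X)%E]fineK; last by exact/integrable_fin_num/sqint_sqr.
  by rewrite -EFinM lee_fin.
rewrite muleC -lee_pdivlMr ?invr_gt0// invrK -EFinM.
by rewrite mulrC ltW.
Qed.

End square_integrable.

(** * Ito integrals *)

Lemma sqr_enorm (R : realType) a b (x : 'M[R]_(a, b)) :
  enorm x ^+ 2 = \sum_i \sum_j x i j ^+ 2.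
Proof.
by rewrite sqr_sqrtr// sumr_ge0// => i _; apply: sumr_ge0 => j _; rewrite sqr_ge0.
Qed.

Lemma enorm_ge0 (R : realType) a b (x : 'M[R]_(a, b)) : 0 <= enorm x.
Proof. exact: sqrtr_ge0. Qed.

Lemma le_entry_enorm (R : realType) a b (x : 'M[R]_(a, b)) i j : `|x i j| <= enorm x.
Proof.
rewrite -sqrtr_sqr ler_wsqrtr// (bigD1 i)//= (bigD1 j)//= -addrA lerDl.
by rewrite addr_ge0// sumr_ge0// => *; rewrite ?sqr_ge0// sumr_ge0// => *; rewrite sqr_ge0.
Qed.

Lemma sqr_sum_le (R : realType) n (F : 'I_n -> R) :
  (\sum_i F i) ^+ 2 <= n%:R * \sum_i F i ^+ 2.
Proof.
elim: n F => [|n IH] F; first by rewrite !big_ord0 expr0n mul0r.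
rewrite !big_ord_recr/=.
set a := \sum_(i < n) _; set x := F ord_max; set b := \sum_(i < n) _ ^+ 2.
have h : a ^+ 2 <= n%:R * b by exact: IH.
have nx : 2 * a * x <= b + n%:R * x ^+ 2.
  case: n F IH @a @x @b h => [|n] F _ a x b h.
    by rewrite /a /b !big_ord0 mulr0 !mul0r addr0.
  have n0 : 0 < n.+1%:R :> R by rewrite ltr0n.
  (* The inequality of the means is weighted by 1/n on a^2, exactly what the induction hypothesis
     a^2 <= n b compensates. *)
  have : 2 * a * x <= n.+1%:R^-1 * a ^+ 2 + n.+1%:R * x ^+ 2.
    rewrite -subr_ge0.
    have -> : n.+1%:R^-1 * a ^+ 2 + n.+1%:R * x ^+ 2 - 2 * a * x
        = n.+1%:R^-1 * (a - n.+1%:R * x) ^+ 2.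
      by field; rewrite gt_eqF.
    by rewrite mulr_ge0 ?invr_ge0 ?sqr_ge0// ltW.
  move/le_trans; apply; rewrite lerD2r.
  by rewrite ler_pdivrMl.
rewrite sqrrD -mulrnAl -mulr_natl -natr1; lra.
Qed.

Section simple_integral.
Variables (R : realType) (disp : measure_display) (Omega : measurableType disp).
Variables (P : probability Omega R) (T : R) (d m : nat).
Variables (X0 : Omega -> 'rV[R]_d) (W : R -> Omega -> 'rV[R]_m).
Hypothesis cP : measure_is_complete P.
Hypothesis bmW : brownian_motion P T W.
Hypothesis rX0 : random_vector X0.
Hypothesis iX0 : indep_gens P (rv_gens [set tt] (fun _ => X0)) (rv_gens `[0, T] W).

Local Notation filt := (filt P X0 W).
Local Notation Fmeas t f :=
  (measurable_fun (setT : set (g_sigma_algebraType (filt t))) (f : Omega -> R)).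

Section brownian_increment.
Variables (s t : R) (j : 'I_m).
Hypotheses (s0 : 0 <= s) (st : s <= t) (tT : t <= T).
Let Delta w := (W t w - W s w) ord0 j.

Lemma increment_adapted : Fmeas t Delta.
Proof.
rewrite (_ : Delta = fun w => W t w ord0 j - W s w ord0 j); last first.
  by apply/funext => w; rewrite /Delta !mxE.
by apply: measurable_funB; apply: filt_W => //; exact: (le_trans s0).
Qed.

(** Empty increments, with s = t, are included because clipping a grid to a window produces them. *)
Lemma increment_variance (eta : Omega -> R) : Fmeas s eta ->
  (\int[P]_w ((eta w * Delta w) ^+ 2)%:E <=
   (8 * (t - s))%:E * \int[P]_w (eta w ^+ 2)%:E)%E.
Proof.
move=> meta; move: st; rewrite le_eqVlt => /predU1P[e|lt_st].
  rewrite integral0_eq; last by move=> w _; rewrite /Delta e subrr mxE mulr0 expr0n.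
  by rewrite mule_ge0 ?lee_fin ?mulr_ge0 ?subr_ge0// integral_ge0// => w _;
    rewrite lee_fin sqr_ge0.
exact: (increment_second_moment cP bmW rX0 iX0 j s0 lt_st tT meta).
Qed.

Lemma sqint_increment (eta : Omega -> R) : Fmeas s eta -> sqint P eta ->
  sqint P (fun w => eta w * Delta w).
Proof.
move=> meta seta; split.
  apply: measurable_funM; first exact: seta.1.
  exact: (filt_measurable_fun cP bmW rX0 tT increment_adapted).
apply: le_lt_trans (increment_variance meta) _.
rewrite lte_mul_pinfty// ?lee_fin ?mulr_ge0 ?subr_ge0//; exact: seta.2.
Qed.

Lemma increment_mean0 (eta : Omega -> R) : Fmeas s eta -> sqint P eta ->
  \int[P]_w (eta w * Delta w) = 0.
Proof.
move=> meta seta; move: st; rewrite le_eqVlt => /predU1P[e|lt_st].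
  under eq_Rintegral do rewrite /Delta e subrr mxE mulr0.
  by rewrite Rintegral_cst// mul0r.
rewrite /Rintegral (increment_mean cP bmW rX0 iX0 s0 lt_st tT meta)//.
exact: sqint_integrable (sqint_increment meta seta).
Qed.

End brownian_increment.

Variable S : simple_integrand P T X0 W.
Local Notation g := (si_grid S).
Local Notation z := (si_coef S).
Local Notation n := (si_size S).

Lemma si_grid_le i j : (i <= j)%N -> (j <= n)%N -> g i <= g j.
Proof.
elim: j => [|j IH]; first by rewrite leqn0 => /eqP ->.
rewrite leq_eqVlt => /predU1P[->//|ij] jn.
by rewrite (le_trans (IH _ _))// ?(ltW (si_grid_lt _))// ltnW.
Qed.

Lemma si_grid_ge0 i : (i <= n)%N -> 0 <= g i.
Proof. by move=> ni; rewrite -(si_grid0 S) si_grid_le. Qed.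

Lemma si_grid_leT i : (i <= n)%N -> g i <= T.
Proof. by move=> ni; have := si_grid_le ni (leqnn _); rewrite si_gridT. Qed.

Section window.
Variables (s t : R).
Hypotheses (s0 : 0 <= s) (st : s <= t) (tT : t <= T).

(** The grid clipped to [s, t]. Steps outside the window collapse and contribute nothing, so the
    integral over a window is a sum over the original steps, without refinement. *)
Let c i := Num.max s (Num.min (g i) t).

Let c_ge i : s <= c i. Proof. by rewrite le_max lexx. Qed.
Let c_le i : c i <= t. Proof. by rewrite ge_max st ge_min lexx orbT. Qed.
Let c0 i : 0 <= c i. Proof. exact: le_trans (c_ge i). Qed.
Let cT i : c i <= T. Proof. exact: le_trans (c_le i) tT. Qed.

Let c_mono i j : (i <= j)%N -> (j <= n)%N -> c i <= c j.
Proof.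
move=> ij jn; rewrite /c ge_max !le_max lexx/=; apply/orP; right.
by rewrite le_min !ge_min lexx orbT si_grid_le.
Qed.

Lemma si_integral_sub w : si_integral S t w - si_integral S s w =
  \sum_(i < n) \sum_(j < m) z i w ord0 j * (W (c i.+1) w - W (c i) w) ord0 j.
Proof.
rewrite /si_integral -sumrB; apply: eq_bigr => i _; rewrite -sumrB.
apply: eq_bigr => j _; rewrite -mulrBr; congr (_ * _); rewrite !mxE.
have h x : W (Num.min x t) w ord0 j - W (Num.min x s) w ord0 j
    = W (Num.max s (Num.min x t)) w ord0 j - W s w ord0 j.
  have [xs|sx] := leP x s; last by rewrite max_r// le_min (ltW sx) st.
  by rewrite min_l ?(le_trans xs st)// max_l// !subrr.
by have := h (g i); have := h (g i.+1); rewrite /c; lra.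
Qed.

Let u (eta : Omega -> R) (j : 'I_m) i w :=
  eta w * z i w ord0 j * (W (c i.+1) w - W (c i) w) ord0 j.

(** When t <= g i, the coefficient [z i] may be unknown at the clipped time [c i], but the step is
    then empty. Hence the repeated case distinction between t and g i below. *)
Let late i : t <= g i -> c i.+1 = c i \/ ~~ (i < n)%N.
Proof.
move=> tg; have [ni|] := boolP (i < n)%N; last by right.
left; rewrite /c !min_r//; exact: (le_trans tg (ltW (si_grid_lt ni))).
Qed.

Let coef_meas i j : (i < n)%N -> g i < t -> Fmeas (c i) (fun w => z i w ord0 j).
Proof.
move=> ni git; have := si_coef_measurable ni; move=> /(_ ord0 j).
apply: filt_fun_mono; rewrite le_max; apply/orP; right.
by rewrite le_min lexx ltW.
Qed.

Let coef_bound i : (i < n)%N -> exists M, forall w j, `|z i w ord0 j| <= M.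
Proof.
move=> /si_coef_bounded[M zM]; exists M => w j.
exact: le_trans (le_entry_enorm _ _ _) (zM w).
Qed.

Let prod_meas eta i j : Fmeas s eta -> (i < n)%N -> g i < t ->
  Fmeas (c i) (fun w => eta w * z i w ord0 j).
Proof.
move=> meta ni git; apply: measurable_funM; last exact: coef_meas.
exact: filt_fun_mono meta.
Qed.

Let prod_sqint eta i j : sqint P eta -> (i < n)%N -> g i < t ->
  sqint P (fun w => eta w * z i w ord0 j).
Proof.
move=> seta ni git; have [M zM] := coef_bound ni.
under eq_fun do rewrite mulrC.
apply: (@sqint_bounded _ _ _ _ _ _ M) => //.
exact: (filt_measurable_fun cP bmW rX0 (cT i) (coef_meas j ni git)).
Qed.

Let u_sqint eta j i : Fmeas s eta -> sqint P eta -> (i < n)%N -> sqint P (u eta j i).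
Proof.
move=> meta seta ni; have [tg|gt] := leP t (g i).
  case: (late tg) => [e|]; last by rewrite ni.
  by rewrite /u; under eq_fun do rewrite e subrr mxE mulr0; exact: sqint_cst.
apply: sqint_increment => //; first exact: c_mono.
- exact: prod_meas.
- exact: prod_sqint.
Qed.

Let u_mean eta j i : Fmeas s eta -> sqint P eta -> (i < n)%N ->
  \int[P]_w u eta j i w = 0.
Proof.
move=> meta seta ni; have [tg|gt] := leP t (g i).
  case: (late tg) => [e|]; last by rewrite ni.
  rewrite /u; under eq_Rintegral do rewrite e subrr mxE mulr0.
  by rewrite Rintegral_cst// mul0r.
apply: increment_mean0 => //; first exact: c_mono.
- exact: prod_meas.
- exact: prod_sqint.
Qed.

Lemma si_integral_mean eta : Fmeas s eta -> sqint P eta ->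
  P.-integrable setT (fun w => (eta w * (si_integral S t w - si_integral S s w))%:E)
  /\ \int[P]_w (eta w * (si_integral S t w - si_integral S s w)) = 0.
Proof.
move=> meta seta.
have E w : eta w * (si_integral S t w - si_integral S s w) =
    \sum_(i < n) \sum_(j < m) u eta j i w.
  rewrite si_integral_sub mulr_sumr; apply: eq_bigr => i _.
  by rewrite mulr_sumr; apply: eq_bigr => j _; rewrite mulrA.
have iu i j : (i < n)%N -> P.-integrable setT (fun w => (u eta j i w)%:E).
  by move=> ni; apply: sqint_integrable; exact: u_sqint.
under eq_fun do rewrite E; under eq_Rintegral do rewrite E; split.
  by apply: integrable_EFin_sum => // i _; apply: integrable_EFin_sum => // j _; exact: iu.
rewrite Rintegral_sum//; last first.
  by move=> i _; apply: integrable_EFin_sum => // j _; exact: iu.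
rewrite big1// => i _; rewrite Rintegral_sum//; last by move=> j _; exact: iu.
by rewrite big1// => j _; exact: u_mean.
Qed.

Lemma sqint_si_integral_sub : sqint P (fun w => si_integral S t w - si_integral S s w).
Proof.
under eq_fun do rewrite si_integral_sub.
apply: sqint_sum => i _; apply: sqint_sum => j _.
have := @u_sqint (cst 1) j i (measurable_cst _) (sqint_cst P 1) (ltn_ord i).
by rewrite /u; under eq_fun do rewrite mul1r.
Qed.

(** The sum is the integral of a step function. At each time at most one interval of the grid is
    active, the process is [z i] there, and the clipped interval is contained in it. *)
Lemma si_process_energy w :
  ((\sum_(i < n) enorm (z i w) ^+ 2 * (c i.+1 - c i))%:E <=
  \int[lebesgue_measure]_(r in `[s, t]) (enorm (si_process S r w) ^+ 2)%:E)%E.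
Proof.
have -> : ((\sum_(i < n) enorm (z i w) ^+ 2 * (c i.+1 - c i))%:E =
  \int[lebesgue_measure]_(r in `[s, t])
     \sum_(i < n) (enorm (z i w) ^+ 2 * \1_(`]c i, c i.+1]) r)%:E)%E.
  rewrite ge0_integral_sum//; last 2 first.
  - by move=> i; apply/measurable_EFinP/measurable_funM => //; exact: measurable_indic.
  - by move=> i r _; rewrite lee_fin mulr_ge0// sqr_ge0.
  rewrite -sumEFin; apply: eq_bigr => i _.
  under eq_integral do rewrite EFinM.
  rewrite ge0_integralZl//; last 2 first.
  - by apply/measurable_EFinP; exact: measurable_indic.
  - by rewrite lee_fin sqr_ge0.
  rewrite integral_indic//= (_ : _ `&` _ = `]c i, c i.+1]%classic); last first.
    apply/seteqP; split => r /=; first by case.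
    rewrite !in_itv/= => /andP[h1 h2]; split; first by rewrite h1.
    by rewrite (le_trans (c_ge i) (ltW h1)) (le_trans h2 (c_le _)).
  rewrite lebesgue_measure_itv/= lte_fin; case: ltP => h; first by rewrite EFinM EFinB.
  rewrite mule0; have := @c_mono i i.+1 (leqnSn _) (ltn_ord i) => h'.
  by have -> : c i.+1 = c i; [apply/le_anti/andP|rewrite subrr mulr0].
apply: le_integral_nomeas => r _; rewrite sumEFin lee_fin.
have sub i : \1_(`]c i, c i.+1]) r != 0 :> R -> g i < r <= g i.+1.
  move=> ri; have : r \in `]c i, c i.+1]%classic.
    by apply: contra_neqT ri; rewrite indicE => /negbTE ->.
  move=> /set_mem /=; rewrite in_itv/= {1}/c gt_max => /andP[/andP[sr h] h'].
  have rt : r <= t by exact: le_trans h' (c_le _).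
  move: h'; rewrite le_max leNgt sr/= le_min rt andbT => ->.
  by rewrite andbT; move: h; rewrite gt_min => /orP[//|]; rewrite ltNge rt.
have [[i ri]|none] := pselect (exists i : 'I_n, \1_(`]c i, c i.+1]) r != 0 :> R); last first.
  rewrite big1 ?sqr_ge0// => i _; have [->|ri] := eqVneq (\1_(`]c i, c i.+1]) r : R) 0.
    by rewrite mulr0.
  by exfalso; apply: none; exists i.
have /andP[gi gi'] := sub _ ri.
have uniq_ (k : 'I_n) : k != i -> ~~ (g k < r <= g k.+1).
  rewrite neq_lt => /orP[ki|ik]; rewrite negb_and -leNgt -ltNge; apply/orP.
  - by right; rewrite (le_lt_trans _ gi)// si_grid_le// ltnW.
  - by left; rewrite (le_trans gi')// si_grid_le// ltnW.
rewrite (bigD1 i)//= big1 ?addr0; last first.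
  move=> k ki; have [->|rk] := eqVneq (\1_(`]c k, c k.+1]) r : R) 0; first by rewrite mulr0.
  by have := uniq_ _ ki; rewrite sub.
rewrite /si_process (bigD1 i)/= ?gi ?gi'// big1 ?addr0; last first.
  by move=> k /andP[h ki]; have := uniq_ _ ki; rewrite h.
rewrite indicE; case: (_ \in _); first by rewrite mulr1.
by rewrite mulr0 sqr_ge0.
Qed.

(** The factor 8 is the Gaussian bound. The factor m comes from Cauchy-Schwarz over the components
    of W, so that orthogonality is only used between different steps of one component, where the
    earlier factors are known at the start of the later step. *)
Lemma si_integral_energy (eta : Omega -> R) (M : R) : Fmeas s eta ->
  (forall w, `|eta w| <= M) ->
  (\int[P]_w ((eta w * (si_integral S t w - si_integral S s w)) ^+ 2)%:E <=
   (8 * m%:R)%:E * \int[P]_w ((eta w ^+ 2)%:E *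
     \int[lebesgue_measure]_(r in `[s, t]) (enorm (si_process S r w) ^+ 2)%:E))%E.
Proof.
move=> meta etaM.
have meta' : measurable_fun setT eta.
  by apply: (filt_measurable_fun cP bmW rX0 _ meta); exact: le_trans tT.
have seta : sqint P eta.
  have := sqint_bounded (sqint_cst P 1) meta' etaM.
  by under eq_fun do rewrite mulr1.
have mz j (i : 'I_n) : measurable_fun setT (fun w => z i w ord0 j).
  apply: (filt_measurable_fun cP bmW rX0 (si_grid_leT (ltnW (ltn_ord i)))).
  exact: si_coef_measurable.
pose v j w := \sum_(i < n) u eta j i w.
have su j i : (i < n)%N -> sqint P (u eta j i) by exact: u_sqint.
have sv j : sqint P (v j) by apply: sqint_sum => i _; exact: su.
have v2 j : (\int[P]_w (v j w ^+ 2)%:E <= \sum_(i < n)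
    (8 * (c i.+1 - c i))%:E * \int[P]_w ((eta w * z i w ord0 j) ^+ 2)%:E)%E.
  have h := @sqint_sum_orthogonal _ _ _ P (u eta j) n (su j).
  have {}h : \int[P]_w (v j w ^+ 2) = \sum_(i < n) \int[P]_w (u eta j i w ^+ 2).
    apply: h => i k ik kn.
    have [tg|gt] := leP t (g k).
      case: (late tg) => [e|]; last by rewrite kn.
      rewrite /u [X in Rintegral _ _ X](_ : _ = cst 0) ?Rintegral_cst ?mul0r//.
      by apply/funext => w; rewrite e subrr [(0 : 'rV_m) _ _]mxE !mulr0.
    have ni := ltn_trans ik kn.
    rewrite /u; under eq_Rintegral do rewrite mulrA.
    have cik : c i.+1 <= c k by apply: c_mono => //; exact: ltnW.
    have Fu : Fmeas (c k) (u eta j i).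
      have [tg|gt'] := leP t (g i).
        case: (late tg) => [e|]; last by rewrite ni.
        rewrite /u (_ : (fun w => _) = cst 0)//.
        by apply/funext => w; rewrite e subrr mxE mulr0.
      apply: (filt_fun_mono cik).
      apply: measurable_funM; last by apply: increment_adapted => //; exact: c_mono.
      apply: (filt_fun_mono (c_mono (leqnSn _) ni)); exact: prod_meas.
    have Fz : Fmeas (c k) (fun w => eta w * z k w ord0 j) by exact: prod_meas.
    have [Mz zM] := coef_bound kn.
    apply: increment_mean0 => //; first exact: c_mono.
    - exact: measurable_funM.
    - under eq_fun do rewrite mulrC.
      apply: (@sqint_bounded _ _ _ _ _ _ (M * Mz)); first exact: su.
        by apply: measurable_funM => //; exact: (mz j (Ordinal kn)).
      by move=> w; rewrite normrM ler_pM.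
  have iv : (\int[P]_w (v j w ^+ 2)%:E)%E \is a fin_num.
    by apply/integrable_fin_num => //; exact: sqint_sqr.
  rewrite -[leLHS]fineK// [fine _]h -sumEFin; apply: lee_sum => i _.
  rewrite fineK; last by apply/integrable_fin_num => //; apply: sqint_sqr; exact: su.
  have [tg|gt] := leP t (g i).
    case: (late tg) => [e|]; last by rewrite ltn_ord.
    rewrite integral0_eq; last by move=> w _; rewrite /u e subrr mxE mulr0 expr0n.
    rewrite mule_ge0// ?lee_fin ?e ?subrr ?mulr0// integral_ge0// => w _.
    by rewrite lee_fin sqr_ge0.
  apply: increment_variance => //; first exact: c_mono.
  exact: prod_meas.
have E w : eta w * (si_integral S t w - si_integral S s w) = \sum_(j < m) v j w.
  rewrite si_integral_sub exchange_big mulr_sumr; apply: eq_bigr => j _.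
  by rewrite mulr_sumr; apply: eq_bigr => i _; rewrite mulrA.
have c1 (i : 'I_n) : 0 <= c i.+1 - c i by rewrite subr_ge0 c_mono.
have mez j (i : 'I_n) : measurable_fun setT (fun w => ((eta w * z i w ord0 j) ^+ 2)%:E).
  by apply/measurable_EFinP/measurable_funX/measurable_funM.
apply: (@le_trans _ _ (m%:R%:E * \sum_(j < m) \int[P]_w (v j w ^+ 2)%:E)%E).
  rewrite -ge0_integral_sum//; last 2 first.
  - by move=> j; apply/measurable_EFinP/measurable_funX; exact: (sv j).1.
  - by move=> j w _; rewrite lee_fin sqr_ge0.
  rewrite -ge0_integralZl//; last 2 first.
  - apply: emeasurable_sum => j.
    by apply/measurable_EFinP/measurable_funX; exact: (sv j).1.
  - by move=> w _; apply: sume_ge0 => j _; rewrite lee_fin sqr_ge0.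
  apply: le_integral_nomeas => w _; rewrite E sumEFin -EFinM lee_fin.
  exact: sqr_sum_le.
apply: (@le_trans _ _ (m%:R%:E * \sum_(j < m) \sum_(i < n)
    (8 * (c i.+1 - c i))%:E * \int[P]_w ((eta w * z i w ord0 j) ^+ 2)%:E)%E).
  by rewrite lee_wpmul2l ?lee_fin//; apply: lee_sum => j _; exact: v2.
rewrite EFinM -muleA muleCA lee_wpmul2l ?lee_fin//.
have -> : (\sum_(j < m) \sum_(i < n)
    (8 * (c i.+1 - c i))%:E * \int[P]_w ((eta w * z i w ord0 j) ^+ 2)%:E =
    8%:E * \int[P]_w \sum_(j < m) \sum_(i < n)
       ((c i.+1 - c i)%:E * ((eta w * z i w ord0 j) ^+ 2)%:E))%E.
  have t0 j (i : 'I_n) w : (0 <= (c i.+1 - c i)%:E * ((eta w * z i w ord0 j) ^+ 2)%:E)%E.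
    by rewrite mule_ge0 ?lee_fin ?sqr_ge0.
  rewrite ge0_integral_sum//; last 2 first.
  - by move=> j; apply: emeasurable_sum => i; exact: measurable_funeM.
  - by move=> j w _; exact: sume_ge0.
  rewrite ge0_sume_distrr; last first.
    by move=> j _; apply: integral_ge0 => w _; exact: sume_ge0.
  apply: eq_bigr => j _; rewrite ge0_integral_sum//; last first.
    by move=> i; exact: measurable_funeM.
  rewrite ge0_sume_distrr; last by move=> i _; exact: integral_ge0.
  apply: eq_bigr => i _; rewrite ge0_integralZl// ?muleA// ?lee_fin// => w _.
  by rewrite lee_fin sqr_ge0.
rewrite lee_wpmul2l ?lee_fin//; apply: le_integral_nomeas => w _.
apply: le_trans (_ : (eta w ^+ 2)%:E * (\sum_(i < n) enorm (z i w) ^+ 2 * (c i.+1 - c i))%:E <= _)%E.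
  rewrite -EFinM exchange_big/= mulr_sumr -sumEFin; apply: lee_sum => i _.
  rewrite sqr_enorm big_ord1 !mulr_suml mulr_sumr -sumEFin; apply: lee_sum => j _.
  by rewrite -EFinM lee_fin exprMn mulrC -mulrA.
rewrite lee_wpmul2l ?lee_fin ?sqr_ge0//.
exact: si_process_energy.
Qed.

End window.
End simple_integral.

Section path_integral.
Context (R : realType) (disp : measure_display) (Omega : measurableType disp).
Variables (A : set (measurableTypeR R)) (mA : measurable A).
Variable f : R -> Omega -> R.
Hypothesis mf : measurable_fun (A `*` setT : set (measurableTypeR R * Omega))
  (fun p => f p.1 p.2).

Lemma measurable_path w : measurable_fun A (fun r => f r w : R).
Proof.
have h : measurable_fun A (fun r : measurableTypeR R => (r, w)).
  by apply: measurable_funTS; apply: measurable_fun_pair; [exact: measurable_id|exact: measurable_cst].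
have mAT : measurable (A `*` setT : set (measurableTypeR R * Omega)).
  by apply: measurableX.
apply: (measurable_comp mAT _ mf h).
by move=> _ [r Ar <-].
Qed.

Lemma measurable_path_integral (B : set (measurableTypeR R)) :
  measurable B -> B `<=` A -> (forall r w, 0 <= f r w) ->
  measurable_fun setT (fun w => \int[lebesgue_measure]_(r in B) (f r w)%:E)%E.
Proof.
move=> mB BA f0.
pose F := ((fun q : measurableTypeR R * Omega => (f q.1 q.2)%:E) \_ (B `*` setT))%E.
have mBT : measurable (B `*` setT : set (measurableTypeR R * Omega)).
  exact: measurableX.
have mF : measurable_fun setT F.
  have mfB : measurable_fun (B `*` setT : set (measurableTypeR R * Omega)) (fun p => f p.1 p.2).
    by apply: measurable_funS mf; [exact: measurableX|move=> p [/BA]].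
  apply: (measurable_restrictT _ mBT).1.
  by apply/measurable_EFinP.
have F0 p : (0 <= F p)%E.
  by rewrite /F patchE; case: ifP => // _; rewrite lee_fin.
have := @measurable_fun_fubini_tonelli_G _ _ _ _ _ lebesgue_measure F mF F0.
apply: eq_measurable_fun => w _; rewrite /fubini_G [in RHS]integral_mkcond.
apply: eq_integral => r _; rewrite /F !patchE.
by congr (if _ then _ else _); apply/idP/idP => /set_mem h; apply/mem_set => //; case: h.
Qed.

End path_integral.

Section ito_integral.
Variables (R : realType) (disp : measure_display) (Omega : measurableType disp).
Variables (P : probability Omega R) (T : R) (d m : nat).
Variables (X0 : Omega -> 'rV[R]_d) (W : R -> Omega -> 'rV[R]_m).
Hypothesis cP : measure_is_complete P.
Hypothesis bmW : brownian_motion P T W.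
Hypothesis rX0 : random_vector X0.
Hypothesis iX0 : indep_gens P (rv_gens [set tt] (fun _ => X0)) (rv_gens `[0, T] W).

Local Notation filt := (filt P X0 W).
Local Notation Fmeas t f :=
  (measurable_fun (setT : set (g_sigma_algebraType (filt t))) (f : Omega -> R)).
Local Notation leb := (@lebesgue_measure R).
Local Notation dom := (`[0, T] `*` setT : set (measurableTypeR R * Omega)).

(** Progressive measurability at the final time T is joint measurability for F_T, which is contained
    in the ambient sigma-algebra by completeness. *)
Lemma progressive_joint n (Y : R -> Omega -> 'rV[R]_n) j : 0 <= T ->
  progressive P T X0 W Y -> measurable_fun dom (fun p => Y p.1 p.2 ord0 j).
Proof.
move=> T0 /(_ T); rewrite in_itv/= T0 lexx => /(_ erefl ord0 j) mY.
pose i (p : measurableTypeR R * Omega) :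
  measurableTypeR R * g_sigma_algebraType (filt T) := (p.1, p.2).
have mi : measurable_fun setT i.
  apply: measurable_fun_pair; first exact: measurable_fst.
  move=> _ B mB; rewrite setTI.
  have mB' : measurable (B : set Omega) by exact: (filt_measurable_set cP bmW rX0 (lexx T)).
  by rewrite -[X in measurable X]setTI; exact: measurable_snd.
have mdom : measurable (`[0, T] `*` setT : set (measurableTypeR R * g_sigma_algebraType (filt T))).
  by apply: measurableX => //; exact: measurable_itv.
apply: (measurable_comp mdom _ mY (measurable_funS measurableT (@subsetT _ _) mi)).
by move=> _ [p [p1 _] <-].
Qed.

Lemma si_process_joint (S : simple_integrand P T X0 W) j :
  measurable_fun dom (fun p => si_process S p.1 p.2 ord0 j).
Proof.
have -> : (fun p : measurableTypeR R * Omega => si_process S p.1 p.2 ord0 j) =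
   (fun p => \sum_(i < si_size S)
      \1_(`]si_grid S i, si_grid S i.+1]) p.1 * si_coef S i p.2 ord0 j).
  apply/funext => p; rewrite /si_process summxE big_mkcond; apply: eq_bigr => i _.
  rewrite indicE mem_setE in_itv/=; case: ifP => _; by rewrite ?mul1r ?mul0r.
apply: measurable_funTS; apply: measurable_sum => i.
apply: measurable_funM.
  apply: (@measurableT_comp _ _ _ _ _ _ (\1_(`]si_grid S i, si_grid S i.+1]) : measurableTypeR R -> R)).
    exact: measurable_indic.
  exact: measurable_fst.
apply: (@measurableT_comp _ _ _ _ _ _ (fun w => si_coef S i w ord0 j)); last exact: measurable_snd.
apply: (filt_measurable_fun cP bmW rX0 (si_grid_leT (ltnW (ltn_ord i)))).
exact: si_coef_measurable.
Qed.

Lemma measurable_sqr_enorm_joint n (D : set (measurableTypeR R * Omega)) (Y : R -> Omega -> 'rV[R]_n) :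
  (forall j, measurable_fun D (fun p => Y p.1 p.2 ord0 j)) ->
  measurable_fun D (fun p => enorm (Y p.1 p.2) ^+ 2).
Proof.
move=> mY; under eq_fun do rewrite sqr_enorm big_ord1.
by apply: measurable_sum => j; apply: measurable_funX; exact: mY.
Qed.

Lemma sqr_enormD n (x y : 'rV[R]_n) :
  enorm (x + y) ^+ 2 <= 2 * enorm x ^+ 2 + 2 * enorm y ^+ 2.
Proof.
rewrite !sqr_enorm !big_ord1 !mulr_sumr -big_split/=; apply: ler_sum => j _.
by rewrite mxE; have := sqr_ge0 (x ord0 j - y ord0 j); rewrite sqrrB sqrrD; nra.
Qed.

Lemma si_integral0 (S : simple_integrand P T X0 W) w : si_integral S 0 w = 0.
Proof.
rewrite /si_integral big1// => i _; rewrite big1// => j _.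
by rewrite !min_r ?subrr ?mxE ?mulr0// si_grid_ge0// ltnW.
Qed.

Section ito.
Variables (Z : R -> Omega -> 'rV[R]_m) (I : R -> Omega -> R).
Hypothesis itoI : is_ito_integral P T X0 W Z I.

Lemma ito_Fmeas t : 0 <= t -> t <= T -> Fmeas t (I t).
Proof.
case: itoI => _ aI _ _ t0 tT; have := aI t; rewrite in_itv/= t0 tT => /(_ erefl ord0 ord0).
by under eq_fun do rewrite mxE.
Qed.

Lemma ito_measurable t : 0 <= t -> t <= T -> measurable_fun setT (I t).
Proof.
by move=> t0 tT; apply: (filt_measurable_fun cP bmW rX0 tT); exact: ito_Fmeas.
Qed.

Lemma sqint_si_integral (S : simple_integrand P T X0 W) t : 0 <= t -> t <= T ->
  sqint P (si_integral S t).
Proof.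
move=> t0 tT; have := sqint_si_integral_sub cP bmW rX0 iX0 S (lexx 0) t0 tT.
by congr (sqint _ _); apply/funext => w; rewrite si_integral0 subr0.
Qed.

Lemma sqint_ito t : 0 <= t -> t <= T -> sqint P (I t).
Proof.
move=> t0 tT; case: itoI => _ _ _ [S [_ /(_ t)]].
rewrite in_itv/= t0 tT => /(_ erefl) /(cvge0_lt ltr01) [N _ /(_ N (leqnn N))] SN.
have sS := sqint_si_integral (S N) t0 tT.
have sD : sqint P (fun w => si_integral (S N) t w - I t w).
  split; last exact: lt_trans SN (ltry _).
  by apply: measurable_funB; [exact: sS.1|exact: ito_measurable].
have := sqintB sS sD; congr (sqint _ _); apply/funext => w; lra.
Qed.

Section window.
Variables (s t : R).
Hypotheses (s0 : 0 <= s) (st : s <= t) (tT : t <= T).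

Let t0 : 0 <= t. Proof. exact: le_trans st. Qed.
Let sT : s <= T. Proof. exact: le_trans tT. Qed.

Lemma sqint_ito_sub : sqint P (fun w => I t w - I s w).
Proof. by apply: sqintB; apply: sqint_ito. Qed.

Let approx : exists S : nat -> simple_integrand P T X0 W,
  [/\ (\int[P]_w \int[leb]_(r in `[0%R, T])
            (enorm (si_process (S n) r w - Z r w) ^+ 2)%:E)%E
          @[n --> \oo] --> 0%E,
     (forall n, sqint P (fun w => (I t w - I s w) -
        (si_integral (S n) t w - si_integral (S n) s w))) &
     (\int[P]_w (((I t w - I s w) -
        (si_integral (S n) t w - si_integral (S n) s w)) ^+ 2)%:E @[n --> \oo] --> 0)%E].
Proof.
case: itoI => _ _ _ [S [SZ SI]]; exists S; split => //.
  move=> n; apply: sqintB; first exact: sqint_ito_sub.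
  exact: sqint_si_integral_sub.
have h1 := SI t; have h2 := SI s; move: h1 h2; rewrite !in_itv/= t0 s0 tT sT.
move=> /(_ erefl) h1 /(_ erefl) h2.
have sD n r : 0 <= r -> r <= T -> sqint P (fun w => si_integral (S n) r w - I r w).
  by move=> r0 rT; apply: sqintB; [exact: sqint_si_integral|exact: sqint_ito].
apply: (@squeeze_cvge _ _ _ _ (fun=> 0%E) _
  (fun n => 2%:E * \int[P]_w ((si_integral (S n) t w - I t w) ^+ 2)%:E
    + 2%:E * \int[P]_w ((si_integral (S n) s w - I s w) ^+ 2)%:E)%E).
- apply: nearW => n; rewrite integral_ge0/=; last by move=> w _; rewrite lee_fin sqr_ge0.
  rewrite -!integralZl//; [|exact/sqint_sqr/sD|exact/sqint_sqr/sD].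
  rewrite -integralD//; [|exact/integrableZl/sqint_sqr/sD|exact/integrableZl/sqint_sqr/sD].
  apply: le_integral_nomeas => w _; rewrite -!EFinM -EFinD lee_fin.
  set a := si_integral _ _ _; set b := si_integral _ _ _; set x := I _ _; set y := I _ _.
  by have := sqr_ge0 ((a - x) + (b - y)); rewrite !expr2; nra.
- exact: cvg_cst.
- rewrite [X in _ --> X](_ : _ = 2%:E * 0 + 2%:E * 0)%E; last by rewrite mule0 adde0.
  apply: cvgeD => //.
  + by apply: cvgeZl => //; exact: h1.
  + by apply: cvgeZl => //; exact: h2.
Qed.

(** Holds for simple integrands, and passes to the L^2 limit because the weight is fixed and
    square-integrable. *)
Lemma ito_mean0 eta : Fmeas s eta -> sqint P eta ->
  \int[P]_w (eta w * (I t w - I s w)) = 0.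
Proof.
move=> meta seta; have [S [_ sg g0]] := approx.
have h := sqint_mul_cvg0 seta sg g0.
have E n : \int[P]_w (eta w * (I t w - I s w)) =
    \int[P]_w (eta w * ((I t w - I s w) - (si_integral (S n) t w - si_integral (S n) s w))).
  have [i1 i2] := si_integral_mean cP bmW rX0 iX0 (S n) s0 st tT meta seta.
  under [RHS]eq_Rintegral do rewrite mulrBr.
  rewrite RintegralB// ?i2 ?subr0//.
  by apply: sqintM => //; exact: sqint_ito_sub.
have {}h : (fun=> \int[P]_w (eta w * (I t w - I s w))) @ \oo --> (0 : R).
  by move: h; apply: cvg_trans; apply: near_eq_cvg; apply: nearW => n; rewrite -(E n).
by apply: cvg_unique h; [exact: norm_hausdorff|exact: cvg_cst].
Qed.

(** The constant is 8 m from simple integrands, doubled when I is replaced by an approximating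
    integral and doubled again when the approximating process is replaced by Z. The bound M on the
    weight only enters the error terms, which vanish. *)
Lemma ito_energy eta M : Fmeas s eta -> (forall w, `|eta w| <= M) ->
  (\int[P]_w ((eta w * (I t w - I s w)) ^+ 2)%:E <=
   (32 * m%:R)%:E * \int[P]_w ((eta w ^+ 2)%:E *
     \int[leb]_(r in `[s, t]) (enorm (Z r w) ^+ 2)%:E))%E.
Proof.
move=> meta etaM; have [S [SZ sg g0]] := approx.
have T0 : 0 <= T by exact: le_trans s0 sT.
have meta' : measurable_fun setT eta by exact: (filt_measurable_fun cP bmW rX0 sT meta).
have [ZH _ _ _] := itoI; have [pZ _] := ZH.
pose EZ := (\int[P]_w ((eta w ^+ 2)%:E *
     \int[leb]_(r in `[s, t]) (enorm (Z r w) ^+ 2)%:E))%E.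
have sub : `[s, t]%classic `<=` `[0, T]%classic.
  by move=> r /=; rewrite !in_itv/= => /andP[sr rt]; rewrite (le_trans s0 sr) (le_trans rt tT).
have mdomT : measurable (`[0, T]%classic : set (measurableTypeR R)) by exact: measurable_itv.
have mst : measurable (`[s, t]%classic : set (measurableTypeR R)) by exact: measurable_itv.
have jZ : measurable_fun dom (fun p => enorm (Z p.1 p.2) ^+ 2).
  by apply: measurable_sqr_enorm_joint => j; exact: progressive_joint.
have jSZ n : measurable_fun dom (fun p => enorm (si_process (S n) p.1 p.2 - Z p.1 p.2) ^+ 2).
  apply: (@measurable_sqr_enorm_joint _ _ (fun r w => si_process (S n) r w - Z r w)) => j.
  rewrite [X in measurable_fun _ X](_ : _ =
    (fun p => si_process (S n) p.1 p.2 ord0 j - Z p.1 p.2 ord0 j)); last first.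
    by apply/funext => p; rewrite !mxE.
  by apply: measurable_funB; [exact: si_process_joint|exact: progressive_joint].
have mpi f : measurable_fun dom (fun p : measurableTypeR R * Omega => f p.1 p.2 : R) ->
    (forall r w, 0 <= f r w) ->
    measurable_fun setT (fun w => \int[leb]_(r in `[s, t]) (f r w)%:E)%E.
  move=> jf f0; exact: (measurable_path_integral mdomT jf mst sub f0).
have eta2 w : (0 <= (eta w ^+ 2)%:E)%E by rewrite lee_fin sqr_ge0.
have meta2 : measurable_fun setT (fun w => (eta w ^+ 2)%:E).
  exact/measurable_EFinP/measurable_funX.
pose b n := (\int[P]_w \int[leb]_(r in `[0%R, T]) (enorm (si_process (S n) r w - Z r w) ^+ 2)%:E)%E.
pose a n := (\int[P]_w (((I t w - I s w) -
        (si_integral (S n) t w - si_integral (S n) s w)) ^+ 2)%:E)%E.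
have main n : (\int[P]_w ((eta w * (I t w - I s w)) ^+ 2)%:E <=
    (32 * m%:R)%:E * EZ + ((32 * m%:R * M ^+ 2)%:E * b n + (2 * M ^+ 2)%:E * a n))%E.
  pose D w := si_integral (S n) t w - si_integral (S n) s w.
  have sD : sqint P D by exact: sqint_si_integral_sub.
  have setaD := sqint_bounded sD meta' etaM.
  have setag := sqint_bounded (sg n) meta' etaM.
  apply: (@le_trans _ _ (2%:E * \int[P]_w ((eta w * D w) ^+ 2)%:E +
     2%:E * \int[P]_w ((eta w * ((I t w - I s w) - D w)) ^+ 2)%:E)%E).
    rewrite -!integralZl//; [|exact/sqint_sqr|exact/sqint_sqr].
    rewrite -integralD//; [|exact/integrableZl/sqint_sqr|exact/integrableZl/sqint_sqr].
    apply: le_integral_nomeas => w _; rewrite -!EFinM -EFinD lee_fin.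
    set x := I t w - I s w; set y := D w.
    rewrite (_ : eta w * x = eta w * y + eta w * (x - y)); last by ring.
    set u := eta w * y; set v := eta w * (x - y).
    by have := sqr_ge0 (u - v); rewrite !expr2; nra.
  rewrite addeA; apply: leeD; last first.
    rewrite EFinM -muleA lee_wpmul2l ?lee_fin//.
    rewrite -integralZl//; last exact/sqint_sqr/sg.
    apply: le_integral_nomeas => w _; rewrite -EFinM lee_fin exprMn ler_wpM2r ?sqr_ge0//.
    by rewrite -real_normK ?num_real// lerXn2r ?nnegrE// (le_trans (normr_ge0 _) (etaM w)).
  have := si_integral_energy cP bmW rX0 iX0 (S n) s0 st tT meta etaM.
  move=> /(@lee_wpmul2l _ 2%:E); rewrite lee_fin => /(_ (ler0n R 2)) /le_trans; apply.
  rewrite muleA -EFinM.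
  apply: (@le_trans _ _ ((2 * (8 * m%:R))%:E * (2%:E * EZ + (2 * M ^+ 2)%:E * b n))%E); last first.
    rewrite ge0_muleDr; last 2 first.
    - by rewrite mule_ge0 ?lee_fin// integral_ge0// => w _; rewrite mule_ge0// integral_ge0// => r _; rewrite lee_fin sqr_ge0.
    - rewrite mule_ge0 ?lee_fin ?(mulr_ge0 (ler0n _ 2) (sqr_ge0 M))// integral_ge0// => w _.
      by rewrite integral_ge0// => r _; rewrite lee_fin sqr_ge0.
    rewrite !muleA -!EFinM.
    by rewrite le_eqVlt; apply/orP; left; apply/eqP; congr (_%:E * _ + _%:E * _)%E; ring.
  rewrite lee_wpmul2l ?lee_fin ?mulr_ge0//.
  apply: (@le_trans _ _ (\int[P]_w (2%:E * ((eta w ^+ 2)%:E *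
     \int[leb]_(r in `[s, t]) (enorm (Z r w) ^+ 2)%:E) +
     (2 * M ^+ 2)%:E * \int[leb]_(r in `[s, t]) (enorm (si_process (S n) r w - Z r w) ^+ 2)%:E))%E).
    apply: le_integral_nomeas => w _.
    apply: (@le_trans _ _ ((eta w ^+ 2)%:E * (2%:E * \int[leb]_(r in `[s, t]) (enorm (Z r w) ^+ 2)%:E
       + 2%:E * \int[leb]_(r in `[s, t]) (enorm (si_process (S n) r w - Z r w) ^+ 2)%:E))%E).
      rewrite lee_wpmul2l//.
      have mp f : measurable_fun dom (fun p : measurableTypeR R * Omega => f p.1 p.2 : R) ->
         measurable_fun `[s, t]%classic (fun r => (f r w)%:E).
        move=> jf; apply/measurable_EFinP.
        by apply: measurable_funS (measurable_path mdomT jf w).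
      rewrite -!ge0_integralZl//; last 4 first.
      - exact: (mp (fun r w => enorm (si_process (S n) r w - Z r w) ^+ 2)).
      - by move=> r _; rewrite lee_fin sqr_ge0.
      - exact: (mp (fun r w => enorm (Z r w) ^+ 2)).
      - by move=> r _; rewrite lee_fin sqr_ge0.
      rewrite -ge0_integralD//; last 4 first.
      - by move=> r _; rewrite -EFinM lee_fin mulr_ge0// sqr_ge0.
      - by apply: measurable_funeM; exact: (mp (fun r w => enorm (Z r w) ^+ 2)).
      - by move=> r _; rewrite -EFinM lee_fin mulr_ge0// sqr_ge0.
      - by apply: measurable_funeM; exact: (mp (fun r w => enorm (si_process (S n) r w - Z r w) ^+ 2)).
      apply: le_integral_nomeas => r _; rewrite -!EFinM -EFinD lee_fin.
      rewrite (le_trans _ (sqr_enormD _ _))//.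
      by rewrite addrC subrK.
    have i0 f : (0 <= \int[leb]_(r in `[s, t]) (enorm (f r : 'rV[R]_m) ^+ 2)%:E)%E.
      by apply: integral_ge0 => r _; rewrite lee_fin sqr_ge0.
    rewrite ge0_muleDr ?mule_ge0//; apply: leeD; first by rewrite muleCA.
    rewrite muleCA [(2 * M ^+ 2)%:E]EFinM -muleA; apply: lee_wpmul2l; first by rewrite lee_fin.
    rewrite lee_wpmul2r// ?lee_fin.
    by rewrite -real_normK ?num_real// lerXn2r ?nnegrE// (le_trans (normr_ge0 _) (etaM w)).
  have i0 (f : R -> Omega -> 'rV[R]_m) w : (0 <= \int[leb]_(r in `[s, t]) (enorm (f r w) ^+ 2)%:E)%E.
    by apply: integral_ge0 => r _; rewrite lee_fin sqr_ge0.
  have mi1 := mpi (fun r w => enorm (Z r w) ^+ 2) jZ (fun r w => sqr_ge0 _).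
  have mi2 := mpi (fun r w => enorm (si_process (S n) r w - Z r w) ^+ 2) (jSZ n) (fun r w => sqr_ge0 _).
  have M20 : (0 <= (2 * M ^+ 2)%:E)%E by rewrite lee_fin (mulr_ge0 (ler0n _ 2) (sqr_ge0 M)).
  rewrite ge0_integralD//; last 4 first.
  - by move=> w _; rewrite !mule_ge0 ?lee_fin ?sqr_ge0//; exact: (i0 Z).
  - by apply: measurable_funeM; exact: emeasurable_funM.
  - by move=> w _; rewrite mule_ge0//; exact: (i0 (fun r w => si_process (S n) r w - Z r w)).
  - exact: measurable_funeM.
  apply: leeD.
    rewrite ge0_integralZl//; first exact: emeasurable_funM.
    by move=> w _; rewrite mule_ge0//; exact: (i0 Z).
  rewrite (ge0_integralZl P measurableT mi2 _ M20); last first.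
    by move=> w _; exact: (i0 (fun r w => si_process (S n) r w - Z r w)).
  apply: (lee_wpmul2l M20); apply: le_integral_nomeas => w _.
  apply: ge0_subset_integral => //.
    by apply/measurable_EFinP; exact: (measurable_path mdomT (f := fun r w => enorm (si_process (S n) r w - Z r w) ^+ 2) (jSZ n) w).
  by move=> r _; rewrite lee_fin sqr_ge0.
have b0 : (b n @[n --> \oo] --> 0)%E by exact: SZ.
apply/lee_addgt0Pr => e e0.
pose c := 32 * m%:R * M ^+ 2 + 2 * M ^+ 2 + 1.
have c1 : 0 <= 32 * m%:R * M ^+ 2 by rewrite mulr_ge0 ?sqr_ge0// mulr_ge0.
have c2 : 0 <= 2 * M ^+ 2 by exact: (mulr_ge0 (ler0n _ 2) (sqr_ge0 M)).
have c0 : 0 < c by rewrite ltr_wpDl// addr_ge0.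
have ec : 0 < e / c by rewrite divr_gt0.
have [N _ HN] := filterI (cvge0_lt ec b0) (cvge0_lt ec g0).
have [bN aN] := HN N (leqnn N).
apply: le_trans (main N) _; rewrite leeD2l//.
apply: (@le_trans _ _ ((32 * m%:R * M ^+ 2)%:E * (e / c)%:E + (2 * M ^+ 2)%:E * (e / c)%:E)%E).
  by apply: leeD; rewrite lee_wpmul2l ?lee_fin//; exact: ltW.
rewrite -!EFinM -EFinD lee_fin -mulrDl mulrCA ler_piMr ?(ltW e0)//.
by rewrite ler_pdivrMr// mul1r /c lerDl.
Qed.

End window.
End ito.
End ito_integral.

(** * Continuous paths *)

Section interval_paths.
Context (R : realType) (T : R).
Hypothesis T0 : 0 <= T.

(** Clamping keeps every term of the enumeration of the rationals inside [0, T], so that countable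
    suprema run over all n without a side condition; indices that encode no rational give the point
    0. *)
Definition itv_point (n : nat) : R :=
  Num.min T (Num.max 0 (if unpickle n is Some q then ratr (q : rat) else 0)).

Lemma itv_pointP n : 0 <= itv_point n <= T.
Proof. by rewrite /itv_point le_min T0 le_max lexx /= ge_min lexx. Qed.

Lemma itv_point_dense t e : 0 <= t <= T -> 0 < e -> exists n, `|itv_point n - t| < e.
Proof.
move=> /andP[t0 tT] e0.
have /rat_in_itvoo[q] : t - e < t + e by rewrite ltrD2l gtrN.
rewrite in_itv/= => /andP[q1 q2]; exists (pickle q).
rewrite /itv_point pickleK; set x := ratr q in q1 q2 *.
by rewrite ltr_distl; apply/andP; split;
  rewrite ?lt_min ?gt_min ?lt_max ?gt_max; case: (ltP 0 x) => x0; case: (ltP x T) => xT //=; try lra;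
  apply/orP; lra.
Qed.

Section one_path.
Context (V : normedModType R).
Implicit Types f : R -> V.

Definition path_cont f := forall x : R, 0 <= x <= T -> forall e : R, 0 < e ->
  exists2 h : R, 0 < h & forall y : R, 0 <= y <= T -> `|y - x| < h -> `|f y - f x| < e.

Lemma path_contP f : {within `[0, T], continuous f} <-> path_cont f.
Proof.
rewrite subspace_continuousP; split => [cf x xT e e0|cf x].
  have := cf x; rewrite /= in_itv/= => /(_ xT) /cvgr_distC_lt /(_ _ e0).
  rewrite near_withinE => /nbhs_ballP[h /= h0 hf]; exists h => // y yT yx.
  apply: hf; last by rewrite /= in_itv/=.
  by rewrite /ball /= distrC.
rewrite /= in_itv/= => xT; apply/cvgrPdist_lt => e e0.
have [h h0 hf] := cf x xT e e0; rewrite near_withinE; apply/nbhs_ballP; exists h => //= y.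
by rewrite /ball/= in_itv/= => xy yT; rewrite distrC hf// distrC.
Qed.

(** Bolzano-Weierstrass in terms of a cluster point, which avoids the extraction of a
    subsequence. *)
Lemma itv_cluster (u : nat -> R) : (forall n, 0 <= u n <= T) ->
  exists2 p, 0 <= p <= T & forall e N, 0 < e -> exists2 n, (N <= n)%N & `|u n - p| < e.
Proof.
move=> uT; have := @segment_compact R 0 T (u @ \oo) _.
case.
  by exists 0%N => // n _ /=; rewrite in_itv/=.
move=> p [] /=; rewrite in_itv/= => pT clp; exists p => // e N e0.
have [x [[n Nn <-] xp]] := clp (u @` [set n | (N <= n)%N]) (ball p e)
  (ltac:(by exists N => // n Nn; exists n)) (nbhsx_ballx _ _ e0).
by exists n => //; rewrite distrC.
Qed.

Lemma path_unif f : path_cont f -> forall e : R, 0 < e ->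
  exists2 h : R, 0 < h & forall x y : R, 0 <= x <= T -> 0 <= y <= T -> `|x - y| < h ->
    `|f x - f y| < e.
Proof.
move=> cf e e0; apply: contrapT => no.
have ex n : exists xy : R * R, [/\ 0 <= xy.1 <= T, 0 <= xy.2 <= T,
    `|xy.1 - xy.2| < n.+1%:R^-1 & e <= `|f xy.1 - f xy.2|].
  apply: contrapT => no'; apply: no; exists n.+1%:R^-1 => // x y xT yT xy.
  by rewrite ltNge; apply/negP => h; apply: no'; exists (x, y).
have [u uP] := choice ex.
have [p pT clp] := @itv_cluster (fun n => (u n).1) (fun n => ltac:(by have [] := uP n)).
have [h h0 hf] := cf p pT (e / 2) (ltac:(by rewrite divr_gt0)).
have h20 : 0 < h / 2 by rewrite divr_gt0.
have [N _ HN] := @near_infty_natSinv_lt R (PosNum h20).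
have [n Nn up] := clp (h / 2) N h20.
have [u1 u2 u12 eu] := uP n.
have {}HN := HN n Nn; rewrite /= in HN.
have f1 : `|f (u n).1 - f p| < e / 2 by apply: hf => //; lra.
have f2 : `|f (u n).2 - f p| < e / 2.
  apply: hf => //; rewrite -(subrKA (u n).1) (le_lt_trans (ler_normD _ _))//.
  by rewrite [ltRHS]splitr ltrD// distrC (lt_trans u12).
have := ler_normD (f (u n).1 - f p) (f p - f (u n).2).
by rewrite subrKA [`|f p - _|]distrC; lra.
Qed.

Lemma path_bounded f : path_cont f -> exists2 M : R, 0 <= M & forall x : R, 0 <= x <= T -> `|f x| <= M.
Proof.
move=> /path_contP cf.
have := continuous_compact cf (@segment_compact R 0 T) => /compact_bounded.
move=> [M [_ HM]]; exists (`|M| + 1) => // x xT.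
apply: (HM (`|M| + 1)); first by rewrite ltr_pwDr// ler_norm.
by exists x => //=; rewrite in_itv.
Qed.

Lemma path_cont_norm f : path_cont f -> forall c,
  (forall n, `|f (itv_point n)| <= c) -> forall t, 0 <= t <= T -> `|f t| <= c.
Proof.
move=> cf c fc t tT; apply/ler_addgt0Pr => e e0.
have [h h0 hf] := cf t tT e e0.
have [n nt] := itv_point_dense tT h0.
have := hf _ (itv_pointP n) nt; have := fc n.
by have := ler_normB (f (itv_point n)) (f (itv_point n) - f t); rewrite opprB addrC subrK; lra.
Qed.

End one_path.
End interval_paths.

(** Enumerates pairs, so that a supremum over two times is the supremum of a sequence and is
    measurable as such. *)
Definition nat_pair (n : nat) : nat * nat :=
  if unpickle n is Some kl then kl else (0, 0)%N.

Lemma nat_pair_surj kl : exists n, nat_pair n = kl.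
Proof. by exists (pickle kl); rewrite /nat_pair pickleK. Qed.

Section path_sup.
Context (R : realType) (T : R) (V : normedModType R).
Context (disp : measure_display) (Omega : measurableType disp).
Hypothesis T0 : 0 <= T.
Variable X : R -> Omega -> V.
Hypothesis cX : forall w, path_cont T (X ^~ w).

(* The suprema are taken over a countable dense set of times, to be measurable
   in the outcome. *)
Definition path_sup w : R := sup (range (fun n => `|X (itv_point T n) w|)).

Definition path_osc (h : R) w : R := sup (range (fun n =>
  let: (k, l) := nat_pair n in
  if `|itv_point T k - itv_point T l| < h
  then `|X (itv_point T k) w - X (itv_point T l) w| else 0)).

Let sup_ub w : has_ubound (range (fun n => `|X (itv_point T n) w|)).
Proof.
have [M _ XM] := path_bounded (cX w).
by exists M => _ [n _ <-]; apply: XM; exact: itv_pointP.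
Qed.

Lemma le_path_sup t w : 0 <= t <= T -> `|X t w| <= path_sup w.
Proof.
move=> tT; apply: (path_cont_norm T0 (cX w)) tT => n.
by apply: (ub_le_sup (sup_ub w)); exists n.
Qed.

Lemma path_sup_ge0 w : 0 <= path_sup w.
Proof. by apply: le_trans (le_path_sup w (t := 0) _); rewrite ?normr_ge0// lexx. Qed.

Lemma path_sup_le w c : (forall t : R, 0 <= t <= T -> `|X t w| <= c) -> path_sup w <= c.
Proof.
move=> Xc; apply: ge_sup.
  by exists `|X (itv_point T 0) w|; exists 0%N.
by move=> _ [n _ <-]; apply: Xc; exact: itv_pointP.
Qed.

Lemma measurable_path_sup :
  (forall t : R, 0 <= t <= T -> measurable_fun setT (fun w => `|X t w| : R)) ->
  measurable_fun setT path_sup.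
Proof.
move=> mX.
have := @measurable_fun_sups _ _ R setT (fun n w => `|X (itv_point T n) w|) 0%N.
move=> /(_ (fun w _ => sup_ub w)) H.
have -> : path_sup = (fun x => sups ((fun n w => `|X (itv_point T n) w|) ^~ x) 0).
  apply/funext => w; rewrite /path_sup /sups /=; congr sup.
  by apply/seteqP; split => _ [n _ <-]; exists n.
by apply: H => n; apply: mX; exact: itv_pointP.
Qed.

Let osc_ub (h : R) w : has_ubound (range (fun n =>
  let: (k, l) := nat_pair n in
  if `|itv_point T k - itv_point T l| < h
  then `|X (itv_point T k) w - X (itv_point T l) w| else 0)).
Proof.
exists (path_sup w + path_sup w) => _ [n _ <-].
have s0 := path_sup_ge0 w.
case: nat_pair => k l.
case: ifP => _; last by rewrite addr_ge0.
by rewrite (le_trans (ler_normB _ _))// lerD// le_path_sup// itv_pointP.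
Qed.

Lemma path_osc_ge0 h w : 0 <= path_osc h w.
Proof.
have := ub_le_sup (osc_ub h w) (ltac:(by exists 0%N)).
by move=> /(le_trans _); apply; case: (nat_pair 0) => k l; case: ifP.
Qed.

Lemma path_osc_le h w c : 0 <= c ->
  (forall s t : R, 0 <= s <= T -> 0 <= t <= T -> `|s - t| < h -> `|X s w - X t w| <= c) ->
  path_osc h w <= c.
Proof.
move=> c0 Xc; apply: ge_sup; first by eexists; exists 0%N.
move=> _ [n _ <-]; case: nat_pair => k l.
by case: ifP => // kl; apply: Xc => //; exact: itv_pointP.
Qed.

Lemma path_osc_le_sup h w : path_osc h w <= 2 * path_sup w.
Proof.
apply: path_osc_le => [|s t sT tT _]; first by rewrite mulr_ge0// path_sup_ge0.
by rewrite (le_trans (ler_normB _ _))// mulr_natl mulr2n lerD// le_path_sup.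
Qed.

Lemma le_path_osc h w s t : 0 <= s <= T -> 0 <= t <= T -> `|s - t| < h ->
  `|X s w - X t w| <= path_osc h w.
Proof.
move=> sT tT st; apply/ler_addgt0Pr => e e0.
have e20 : 0 < e / 2 by rewrite divr_gt0.
have [a a0 ha] := cX w sT e20.
have [b b0 hb] := cX w tT e20.
(* Giving half of the slack h - |s - t| to each endpoint keeps the approximating pair closer than
   h. *)
have k0 : 0 < (h - `|s - t|) / 2 by rewrite divr_gt0// subr_gt0.
have [k ks] := itv_point_dense sT (ltac:(by rewrite lt_min a0 k0) : 0 < Num.min a ((h - `|s - t|) / 2)).
have [l lt] := itv_point_dense tT (ltac:(by rewrite lt_min b0 k0) : 0 < Num.min b ((h - `|s - t|) / 2)).
move: ks lt; rewrite !lt_min => /andP[ka kh] /andP[lb lh].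
have Xk := ha _ (itv_pointP T0 k) ka; have Xl := hb _ (itv_pointP T0 l) lb.
set sk := itv_point T k in ka kh Xk *; set tl := itv_point T l in lb lh Xl *.
have kl : `|sk - tl| < h.
  rewrite (_ : sk - tl = (sk - s) + (s - t) - (tl - t)); last by ring.
  by rewrite (le_lt_trans (ler_normB _ _))// (le_lt_trans (lerD (ler_normD _ _) (lexx _)))//; lra.
have osc_kl : `|X sk w - X tl w| <= path_osc h w.
  have [n nE] := nat_pair_surj (k, l).
  by apply: (ub_le_sup (osc_ub h w)); exists n => //; rewrite nE kl.
rewrite (_ : X s w - X t w = (X sk w - X tl w) - (X sk w - X s w) + (X tl w - X t w)); last first.
  by rewrite opprB (addrC (X sk w - X tl w)) !subrKA.
rewrite (le_trans (ler_normD _ _))// (le_trans (lerD (ler_normB _ _) (lexx _)))//; lra.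
Qed.

Lemma path_osc_small w (e : R) : 0 < e -> exists2 h0 : R, 0 < h0 & forall h : R, h <= h0 -> path_osc h w <= e.
Proof.
move=> e0; have [h0 h00 H] := path_unif (cX w) e0; exists h0 => // h hh0.
by apply: path_osc_le => [|s t sT tT st]; apply: ltW => //; apply: H => //; exact: lt_le_trans hh0.
Qed.

Lemma measurable_path_osc h :
  (forall s t : R, 0 <= s <= T -> 0 <= t <= T -> measurable_fun setT (fun w => `|X s w - X t w| : R)) ->
  measurable_fun setT (path_osc h).
Proof.
move=> mX.
pose F n w : R := let: (k, l) := nat_pair n in
  if `|itv_point T k - itv_point T l| < h
  then `|X (itv_point T k) w - X (itv_point T l) w| else 0.
have := @measurable_fun_sups _ _ R setT F 0%N (fun w _ => osc_ub h w).
have -> : path_osc h = (fun x => sups (F ^~ x) 0).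
  apply/funext => w; rewrite /path_osc /sups /=; congr sup.
  by apply/seteqP; split => _ [n _ <-]; exists n.
apply => n; rewrite /F; case: nat_pair => k l.
by case: (_ < h); [apply: mX; exact: itv_pointP|exact: measurable_cst].
Qed.

End path_sup.

Section matrix_norm.
Context (R : realType).

Lemma le_entry_norm n (x : 'rV[R]_n) j : `|x ord0 j| <= `|x|.
Proof.
rewrite [leRHS]mx_normrE.
by apply: (le_bigmax_cond _ (fun ij : 'I_1 * 'I_n => `|x ij.1 ij.2|) (j := (ord0, j))).
Qed.

Lemma norm_le_entries n (x : 'rV[R]_n) c : 0 <= c -> (forall j, `|x ord0 j| <= c) -> `|x| <= c.
Proof.
move=> c0 xc; rewrite [leLHS]mx_normrE; apply: bigmax_le => // -[i j] _ /=.
by rewrite ord1.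
Qed.

Lemma norm_le_enorm n (x : 'rV[R]_n) : `|x| <= enorm x.
Proof. by apply: norm_le_entries => [|j]; [exact: enorm_ge0|exact: le_entry_enorm]. Qed.

Lemma enorm_le_norm n (x : 'rV[R]_n) : enorm x <= n%:R * `|x|.
Proof.
rewrite -(@ler_pXn2r _ 2)// ?nnegrE ?enorm_ge0 ?mulr_ge0//.
rewrite sqr_enorm big_ord1 exprMn.
apply: (@le_trans _ _ (\sum_(j < n) `|x| ^+ 2)).
  apply: ler_sum => j _; rewrite -real_normK ?num_real// lerXn2r ?nnegrE//.
  exact: le_entry_norm.
rewrite sumr_const card_ord -[leLHS]mulr_natl ler_wpM2r ?sqr_ge0// -natrX ler_nat.
by case: n {x} => // n; rewrite expnS leq_pmulr// expn_gt0.
Qed.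

Lemma measurable_mx_norm d (U : measurableType d) (D : set U) n (x : U -> 'rV[R]_n) :
  (forall j, measurable_fun D (fun u => x u ord0 j)) ->
  measurable_fun D (fun u => `|x u|).
Proof.
move=> mx.
rewrite [X in measurable_fun _ X](_ : _ = (fun u => \big[Num.max/0]_(ij : 'I_1 * 'I_n) `|x u ij.1 ij.2|)); last first.
  by apply/funext => u; exact: mx_normrE.
rewrite unlock; elim: (index_enum _) => [|[i j] r IH] /=; first exact: measurable_cst.
apply: measurable_maxr => //; apply: measurableT_comp => //.
by rewrite ord1; exact: mx.
Qed.

End matrix_norm.

(** * Joint measurability *)

Section borel_composition.
Context (R : realType).

(** Second countability, in the form of [base], writes every open set as a countable union of sets
    whose preimages are measurable. *)
Lemma measurable_fun_borel_base (C : countType) (V : ptopologicalType)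
    (base : C -> nat -> set V) d (Z : measurableType d) (D : set Z) (phi : Z -> V) :
  (forall O x, open O -> O x -> exists c n, base c n x /\ base c n `<=` O) ->
  (forall c n, measurable (D `&` phi @^-1` base c n)) ->
  measurable_fun D (phi : Z -> g_sigma_algebraType (@open V)).
Proof.
move=> baseP mbase mD.
move=> B mB; apply: (@measurability _ _ Z (g_sigma_algebraType (@open V)) D phi (@open V)) => //.
move=> _ [G oG <-].
pose U (k : nat) := if (unpickle k : option (C * nat)) is Some cn
   then if asbool (base cn.1 cn.2 `<=` G) then D `&` phi @^-1` base cn.1 cn.2 else set0
   else set0.
rewrite (_ : _ `&` _ = \bigcup_k U k).
  apply: bigcupT_measurable => k; rewrite /U; case: unpickle => [cn|]//.
  by case: ifP.
apply/seteqP; split => [z [Dz Oz]|z [k _]].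
  have [c [n [bz bO]]] := baseP _ _ oG Oz.
  exists (pickle (c, n)) => //; rewrite /U pickleK/=.
  by case: asboolP.
rewrite /U; case: unpickle => [[c n]|]//=.
by case: asboolP => // bO [Dz bz]; split => //; exact: bO.
Qed.

Section balls.
Context (C : countType) (V : pseudoMetricType R) (c : C -> V).

Definition ball_dense := forall x (e : R), 0 < e -> exists q, ball (c q) e x.

Lemma ball_dense_base : ball_dense -> forall O x, open O -> O x ->
  exists q n, ball (c q) n.+1%:R^-1 x /\ ball (c q) n.+1%:R^-1 `<=` O.
Proof.
move=> dc O x oO Ox.
have : nbhs x O by exact: open_nbhs_nbhs.
move=> /nbhs_ballP[e /= e0 eO].
have e20 : 0 < e / 2 by rewrite divr_gt0.
have [N _ HN] := @near_infty_natSinv_lt R (PosNum e20).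
have {}HN := HN N (leqnn N); rewrite /= in HN.
have [|q qx] := dc x N.+1%:R^-1; first by rewrite invr_gt0.
exists q, N; split => // y qy; apply: eO.
rewrite [e]splitr; apply: (@ball_triangle _ _ (c q)).
  by apply: ball_sym; apply: le_ball qx; exact: ltW.
by apply: le_ball qy; exact: ltW.
Qed.

Definition ball_measurable d (Z : measurableType d) (D : set Z) (phi : Z -> V) :=
  forall q (e : R), 0 < e -> measurable (D `&` phi @^-1` ball (c q) e).

End balls.

Lemma ball_dense_R : ball_dense (fun q : rat => ratr q : R).
Proof.
move=> x e e0; have /rat_in_itvoo[q] : x - e < x + e by rewrite ltrD2l gtrN.
rewrite in_itv/= => /andP[q1 q2]; exists q.
by rewrite /ball/= ltr_distl; apply/andP; split; lra.
Qed.

Lemma ball_dense_rV n : ball_dense (fun q : 'rV[rat]_n => map_mx (@ratr R) q).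
Proof.
move=> x e e0.
have /choice[f fP] : forall j : 'I_n, exists q : rat, ball (ratr q : R) e (x ord0 j).
  by move=> j; exact: ball_dense_R.
exists (\row_j f j); split => // i j.
by rewrite !mxE ord1; exact: fP.
Qed.

Lemma ball_dense_pair (C1 C2 : countType) (V1 V2 : pseudoMetricType R)
    (c1 : C1 -> V1) (c2 : C2 -> V2) : ball_dense c1 -> ball_dense c2 ->
  ball_dense (fun q : C1 * C2 => (c1 q.1, c2 q.2)).
Proof.
move=> d1 d2 [x y] e e0; have [q qx] := d1 x e e0; have [r ry] := d2 y e e0.
by exists (q, r); split.
Qed.

Section measurable_balls.
Context d (Z : measurableType d) (D : set Z).
Hypothesis mD : measurable D.

Lemma ball_measurable_R (phi : Z -> R) : measurable_fun D phi ->
  ball_measurable (fun q : rat => ratr q : R) D phi.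
Proof.
move=> mphi q e e0.
have -> : ball (ratr q : R) e = `]ratr q - e, ratr q + e[%classic.
  by apply/seteqP; split => y; rewrite /ball/= in_itv/= ltr_distlC.
by apply: mphi => //; exact: measurable_itv.
Qed.

Lemma ball_measurable_rV n (phi : Z -> 'rV[R]_n) :
  (forall j, measurable_fun D (fun z => phi z ord0 j)) ->
  ball_measurable (fun q : 'rV[rat]_n => map_mx (@ratr R) q) D phi.
Proof.
move=> mphi q e e0.
have -> : D `&` phi @^-1` ball (map_mx (@ratr R) q) e =
  D `&` \bigcap_(j in [set: 'I_n]) (D `&` (fun z => phi z ord0 j) @^-1` ball (ratr (q ord0 j) : R) e).
  apply/seteqP; split => z [Dz h]; split => //.
    by move=> j _; split => //; have [_ /(_ ord0 j)] := h; rewrite mxE.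
  split => // i j; have [_] := h j I.
  by rewrite /= (ord1 i) !mxE.
apply: measurableI => //; apply: fin_bigcap_measurable => // j _.
exact: ball_measurable_R.
Qed.

Lemma ball_measurable_pair (C1 C2 : countType) (V1 V2 : pseudoMetricType R)
    (c1 : C1 -> V1) (c2 : C2 -> V2) (phi1 : Z -> V1) (phi2 : Z -> V2) :
  ball_measurable c1 D phi1 -> ball_measurable c2 D phi2 ->
  ball_measurable (fun q : C1 * C2 => (c1 q.1, c2 q.2)) D (fun z => (phi1 z, phi2 z)).
Proof.
move=> m1 m2 q e e0.
have := measurableI _ _ (m1 q.1 e e0) (m2 q.2 e e0).
congr (measurable _); apply/seteqP; split => z /=.
  by move=> [[Dz h1] [_ h2]].
by move=> [Dz [h1 h2]].
Qed.

Variable T : R.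

(** The coefficient is Borel for the open sets of a product space, whereas its arguments are
    measurable coordinate by coordinate. Balls with rational centres connect the two: they are
    products, and they form a countable base. *)
Lemma measurable_fun_comp3 n k (g : R -> 'rV[R]_n -> 'rV[R]_k -> R)
    (tau : Z -> R) (xi : Z -> 'rV[R]_n) (zeta : Z -> 'rV[R]_k) :
  borel_fun (`[0, T] `*` setT `*` setT : set (R * 'rV[R]_n * 'rV[R]_k))
    (fun p => g p.1.1 p.1.2 p.2) ->
  measurable_fun D tau -> (forall z, D z -> 0 <= tau z <= T) ->
  (forall j, measurable_fun D (fun z => xi z ord0 j)) ->
  (forall j, measurable_fun D (fun z => zeta z ord0 j)) ->
  measurable_fun D (fun z => g (tau z) (xi z) (zeta z)).
Proof.
move=> mg mtau tauT mxi mzeta.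
pose V := (R * 'rV[R]_n * 'rV[R]_k)%type.
pose phi z : V := (tau z, xi z, zeta z).
have mphi : measurable_fun D (phi : Z -> g_sigma_algebraType (@open V)).
  have dns := ball_dense_pair (ball_dense_pair ball_dense_R (@ball_dense_rV n)) (@ball_dense_rV k).
  apply: (measurable_fun_borel_base (ball_dense_base dns)) => q m.
  have bm := ball_measurable_pair (ball_measurable_pair (ball_measurable_R mtau)
    (ball_measurable_rV mxi)) (ball_measurable_rV mzeta).
  by apply: (bm q); rewrite invr_gt0.
have mdom : measurable (`[0, T] `*` setT `*` setT : set (g_sigma_algebraType (@open V))).
  rewrite -[X in measurable X]setCK; apply: measurableC; apply: sub_sigma_algebra.
  rewrite (_ : ~` _ = (fun p : V => p.1.1) @^-1` (~` `[0, T])).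
    apply: open_comp; last by apply: closed_openC; exact: interval_closed.
    by move=> p _; apply: continuous_comp; exact: cvg_fst.
  by apply/seteqP; split => p /= h; [move=> h'; apply: h; split|move=> [[]]].
apply: (measurable_comp mdom _ mg mphi).
by move=> _ [z Dz <-]; split => //; split => //=; rewrite in_itv/=; exact: tauT.
Qed.

Lemma measurable_fun_comp2 n (g : R -> 'rV[R]_n -> R)
    (tau : Z -> R) (xi : Z -> 'rV[R]_n) :
  borel_fun (`[0, T] `*` setT : set (R * 'rV[R]_n)) (fun p => g p.1 p.2) ->
  measurable_fun D tau -> (forall z, D z -> 0 <= tau z <= T) ->
  (forall j, measurable_fun D (fun z => xi z ord0 j)) ->
  measurable_fun D (fun z => g (tau z) (xi z)).
Proof.
move=> mg mtau tauT mxi.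
pose V := (R * 'rV[R]_n)%type.
pose phi z : V := (tau z, xi z).
have mphi : measurable_fun D (phi : Z -> g_sigma_algebraType (@open V)).
  have dns := ball_dense_pair ball_dense_R (@ball_dense_rV n).
  apply: (measurable_fun_borel_base (ball_dense_base dns)) => q m.
  apply: ball_measurable_pair; last by rewrite invr_gt0.
  - exact: ball_measurable_R.
  - exact: ball_measurable_rV.
have mdom : measurable (`[0, T] `*` setT : set (g_sigma_algebraType (@open V))).
  rewrite -[X in measurable X]setCK; apply: measurableC; apply: sub_sigma_algebra.
  rewrite (_ : ~` _ = (fun p : V => p.1) @^-1` (~` `[0, T])).
    apply: open_comp; last by apply: closed_openC; exact: interval_closed.
    by move=> p _; exact: cvg_fst.
  by apply/seteqP; split => p /= h; [move=> h'; apply: h; split|move=> []].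
apply: (measurable_comp mdom _ mg mphi).
by move=> _ [z Dz <-]; split => //=; rewrite in_itv/=; exact: tauT.
Qed.

Lemma measurable_fun_comp3R n (g : R -> 'rV[R]_n -> R -> R)
    (tau : Z -> R) (xi : Z -> 'rV[R]_n) (zeta : Z -> R) :
  borel_fun (`[0, T] `*` setT `*` setT : set (R * 'rV[R]_n * R))
    (fun p => g p.1.1 p.1.2 p.2) ->
  measurable_fun D tau -> (forall z, D z -> 0 <= tau z <= T) ->
  (forall j, measurable_fun D (fun z => xi z ord0 j)) ->
  measurable_fun D zeta ->
  measurable_fun D (fun z => g (tau z) (xi z) (zeta z)).
Proof.
move=> mg mtau tauT mxi mzeta.
pose V := (R * 'rV[R]_n * R)%type.
pose phi z : V := (tau z, xi z, zeta z).
have mphi : measurable_fun D (phi : Z -> g_sigma_algebraType (@open V)).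
  have dns := ball_dense_pair (ball_dense_pair ball_dense_R (@ball_dense_rV n)) ball_dense_R.
  apply: (measurable_fun_borel_base (ball_dense_base dns)) => q m.
  have bm := ball_measurable_pair (ball_measurable_pair (ball_measurable_R mtau)
    (ball_measurable_rV mxi)) (ball_measurable_R mzeta).
  by apply: (bm q); rewrite invr_gt0.
have mdom : measurable (`[0, T] `*` setT `*` setT : set (g_sigma_algebraType (@open V))).
  rewrite -[X in measurable X]setCK; apply: measurableC; apply: sub_sigma_algebra.
  rewrite (_ : ~` _ = (fun p : V => p.1.1) @^-1` (~` `[0, T])).
    apply: open_comp; last by apply: closed_openC; exact: interval_closed.
    by move=> p _; apply: continuous_comp; exact: cvg_fst.
  by apply/seteqP; split => p /= h; [move=> h'; apply: h; split|move=> [[]]].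
apply: (measurable_comp mdom _ mg mphi).
by move=> _ [z Dz <-]; split => //; split => //=; rewrite in_itv/=; exact: tauT.
Qed.

End measurable_balls.
End borel_composition.

(** The integral of f lies between those of -g and g by monotonicity, and is finite because these
    are. *)
Lemma Rintegral_abs_le d (T : measurableType d) (R : realType)
    (mu : {measure set T -> \bar R}) (D : set T) (f g : T -> R) :
  measurable D -> (forall x, D x -> `|f x| <= g x) ->
  mu.-integrable D (fun x => (g x)%:E) ->
  `|\int[mu]_(x in D) f x| <= \int[mu]_(x in D) g x.
Proof.
move=> mD fg ig.
have gfin := integrable_fin_num mD ig.
have le1 : (\int[mu]_(x in D) (f x)%:E <= \int[mu]_(x in D) (g x)%:E)%E.
  by apply: le_integral_nomeas => x Dx; rewrite lee_fin (le_trans (ler_norm _)) ?fg.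
have le2 : (- (\int[mu]_(x in D) (g x)%:E) <= \int[mu]_(x in D) (f x)%:E)%E.
  rewrite -(integralN (integrable_add_def mD ig)); apply: le_integral_nomeas => x Dx.
  by rewrite -EFinN lee_fin; have := fg _ Dx; rewrite ler_norml => /andP[].
rewrite /Rintegral; move: le1 le2; rewrite -[in X in X -> _](fineK gfin).
rewrite -[in X in _ -> X -> _](fineK gfin) -EFinN.
set a := fine _; case: (\int[mu]_(x in D) (f x)%:E)%E => [r| |]//.
by rewrite !lee_fin ler_norml => -> ->.
Qed.

Section joint_measurability.
Context (R : realType) (disp : measure_display) (Omega : measurableType disp) (T : R).
Local Notation dom := (`[0, T] `*` setT : set (measurableTypeR R * Omega)).

Lemma measurable_dom : measurable dom.
Proof. by apply: measurableX => //; exact: measurable_itv. Qed.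

(* A continuous process is the limit of its discretizations on the left. *)
Lemma continuous_joint (X : R -> Omega -> R) :
  (forall w, path_cont T (X ^~ w)) ->
  (forall t : R, 0 <= t <= T -> measurable_fun setT (X t)) ->
  measurable_fun dom (fun p => X p.1 p.2).
Proof.
move=> cX mX.
pose kap n (s : R) : R := (Num.trunc (s * n.+1%:R))%:R / n.+1%:R.
have n0 n : 0 < n.+1%:R :> R by rewrite ltr0n.
have kapP n s : 0 <= s <= T -> [/\ 0 <= kap n s, kap n s <= s, kap n s <= T & s - kap n s < n.+1%:R^-1].
  move=> /andP[s0 sT].
  have /truncn_itv/andP[h1 h2] : 0 <= s * n.+1%:R by rewrite mulr_ge0// ltW.
  have ks : kap n s <= s by rewrite /kap ler_pdivrMr.
  split => //; first by rewrite divr_ge0// ltW.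
    exact: le_trans sT.
  by rewrite /kap -(ltr_pM2r (n0 n)) mulrBl divfK ?gt_eqF// mulVf ?gt_eqF// ltrBlDl natr1.
apply: (@measurable_fun_cvg _ _ _ _ (fun n p => X (kap n p.1) p.2)); last first.
  move=> [s w] [/= sT _]; rewrite in_itv/= in sT.
  apply/cvgrPdist_lt => e e0.
  have [h h0 hX] := cX w s sT e e0.
  have [N _ HN] := @near_infty_natSinv_lt R (PosNum h0).
  exists N => // n /= Nn; rewrite distrC; have [k1 k2 k3 k4] := kapP n s sT.
  apply: hX; first by rewrite k1 k3.
  rewrite distrC ger0_norm ?subr_ge0// (lt_trans k4)//.
  exact: (HN n Nn).
move=> n mdom B mB.
(* The guard discards grid times after T, where X is not constrained. *)
pose U (k : nat) : set (measurableTypeR R * Omega) := if k%:R / n.+1%:R <= T then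
  (`[0, T]%classic `&` `[k%:R / n.+1%:R, k.+1%:R / n.+1%:R[%classic) `*` (X (k%:R / n.+1%:R) @^-1` B) else set0.
rewrite (_ : _ `&` _ = \bigcup_k U k).
  apply: bigcupT_measurable => k; rewrite /U; case: ifP => // kT.
  apply: measurableX; first by apply: measurableI; exact: measurable_itv.
  rewrite -[X in measurable X]setTI; apply: mX => //.
  by rewrite kT divr_ge0// ltW.
apply/seteqP; split => [[s w] [[/= sT _] Bsw]|[s w] [k _]].
  rewrite in_itv/= in sT; have [k1 k2 k3 k4] := kapP n s sT.
  exists (Num.trunc (s * n.+1%:R)) => //; rewrite /U k3; split => //=.
  rewrite !in_itv/= sT k2/=; split => //.
  rewrite ltr_pdivlMr//.
  have /truncn_itv/andP[//] : 0 <= s * n.+1%:R.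
  by case/andP: sT => s0 _; rewrite mulr_ge0// ltW.
rewrite /U; case: ifP => // kT [/= [sT]]; rewrite in_itv/= => /andP[h1 h2] BX.
split => //=; rewrite /kap.
suff -> : Num.trunc (s * n.+1%:R) = k by [].
by apply/eqP; rewrite truncn_eq ?mulr_ge0//; [rewrite -ler_pdivrMr// h1 -ltr_pdivlMr|
  move: sT; rewrite in_itv/= => /andP[]].
Qed.

(** Tonelli applies to the positive and the negative part separately; [fine] supplies a measurable
    value also where the difference of the two is infinite. *)
Lemma measurable_Rintegral (P : probability Omega R) (f : R -> Omega -> R)
    (A : set (measurableTypeR R)) : measurable A ->
  measurable_fun (A `*` setT : set (measurableTypeR R * Omega)) (fun p => f p.1 p.2) ->
  measurable_fun A (fun s => \int[P]_w f s w).
Proof.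
move=> mA mf.
have mAT : measurable (A `*` setT : set (measurableTypeR R * Omega)) by exact: measurableX.
pose F := ((fun p : measurableTypeR R * Omega => (f p.1 p.2)%:E) \_ (A `*` setT))%E.
have mF : measurable_fun setT F.
  by apply: (measurable_restrictT _ mAT).1; exact/measurable_EFinP.
have mp := measurable_fun_fubini_tonelli_F (m2 := P) _ (measurable_funepos mF) (funepos_ge0 _).
have mn := measurable_fun_fubini_tonelli_F (m2 := P) _ (measurable_funeneg mF) (funeneg_ge0 _).
have := measurable_funTS (D := A) (emeasurable_funB mp mn).
move=> m.
have : measurable_fun A (fun s => fine (fubini_F P F^\+%E s - fubini_F P F^\-%E s)%E).
  by apply: measurableT_comp m; exact: fine_measurable.
apply: eq_measurable_fun => s /set_mem As; rewrite /Rintegral /fubini_F; congr fine.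
rewrite [RHS]integralE; congr (_ - _)%E; apply: eq_integral => w _.
  by rewrite !funeposE /F patchE mem_set.
by rewrite !funenegE /F patchE mem_set.
Qed.

End joint_measurability.

(** * Processes of S^2, controls and mean fields *)

Section processes.
Variables (R : realType) (disp : measure_display) (Omega : measurableType disp).
Variables (P : probability Omega R) (T : R) (d m : nat).
Variables (X0 : Omega -> 'rV[R]_d) (W : R -> Omega -> 'rV[R]_m).
Hypothesis T0 : 0 < T.
Hypothesis cP : measure_is_complete P.
Hypothesis bmW : brownian_motion P T W.
Hypothesis rX0 : random_vector X0.

Local Notation filt := (filt P X0 W).
Local Notation Fmeas t f :=
  (measurable_fun (setT : set (g_sigma_algebraType (filt t))) (f : Omega -> R)).
Local Notation dom := (`[0, T] `*` setT : set (measurableTypeR R * Omega)).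
Let T0' : 0 <= T. Proof. exact: ltW. Qed.

Section S2.
Variables (n : nat) (X : R -> Omega -> 'rV[R]_n).
Hypothesis SX : in_S2 P T X0 W X.

Lemma S2_path w : path_cont T (X ^~ w).
Proof. by case: SX => _ cX _; apply/path_contP; exact: cX. Qed.

Lemma S2_adapted t j : 0 <= t <= T -> Fmeas t (fun w => X t w ord0 j).
Proof. by case: SX => aX _ _ tT; have := aX t; rewrite in_itv/= => /(_ tT ord0 j). Qed.

Lemma S2_measurable t j : 0 <= t <= T -> measurable_fun setT (fun w => X t w ord0 j).
Proof.
move=> tT; have /andP[_ tT'] := tT.
exact: (filt_measurable_fun cP bmW rX0 tT' (S2_adapted j tT)).
Qed.

Lemma S2_path_entry j w : path_cont T (fun t => X t w ord0 j : R).
Proof.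
move=> x xT e e0; have [h h0 H] := S2_path w xT e0; exists h => // y yT yx.
by apply: le_lt_trans (H y yT yx); have := le_entry_norm (X y w - X x w) j; rewrite !mxE.
Qed.

Lemma S2_joint j : measurable_fun dom (fun p => X p.1 p.2 ord0 j).
Proof.
apply: (@continuous_joint _ _ _ T (fun t w => X t w ord0 j)) => [w|t tT].
  exact: S2_path_entry.
exact: S2_measurable.
Qed.

Lemma S2_sup_measurable : measurable_fun setT (path_sup T X).
Proof.
apply: measurable_path_sup => //; first exact: S2_path.
move=> t tT; apply: measurable_mx_norm => j; exact: S2_measurable.
Qed.

Lemma S2_sqint : sqint P (path_sup T X).
Proof.
split; first exact: S2_sup_measurable.
case: SX => _ _; apply: le_lt_trans; apply: le_integral_nomeas => w _.
set G := ereal_sup _.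
have GX t : 0 <= t <= T -> ((enorm (X t w) ^+ 2)%:E <= G)%E.
  by move=> tT; apply: ereal_sup_ubound; exists t => //; rewrite /= in_itv.
have s0 := path_sup_ge0 T0' S2_path w.
case: G GX => [g| |] GX; last 1 first.
- by have := GX 0 (ltac:(by rewrite lexx)).
- have g0 : 0 <= g.
    have := GX 0 (ltac:(by rewrite lexx)); rewrite lee_fin; apply: le_trans; exact: sqr_ge0.
  rewrite lee_fin -(sqr_sqrtr g0) lerXn2r ?nnegrE ?sqrtr_ge0//.
  apply: (path_sup_le T0') => t tT.
  apply: le_trans (norm_le_enorm _) _.
  rewrite -[leLHS]ger0_norm ?enorm_ge0// -sqrtr_sqr ler_wsqrtr//.
  by have := GX t tT; rewrite lee_fin.
- by rewrite leey.
Qed.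

Lemma S2_le_sup t w : 0 <= t <= T -> `|X t w| <= path_sup T X w.
Proof. by move=> tT; exact: (le_path_sup T0' S2_path). Qed.

End S2.

Section mean_field.
Variables (k : nat) (X : R -> Omega -> 'rV[R]_d) (L : R -> Omega -> R).
Variable g : R -> 'rV[R]_d -> 'rV[R]_k.
Hypothesis SX : in_S2 P T X0 W X.
Hypothesis VL : in_V P T X0 W L.
Hypothesis mg : borel_mx (`[0, T] `*` setT : set (R * 'rV[R]_d)) (fun p => g p.1 p.2).

Lemma V_joint : measurable_fun dom (fun p => L p.1 p.2).
Proof.
case: VL => -[pL _] _ _ _ _.
have := @progressive_joint _ _ _ _ _ _ _ _ _ cP bmW rX0 _ _ ord0 T0' pL.
by congr (measurable_fun _ _); apply/funext => p; rewrite mxE.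
Qed.

Lemma V_itv t w : 0 <= t <= T -> 0 <= L t w <= 1.
Proof. by case: VL => _ _ H _ _ tT; apply: H; rewrite in_itv. Qed.

Lemma mean_field_measurable j :
  measurable_fun (`[0, T] : set (measurableTypeR R)) (fun s => mean_field P g X L s ord0 j).
Proof.
rewrite [X in measurable_fun _ X](_ : _ = fun s => \int[P]_w (g s (X s w) ord0 j * L s w));
  last by apply/funext => s; rewrite mxE.
apply: (@measurable_Rintegral _ _ _ P (fun s w => g s (X s w) ord0 j * L s w)).
  exact: measurable_itv.
apply: measurable_funM; last exact: V_joint.
apply: (@measurable_fun_comp2 _ _ _ _ (@measurable_dom _ _ _ T) T _ (fun s x => g s x ord0 j)
  (fun p : measurableTypeR R * Omega => p.1) (fun p => X p.1 p.2)).
- exact: mg.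
- apply: measurable_funTS; exact: measurable_fst.
- by move=> [s w] [/=]; rewrite in_itv.
- by move=> i; exact: S2_joint.
Qed.

Lemma mean_field_bound (B : Omega -> R) (s : R) : 0 <= s <= T ->
  P.-integrable setT (fun w => (B w)%:E) -> (forall w, 0 <= B w) ->
  (forall w j, `|g s (X s w) ord0 j| <= B w) ->
  `|mean_field P g X L s| <= \int[P]_w B w.
Proof.
move=> sT iB B0 gB.
apply: norm_le_entries => [|j]; first exact: Rintegral_ge0.
rewrite mxE; apply: Rintegral_abs_le => // w _.
have /andP[L0 L1] := V_itv w sT.
by rewrite normrM (ger0_norm L0) (le_trans _ (gB w j))// ler_piMr.
Qed.

End mean_field.
End processes.

(** * Moments of the forward solution *)

Lemma integrable_cst_itv (R : realType) (i : interval R) (a b c : R) :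
  [set` i] `<=` `[a, b] -> (@lebesgue_measure R).-integrable [set` i] (fun=> c%:E).
Proof.
move=> iab; apply: (@integrableS _ _ R (@lebesgue_measure R) `[a, b] [set` i]) => //.
apply: continuous_compact_integrable; first exact: segment_compact.
by apply: continuous_subspaceT => ?; exact: cst_continuous.
Qed.

Section forward_equation.
Variables (R : realType) (disp : measure_display) (Omega : measurableType disp).
Variables (P : probability Omega R) (T : R) (d k m : nat).
Variables (X0 : Omega -> 'rV[R]_d) (W : R -> Omega -> 'rV[R]_m).
Variable D : data R d k m.
Hypothesis T0 : 0 < T.
Hypothesis cP : measure_is_complete P.
Hypothesis bmW : brownian_motion P T W.
Hypothesis rX0 : random_vector X0.
Hypothesis iX0 : indep_gens P (rv_gens [set tt] (fun _ => X0)) (rv_gens `[0, T] W).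
Hypothesis mD : measurable_data T D.
Hypothesis lipD : forward_lipschitz T D.
Variables (L : R -> Omega -> R) (X : R -> Omega -> 'rV[R]_d).
Hypothesis VL : in_V P T X0 W L.
Hypothesis SX : in_S2 P T X0 W X.

Local Notation leb := (@lebesgue_measure R).

(** The mean-field arguments are deterministic and bounded uniformly in time by [M], since sup |X|
    is integrable. With these arguments under control, the Lipschitz coefficients grow linearly in X
    alone. *)
Lemma forward_growth : exists2 C : R, 0 <= C & forall (s : R) w, 0 <= s <= T ->
  (forall j, `|c_b D s (X s w) (mean_field P (c_bbar D) X L s) ord0 j| <= C * (1 + `|X s w|)) /\
  (forall j, enorm (row j (c_sigma D s (X s w) (mean_field P (c_sigmabar D) X L s))) ^+ 2
     <= (C * (1 + `|X s w|)) ^+ 2).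
Proof.
have [K K0 [lip1 lip2 lip0]] := lipD.
pose B w := K + K * (d%:R * path_sup T X w).
have iB : P.-integrable setT (fun w => (B w)%:E).
  apply: integrable_EFinD => //; first exact: finite_measure_integrable_cst.
  do 2 apply: integrable_EFinZl => //.
  exact: sqint_integrable (S2_sqint T0 cP bmW rX0 SX).
have en0 n (x : 'rV[R]_n) : enorm (x - 0) = enorm x by rewrite subr0.
have B0 w : 0 <= B w.
  rewrite addr_ge0// !mulr_ge0//; exact: (path_sup_ge0 (ltW T0) (S2_path SX)).
have bar (g : R -> 'rV[R]_d -> 'rV[R]_k) s w j : 0 <= s <= T ->
   enorm (g s 0) <= K -> (forall x x', enorm (g s x - g s x') <= K * enorm (x - x')) ->
   `|g s (X s w) ord0 j| <= B w.
  move=> sT g0 gl.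
  have := ler_normD (g s 0 ord0 j) (g s (X s w) ord0 j - g s 0 ord0 j).
  rewrite subrKC => /le_trans; apply; rewrite /B lerD//.
    exact: le_trans (le_entry_enorm _ _ _) g0.
  have := le_entry_enorm (g s (X s w) - g s 0) ord0 j; rewrite !mxE => /le_trans; apply.
  rewrite (le_trans (gl _ _))// ler_wpM2l//.
  rewrite en0 (le_trans (enorm_le_norm _))// ler_wpM2l//.
  exact: (S2_le_sup T0 SX).
pose M := \int[P]_w B w.
have M0 : 0 <= M.
  by apply: Rintegral_ge0 => w _.
have lip0' s : 0 <= s <= T -> [/\ enorm (c_b D s 0 0) <= K, enorm (c_sigma D s 0 0) <= K,
    enorm (c_bbar D s 0) <= K & enorm (c_sigmabar D s 0) <= K].
  move=> sT; have := lip0 s; rewrite in_itv/= => /(_ sT).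
  have := enorm_ge0 (c_b D s 0 0); have := enorm_ge0 (c_sigma D s 0 0).
  have := enorm_ge0 (c_bbar D s 0); have := enorm_ge0 (c_sigmabar D s 0).
  by split; lra.
have lip2' s : 0 <= s <= T -> forall x x', enorm (c_bbar D s x - c_bbar D s x') <= K * enorm (x - x') /\
   enorm (c_sigmabar D s x - c_sigmabar D s x') <= K * enorm (x - x').
  move=> sT x x'; have := lip2 s; rewrite in_itv/= => /(_ sT x x').
  have := enorm_ge0 (c_bbar D s x - c_bbar D s x').
  have := enorm_ge0 (c_sigmabar D s x - c_sigmabar D s x').
  by split; lra.
have mb s : 0 <= s <= T -> `|mean_field P (c_bbar D) X L s| <= M.
  move=> sT; apply: (mean_field_bound VL) => // w j; have [_ _ h _] := lip0' s sT.
  by apply: bar => // x x'; have [] := lip2' s sT x x'.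
have ms s : 0 <= s <= T -> `|mean_field P (c_sigmabar D) X L s| <= M.
  move=> sT; apply: (mean_field_bound VL) => // w j; have [_ _ _ h] := lip0' s sT.
  by apply: bar => // x x'; have [] := lip2' s sT x x'.
pose C := K * (1 + d%:R + k%:R * M).
have C0 : 0 <= C by rewrite mulr_ge0// addr_ge0// ?mulr_ge0// addr_ge0.
(* The factor 1 + m absorbs the m entries of a row of sigma, as m <= (1 + m)^2. *)
exists ((1 + m%:R) * C); first by rewrite mulr_ge0// addr_ge0.
move=> s w sT.
have x0 := normr_ge0 (X s w); set x := X s w in x0 *.
have key (z : 'rV[R]_k) : `|z| <= M -> K + K * (enorm (x - 0) + enorm (z - 0)) <= C * (1 + `|x|).
  move=> zM; rewrite !en0.
  apply: (@le_trans _ _ (K + K * (d%:R * `|x| + k%:R * M))).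
    rewrite lerD2l ler_wpM2l// lerD ?enorm_le_norm//.
    by rewrite (le_trans (enorm_le_norm _))// ler_wpM2l.
  rewrite -subr_ge0 (_ : _ - _ = K * (`|x| + d%:R + k%:R * M * `|x|)); last by rewrite /C; ring.
  by rewrite mulr_ge0// !addr_ge0// !mulr_ge0.
have [b0 s0 _ _] := lip0' s sT.
have := lip1 s; rewrite in_itv/= => /(_ sT) {}lip1.
have Cm : C * (1 + `|x|) <= (1 + m%:R) * C * (1 + `|x|).
  rewrite -subr_ge0 (_ : _ - _ = m%:R * (C * (1 + `|x|))); last by ring.
  by rewrite mulr_ge0// mulr_ge0// addr_ge0.
split=> j.
  apply: le_trans Cm; apply: le_trans (key _ (mb s sT)).
  set z := mean_field _ _ _ _ _.
  have := lip1 x 0 z 0; have := enorm_ge0 (c_sigma D s x z - c_sigma D s 0 0).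
  have := le_entry_enorm (c_b D s x z - c_b D s 0 0) ord0 j; rewrite !mxE.
  have := le_entry_enorm (c_b D s 0 0) ord0 j.
  have := ler_normD (c_b D s 0 0 ord0 j) (c_b D s x z ord0 j - c_b D s 0 0 ord0 j).
  rewrite subrKC; lra.
set z := mean_field _ _ _ _ _.
have ent i : `|c_sigma D s x z j i| <= C * (1 + `|x|).
  apply: le_trans (key z (ms s sT)).
  have := lip1 x 0 z 0; have := enorm_ge0 (c_b D s x z - c_b D s 0 0).
  have := le_entry_enorm (c_sigma D s x z - c_sigma D s 0 0) j i; rewrite !mxE.
  have := le_entry_enorm (c_sigma D s 0 0) j i.
  have := ler_normD (c_sigma D s 0 0 j i) (c_sigma D s x z j i - c_sigma D s 0 0 j i).
  rewrite subrKC; lra.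
rewrite sqr_enorm big_ord1 -mulrA exprMn.
have Cx : 0 <= C * (1 + `|x|) by rewrite mulr_ge0// addr_ge0.
apply: (@le_trans _ _ (\sum_(i < m) (C * (1 + `|x|)) ^+ 2)).
  apply: ler_sum => i _; rewrite mxE -real_normK ?num_real// lerXn2r ?nnegrE//.
rewrite sumr_const card_ord -[leLHS]mulr_natl ler_wpM2r ?sqr_ge0//.
by have : 0 <= m%:R :> R by []; nra.
Qed.

Hypothesis solX : forward_solution P T X0 W D L X.

(** Isolates what the moment estimate uses of the forward equation. The drift is measured by a bound
    c of the path on the window alone, because the good-lambda argument controls the path only on
    windows that start with the running maximum in the band. *)
Lemma forward_increments : exists C : R, exists Z : 'I_d -> R -> Omega -> 'rV[R]_m,
  exists I : 'I_d -> R -> Omega -> R,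
  [/\ 0 <= C,
      forall j, is_ito_integral P T X0 W (Z j) (I j),
      forall j (s : R) w, 0 <= s <= T -> enorm (Z j s w) ^+ 2 <= (C * (1 + `|X s w|)) ^+ 2,
      {ae P, forall w, forall s t c : R, 0 <= s -> s <= t -> t <= T ->
         (forall r : R, s <= r <= t -> `|X r w| <= c) -> forall j,
         `|(X t w ord0 j - X s w ord0 j) - (I j t w - I j s w)| <= C * (t - s) * (1 + c)} &
      {ae P, forall w, X 0 w = X0 w}].
Proof.
have [C C0 grow] := forward_growth.
have [_ [I [itoI eqX]]] := solX.
pose Z j s w := row j (c_sigma D s (X s w) (mean_field P (c_sigmabar D) X L s)).
exists C, Z, I; split => //.
- by move=> j s w sT; have [_ /(_ j)] := grow s w sT.
- apply: filterS eqX => w eqX s t c s0 st tT Xc j.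
  have t0 : 0 <= t by exact: le_trans st.
  have sT : s <= T by exact: le_trans tT.
  rewrite (eqX t) ?in_itv/= ?t0// (eqX s) ?in_itv/= ?s0//.
  pose b r := c_b D r (X r w) (mean_field P (c_bbar D) X L r) ord0 j.
  have mb : measurable_fun (`[0, T] : set (measurableTypeR R)) b.
    have mT : measurable (`[0, T] : set (measurableTypeR R)) by exact: measurable_itv.
    apply: (measurable_fun_comp3 mT (T := T) (g := fun s x z => c_b D s x z ord0 j)).
    + by case: mD => -[].
    + exact: measurable_id.
    + by move=> r; rewrite /= in_itv.
    + move=> i; exact: (measurable_path mT (f := fun r w => X r w ord0 i) (S2_joint cP bmW rX0 SX i) w).
    + move=> i; apply: (mean_field_measurable T0 cP bmW rX0 SX VL).
      by case: mD => -[].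
  have ib : leb.-integrable `[0, t] (fun r => (b r)%:E).
    apply: (@le_integrable_EFin _ _ _ _ _ _ _ (fun=> C * (1 + path_sup T X w))) => //.
    + by apply: measurable_funS mb => // r; rewrite /= !in_itv/= => /andP[-> /le_trans ->].
    + move=> r; rewrite /= in_itv/= => /andP[r0 rt].
      have rT : 0 <= r <= T by rewrite r0 (le_trans rt).
      have [/(_ j) h _] := grow r w rT.
      by rewrite (le_trans h)// ler_wpM2l// lerD2l (S2_le_sup T0 SX).
    + exact: (integrable_cst_itv _ (a := 0) (b := t)).
  have -> : X0 w ord0 j + \int[leb]_(r in `[0, t]) b r + I j t w -
     (X0 w ord0 j + \int[leb]_(r in `[0, s]) b r + I j s w) - (I j t w - I j s w)
     = \int[leb]_(r in `[0, t]) b r - \int[leb]_(r in `[0, s]) b r by lra.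
  rewrite Rintegral_itvB ?bnd_simp//.
  apply: (le_trans (Rintegral_abs_le (g := fun=> C * (1 + c)) _ _ _)) => //.
  + move=> r; rewrite /= in_itv/= => /andP[sr rt].
    have rT : 0 <= r <= T by rewrite (le_trans s0 (ltW sr)) (le_trans rt).
    have [/(_ j) h _] := grow r w rT.
    by rewrite (le_trans h)// ler_wpM2l// lerD2l Xc// (ltW sr).
  + by apply: (integrable_cst_itv _ (a := s) (b := t)) => r /=; rewrite !in_itv/= => /andP[/ltW -> ->].
  + rewrite Rintegral_cst//= lebesgue_measure_itv/= lte_fin.
    move: st; rewrite le_eqVlt => /predU1P[->|st]; first by rewrite ltxx /= subrr !mulr0 mul0r.
    by rewrite st /= mulrAC.
(* All simple integrals vanish at time 0, so the squared distance to [I j 0] is constant along the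
   approximation and tends to 0. *)
- have I0 j : {ae P, forall w, I j 0 w = 0}.
    have [_ _ _ [S [_ /(_ 0)]]] := itoI j; rewrite in_itv/= lexx (ltW T0) => /(_ erefl).
    rewrite (_ : (fun n => _) = fun=> (\int[P]_w (I j 0 w ^+ 2)%:E)%E); last first.
      by apply/funext => n; apply: eq_integral => w _; rewrite si_integral0 sub0r sqrrN.
    move=> /(cvg_lim (@ereal_hausdorff R)); rewrite lim_cst; last exact: ereal_hausdorff.
    move=> h.
    have mI : measurable_fun setT (I j 0) by apply: (ito_measurable cP bmW rX0 (itoI j)) => //; exact: ltW.
    have mI2 : measurable_fun setT (fun w => (I j 0 w ^+ 2)%:E).
      exact/measurable_EFinP/measurable_funX.
    have [/(_ _) ae0 _] := ae_eq_integral_abs P measurableT mI2.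
    have : (\int[P]_w `|(I j 0 w ^+ 2)%:E| = 0)%E.
      by rewrite -[RHS]h; apply: eq_integral => w _; rewrite gee0_abs// lee_fin sqr_ge0.
    move=> /ae0; apply: filterS => w /(_ Logic.I) /eqP.
    by rewrite /= eqe sqrf_eq0 => /eqP.
  have I0' : {ae P, forall w, forall j, I j 0 w = 0}.
    suff h (s : seq 'I_d) : {ae P, forall w, forall j, j \in s -> I j 0 w = 0}.
      by apply: filterS (h (enum 'I_d)) => w hw j; apply: hw; rewrite mem_enum.
    elim: s => [|j0 s IHs]; first exact: aeW.
    apply: filterS2 (I0 j0) IHs => w h0 hs j; rewrite inE => /predU1P[->//|]; exact: hs.
  apply: filterS2 eqX I0' => w /(_ 0); rewrite in_itv/= lexx (ltW T0) => /(_ erefl) eqX I0w.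
  apply/rowP => j; rewrite eqX I0w set_itv1 Rintegral_set1; lra.
Qed.

End forward_equation.

(** * The good-lambda inequality *)

Section crossing.
Variables (R : realType) (V : normedModType R).
Implicit Types (x : nat -> V) (lam c : R).

Fixpoint running_max x n : R :=
  if n is i.+1 then Num.max (running_max x i) `|x n| else `|x 0%N|.

Definition band lam (M : R) : R := ((lam < M) && (M <= 3 * lam))%R%:R.

Lemma le_running_max x n : `|x n| <= running_max x n.
Proof. by case: n => [|n] //=; rewrite le_max lexx orbT. Qed.

Lemma running_max_homo x i n : (i <= n)%N -> running_max x i <= running_max x n.
Proof.
by move=> /subnK <-; elim: (n - i)%N => [|k IH]//=; rewrite le_max IH.
Qed.

(* While the running maximum is in the band, the sum tracks the path from its
   first passage above [lam], where its norm is at most [lam + c]; it stops at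
   the first passage above [3 * lam]. *)
Lemma band_crossing x lam c n :
  (forall i, (i < n)%N -> `|x i.+1 - x i| <= c) -> `|x 0%N| <= lam ->
  3 * lam < running_max x n ->
  2 * lam - c <= `|\sum_(i < n) band lam (running_max x i) *: (x i.+1 - x i)|.
Proof.
move=> xc x0; have lam0 : 0 <= lam by exact: le_trans x0.
set S := fun n => \sum_(i < n) band lam (running_max x i) *: (x i.+1 - x i).
(* The induction follows the three regimes of the running maximum: below the band S is 0, inside it
   x - S is frozen, above it S is frozen. *)
suff: [/\ running_max x n <= lam -> S n = 0,
   lam < running_max x n <= 3 * lam -> `|x n - S n| <= lam + c &
   3 * lam < running_max x n -> 2 * lam - c <= `|S n|].
  by case.
elim: n xc => [|n IH] xc.
  by split=> [_|/andP[/= ? _]|/= ?]; [rewrite /S big_ord0|exfalso; lra|exfalso; lra].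
have [i1 i2 i3] := IH (fun i h => xc i (ltnW h)).
have SE : S n.+1 = S n + band lam (running_max x n) *: (x n.+1 - x n) by rewrite /S big_ord_recr.
have xn := le_running_max x n; have hc := xc n (leqnn _).
have xd : `|x n.+1| <= `|x n| + c.
  by have := ler_normD (x n) (x n.+1 - x n); rewrite addrC subrK; lra.
have mono := @running_max_homo x _ _ (leqnSn n).
case: (leP (running_max x n) lam) => M1.
  have {}SE : S n.+1 = 0.
    by rewrite SE /band ltNge M1 /= scale0r addr0 i1.
  rewrite SE subr0 normr0; split=> //; first by move=> _; lra.
  by rewrite /= lt_max => /orP[|]; lra.
case: (leP (running_max x n) (3 * lam)) => M2; last first.
  have {}SE : S n.+1 = S n.
    by rewrite SE /band [X in _ && X]leNgt M2 andbF scale0r addr0.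
  by rewrite SE; split=> [?|/andP[_ ?]|_]; [exfalso; lra|exfalso; lra|exact: i3].
have {}SE : x n.+1 - S n.+1 = x n - S n.
  by rewrite SE /band M1 M2 /= scale1r opprD opprB addrC -addrA subrK addrC.
have {}i2 : `|x n - S n| <= lam + c by apply: i2; rewrite M1.
split=> [?|_|]; [exfalso; lra|by rewrite SE|].
rewrite /= lt_max => /orP[|h]; first lra.
have := ler_normD (x n.+1 - S n.+1) (S n.+1); rewrite subrK SE; lra.
Qed.

End crossing.

Lemma measurable_bool_natr d (T : measurableType d) (R : realType)
  (b : T -> bool) : measurable_fun setT b -> measurable_fun setT (fun x => (b x)%:R : R).
Proof.
move=> mb; rewrite (_ : (fun x => _) = fun x => if b x then 1 else 0); last first.
  by apply/funext => x; case: (b x).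
by apply: measurable_fun_ifT.
Qed.

Lemma ge0_ae_le_Rintegral d (T : measurableType d) (R : realType)
    (mu : {measure set T -> \bar R}) (f g : T -> R) :
  measurable_fun setT f -> (forall x, 0 <= f x) -> (forall x, 0 <= g x) ->
  mu.-integrable setT (fun x => (g x)%:E) ->
  {ae mu, forall x, f x <= g x} -> \int[mu]_x f x <= \int[mu]_x g x.
Proof.
move=> mf f0 g0 ig fg.
have h : (\int[mu]_x (f x)%:E <= \int[mu]_x (g x)%:E)%E.
  apply: ae_ge0_le_integral => //.
  - by move=> x _; rewrite lee_fin.
  - exact/measurable_EFinP.
  - by move=> x _; rewrite lee_fin.
  - by case/integrableP: ig.
  - by apply: filterS fg => x xfg _; rewrite lee_fin.
have gfin := integrable_fin_num measurableT ig.
apply: fine_le => //.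
rewrite ge0_fin_numE; last by apply: integral_ge0 => x _; rewrite lee_fin.
by apply: le_lt_trans h _; rewrite ltey_eq gfin.
Qed.

Lemma exceed_integrable (R : realType) (disp : measure_display)
    (Omega : measurableType disp) (P : probability Omega R) (U : Omega -> R) (c : R) : measurable_fun setT U ->
  P.-integrable setT (fun w => ((c < U w)%R%:R : R)%:E).
Proof.
move=> mU; apply: sqint_integrable.
apply: (sqint_le _ (sqint_cst P 1)) => [|w]; last by case: (_ < _); rewrite ?normr0 ?normr1.
by apply: measurable_bool_natr; apply: measurable_fun_ltr => //; exact: measurable_cst.
Qed.

Section good_lambda.
Variables (R : realType) (disp : measure_display) (Omega : measurableType disp).
Variables (P : probability Omega R) (T : R) (d m : nat).
Variables (X0 : Omega -> 'rV[R]_d) (W : R -> Omega -> 'rV[R]_m).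
Hypothesis T0 : 0 < T.
Hypothesis cP : measure_is_complete P.
Hypothesis bmW : brownian_motion P T W.
Hypothesis rX0 : random_vector X0.
Hypothesis iX0 : indep_gens P (rv_gens [set tt] (fun _ => X0)) (rv_gens `[0, T] W).
Variable X : R -> Omega -> 'rV[R]_d.
Hypothesis SX : in_S2 P T X0 W X.
Variables (C : R) (Z : 'I_d -> R -> Omega -> 'rV[R]_m) (I : 'I_d -> R -> Omega -> R).
Hypothesis C0 : 0 <= C.
Hypothesis itoI : forall j, is_ito_integral P T X0 W (Z j) (I j).
Hypothesis ZX : forall j (s : R) w, 0 <= s <= T ->
  enorm (Z j s w) ^+ 2 <= (C * (1 + `|X s w|)) ^+ 2.
Hypothesis driftX : {ae P, forall w, forall s t c : R, 0 <= s -> s <= t -> t <= T ->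
  (forall r : R, s <= r <= t -> `|X r w| <= c) -> forall j,
  `|(X t w ord0 j - X s w ord0 j) - (I j t w - I j s w)| <= C * (t - s) * (1 + c)}.

Local Notation leb := (@lebesgue_measure R).
Local Notation filt := (filt P X0 W).
Local Notation Fmeas t f :=
  (measurable_fun (setT : set (g_sigma_algebraType (filt t))) (f : Omega -> R)).

(** Each component contributes 2 * 32 m from [ito_energy] and 2 T from the drift, which gives 128 m
    + 4 T after the doubling that splits off [osc]; d counts the components. The leading 8 is 32 /
    4, the weight 32 lam^2 of the event in [Q] over the weight 4 lam^2 in
    [good_lambda_pointwise]. *)
Definition kappa : R := 8 * (d%:R * (128 * m%:R + 4 * T) * C ^+ 2).

Section grid.
Variables (a delta : R) (n : nat) (lam : R).
Hypotheses (a0 : 0 <= a) (d0 : 0 < delta) (adT : a + delta <= T) (lam1 : 1 <= lam).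

Let mesh : R := delta / n.+1%:R.
Let u (i : nat) : R := a + i%:R * mesh.
Let N := n.+1.
(** Twice the mesh, because [path_osc] only compares times strictly closer than its argument. *)
Let osc w := path_osc T X (2 * mesh) w.
Let Mx i w := running_max (fun i => X (u i) w) i.

Let mesh0 : 0 < mesh. Proof. by rewrite divr_gt0. Qed.

Let uS i : u i.+1 - u i = mesh.
Proof. by rewrite /u -natr1; lra. Qed.

Let u_ge i : a <= u i. Proof. by rewrite lerDl mulr_ge0// ltW. Qed.

Let u_ge0 i : 0 <= u i. Proof. exact: le_trans (u_ge i). Qed.

Let u_homo i j : (i <= j)%N -> u i <= u j.
Proof. by move=> ij; rewrite lerD2l ler_wpM2r ?ler_nat// ltW. Qed.

Let uN : u N = a + delta.
Proof. by rewrite /u /mesh mulrC divfK. Qed.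

Let u_leT i : (i <= N)%N -> u i <= T.
Proof. by move=> /u_homo /le_trans; apply; rewrite uN. Qed.

Let u_itv i : (i <= N)%N -> 0 <= u i <= T.
Proof. by move=> iN; rewrite u_ge0 u_leT. Qed.

Let osc_ge0 w : 0 <= osc w.
Proof. by apply: path_osc_ge0 => //; [exact: ltW|exact: S2_path SX]. Qed.

Let osc_window i r w : (i < N)%N -> u i <= r <= u i.+1 -> `|X r w - X (u i) w| <= osc w.
Proof.
move=> iN /andP[h1 h2]; have h := uS i; have m0 := mesh0.
apply: le_path_osc => //; [exact: ltW|exact: S2_path SX| | |].
- by rewrite (le_trans (u_ge0 i) h1) (le_trans h2)// u_leT.
- by apply: u_itv; exact: ltnW.
- by rewrite ger0_norm ?subr_ge0//; lra.
Qed.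

Let sqint_osc : sqint P osc.
Proof.
have mX s t : 0 <= s <= T -> 0 <= t <= T -> measurable_fun setT (fun w => `|X s w - X t w| : R).
  move=> sT tT; apply: measurable_mx_norm => j.
  rewrite (_ : (fun w => _) = fun w => X s w ord0 j - X t w ord0 j); last first.
    by apply/funext => w; rewrite !mxE.
  by apply: measurable_funB; exact: (S2_measurable cP bmW rX0 SX).
apply: (@sqint_le _ _ _ _ (fun w => 2 * path_sup T X w)).
- by apply: measurable_path_osc => //; [exact: ltW|exact: S2_path SX].
- by apply: sqintZ; exact: (S2_sqint T0 cP bmW rX0 SX).
- move=> w; rewrite !ger0_norm ?osc_ge0//; last first.
    by rewrite mulr_ge0//; apply: path_sup_ge0; [exact: ltW|exact: S2_path SX].
  by apply: path_osc_le_sup; [exact: ltW|exact: S2_path SX].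
Qed.

Let Mx_Fmeas i : (i <= N)%N -> Fmeas (u i) (Mx i).
Proof.
have mn l : (l <= N)%N -> Fmeas (u l) (fun w => `|X (u l) w|).
  move=> lN; apply: measurable_mx_norm => j; apply: (S2_adapted SX).
  exact: u_itv.
elim: i => [|i IH] iN; first exact: mn.
rewrite /Mx /=; apply: measurable_maxr; last exact: mn.
by apply: (filt_fun_mono (u_homo (leqnSn i))); apply: IH; exact: ltnW.
Qed.

Let Mx_measurable i : (i <= N)%N -> measurable_fun setT (Mx i).
Proof. by move=> iN; exact: (filt_measurable_fun cP bmW rX0 (u_leT iN) (Mx_Fmeas iN)). Qed.

Let eta i w := band lam (Mx i w).

Let eta_Fmeas i : (i <= N)%N -> Fmeas (u i) (eta i).
Proof.
move=> iN; apply: measurable_bool_natr; apply: measurable_and.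
  by apply: measurable_fun_ltr; [exact: measurable_cst|exact: Mx_Fmeas].
by apply: measurable_fun_ler; [exact: Mx_Fmeas|exact: measurable_cst].
Qed.

Let eta_bound i w : `|eta i w| <= 1.
Proof. by rewrite /eta /band; case: (_ && _); rewrite ?normr1 ?normr0. Qed.

Let eta_measurable i : (i <= N)%N -> measurable_fun setT (eta i).
Proof. by move=> iN; exact: (filt_measurable_fun cP bmW rX0 (u_leT iN) (eta_Fmeas iN)). Qed.

(* Dominates [1_(E_i) (1 + sup |X|)^2] over each window, E_i being the event
   that the running maximum is in the band. *)
Let Q w := 32 * lam ^+ 2 * (lam < Mx N w)%R%:R + 2 * osc w ^+ 2.

Let Q_ge0 w : 0 <= Q w.
Proof. by rewrite addr_ge0// mulr_ge0 ?sqr_ge0// mulr_ge0 ?sqr_ge0. Qed.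

Let Q_integrable : P.-integrable setT (fun w => (Q w)%:E).
Proof.
apply: integrable_EFinD => //; apply: integrable_EFinZl => //.
  by apply: exceed_integrable; exact: Mx_measurable.
exact: sqint_sqr.
Qed.

Let eta_Q i w : (i <= N)%N -> eta i w * (1 + (3 * lam + osc w)) ^+ 2 <= Q w.
Proof.
move=> iN; rewrite /eta /band; case: (boolP (_ && _)) => [/andP[h _]|_]; last by rewrite mul0r.
have h' : lam < Mx N w by apply: (lt_le_trans h); exact: running_max_homo.
rewrite mul1r /Q h' mulr1; have := osc_ge0 w; set o := osc w => o0.
(* From 1 <= lam, 1 + 3 lam is at most 4 lam; this is the origin of the weight 32 = 2 * 4^2 in
   [Q]. *)
apply: (@le_trans _ _ ((4 * lam + o) ^+ 2)).
  by have l1 := lam1; rewrite lerXn2r ?nnegrE//; lra.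
by have := sqr_ge0 (4 * lam - o); rewrite sqrrB sqrrD; lra.
Qed.

Let eta_window i w r : (i < N)%N -> u i <= r <= u i.+1 -> eta i w != 0 -> `|X r w| <= 3 * lam + osc w.
Proof.
move=> iN ru; rewrite /eta /band; case: (boolP (_ && _)) => [/andP[_ h] _|_]; last by rewrite eqxx.
have := osc_window w iN ru; have := ler_normD (X (u i) w) (X r w - X (u i) w); rewrite addrC subrK.
have := le_running_max (fun i => X (u i) w) i; rewrite -/(Mx i w); lra.
Qed.

(** The stochastic part of the sum in [band_crossing]. Since the band is known at the left end of
    each step, it is a martingale transform. *)
Let DI j w := \sum_(i < N) eta i w * (I j (u i.+1) w - I j (u i) w).

Let energy_window j i : (i < N)%N ->
  \int[P]_w ((eta i w * (I j (u i.+1) w - I j (u i) w)) ^+ 2)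
    <= 32 * m%:R * (C ^+ 2 * mesh * \int[P]_w Q w).
Proof.
move=> iN; have st := u_homo (leqnSn i); have tT := u_leT iN.
have E := ito_energy cP bmW rX0 iX0 (itoI j) (u_ge0 i) st tT (eta_Fmeas (ltnW iN)) (eta_bound i).
have B : (\int[P]_w ((eta i w ^+ 2)%:E *
     \int[leb]_(r in `[u i, u i.+1]) (enorm (Z j r w) ^+ 2)%:E) <=
     (C ^+ 2 * mesh)%:E * \int[P]_w (Q w)%:E)%E.
  rewrite -integralZl//; apply: le_integral_nomeas => w _.
  have [e0|e0] := eqVneq (eta i w) 0.
    by rewrite e0 expr0n /= mul0e -EFinM lee_fin !mulr_ge0// ?sqr_ge0 ?ltW.
  have e1 : eta i w = 1 by move: e0; rewrite /eta /band; case: (_ && _); rewrite ?eqxx.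
  have := eta_Q w (ltnW iN); rewrite e1 mul1r => hQ.
  rewrite expr1n mul1e.
  apply: (@le_trans _ _ (\int[leb]_(r in `[u i, u i.+1]) (C ^+ 2 * Q w)%:E)%E).
    apply: le_integral_nomeas => r; rewrite /= in_itv/= => ru; rewrite lee_fin.
    have rT : 0 <= r <= T.
      by case/andP: ru => h1 h2; rewrite (le_trans (u_ge0 i) h1) (le_trans h2).
    rewrite (le_trans (ZX j w rT))// exprMn ler_wpM2l ?sqr_ge0//.
    apply: le_trans hQ; rewrite lerXn2r ?nnegrE//.
    + by have := osc_ge0 w; have := lam1; lra.
    + by rewrite lerD2l; apply: eta_window e0.
  rewrite (@integral_cst _ _ _ _ _ _ ((C ^+ 2 * Q w)%:E))//= lebesgue_measure_itv/= lte_fin.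
  have -> : u i < u i.+1 by rewrite -subr_gt0 uS.
  by rewrite -EFinB uS -!EFinM lee_fin mulrAC.
have Qfin := integrable_fin_num measurableT Q_integrable.
have := le_trans E (lee_wpmul2l _ B); rewrite lee_fin => /(_ (mulr_ge0 (ler0n _ 32) (ler0n _ m))) {}E.
have := fine_le _ _ E; rewrite /Rintegral => h; apply: le_trans (h _ _) _.
- rewrite ge0_fin_numE; last by apply: integral_ge0 => w _; rewrite lee_fin sqr_ge0.
  apply: (le_lt_trans E); rewrite -(fineK Qfin) -!EFinM; exact: ltry.
- by rewrite -(fineK Qfin) -!EFinM.
- by rewrite -(fineK Qfin) -!EFinM.
Qed.

Let eta_ito_sqint j i : (i < N)%N -> sqint P (fun w => eta i w * (I j (u i.+1) w - I j (u i) w)).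
Proof.
move=> iN; apply: (sqint_bounded (M := 1)) => //; last exact: eta_measurable (ltnW iN).
exact: (sqint_ito_sub cP bmW rX0 iX0 (itoI j) (u_ge0 i) (u_homo (leqnSn i)) (u_leT iN)).
Qed.

Let DI_sqint j : sqint P (DI j).
Proof. by apply: sqint_sum => i _; apply: eta_ito_sqint. Qed.

(** Increments over distinct windows are orthogonal, so the energies add up and the meshes sum to
    delta. Being linear in delta, the bound becomes absorbable on a short interval. *)
Let DI_energy j : \int[P]_w (DI j w ^+ 2) <= 32 * m%:R * C ^+ 2 * delta * \int[P]_w Q w.
Proof.
pose F i w := eta i w * (I j (u i.+1) w - I j (u i) w).
have -> : \int[P]_w (DI j w ^+ 2) = \sum_(i < N) \int[P]_w (F i w ^+ 2).
  apply: (@sqint_sum_orthogonal _ _ _ P F) => [i|i l il lN]; first exact: eta_ito_sqint.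
  have iN := ltn_trans il lN.
  under eq_Rintegral do rewrite /F mulrA.
  apply: (ito_mean0 cP bmW rX0 iX0 (itoI j) (u_ge0 l) (u_homo (leqnSn l)) (u_leT lN)).
    apply: measurable_funM; last exact: eta_Fmeas (ltnW lN).
    apply: measurable_funM.
      by apply: (filt_fun_mono (u_homo (ltnW il))); exact: eta_Fmeas (ltnW iN).
    apply: measurable_funB.
      by apply: (filt_fun_mono (u_homo il)); exact: (ito_Fmeas (itoI j) (u_ge0 _) (u_leT iN)).
    by apply: (filt_fun_mono (u_homo (ltnW il))); exact: (ito_Fmeas (itoI j) (u_ge0 _) (u_leT (ltnW iN))).
  rewrite (_ : (fun w => _) = fun w => eta l w * F i w); last by apply/funext => w; rewrite mulrC.
  apply: (sqint_bounded (M := 1)) => //; first exact: eta_ito_sqint.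
  exact: eta_measurable (ltnW lN).
apply: (@le_trans _ _ (\sum_(i < N) 32 * m%:R * (C ^+ 2 * mesh * \int[P]_w Q w))).
  by apply: ler_sum => i _; exact: energy_window.
rewrite sumr_const card_ord -[leLHS]mulr_natl.
have -> : delta = mesh * N%:R by rewrite /mesh divfK.
by rewrite le_eqVlt; apply/orP; left; apply/eqP; ring.
Qed.

(** On the event, [band_crossing] gives 2 lam <= |D| + osc, where D is the banded sum. Its
    components differ from [DI] by a drift of size at most C delta (1 + 3 lam + osc), whose square
    is controlled by [Q]. *)
Let good_lambda_pointwise : {ae P, forall w,
  4 * lam ^+ 2 * ((`|X a w| <= lam) && (3 * lam < Mx N w))%R%:R <=
  2 * \sum_j (2 * DI j w ^+ 2 + 2 * (C * delta) ^+ 2 * Q w) + 2 * osc w ^+ 2}.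
Proof.
apply: filterS driftX => w drift.
have rhs0 : 0 <= 2 * \sum_j (2 * DI j w ^+ 2 + 2 * (C * delta) ^+ 2 * Q w) + 2 * osc w ^+ 2.
  rewrite addr_ge0 ?(mulr_ge0 (ler0n _ 2) (sqr_ge0 _))// mulr_ge0// sumr_ge0// => j _.
  rewrite addr_ge0 ?(mulr_ge0 (ler0n _ 2) (sqr_ge0 _))//.
  by rewrite mulr_ge0 ?Q_ge0// (mulr_ge0 (ler0n _ 2) (sqr_ge0 _)).
case: (boolP (_ && _)) => [/andP[Xa MN]|_]; last by rewrite mulr0.
rewrite mulr1.
pose x i := X (u i) w.
have u0 : u 0 = a by rewrite /u mul0r addr0.
have cross := @band_crossing _ _ x lam (osc w) N.
have {cross} cross : 2 * lam - osc w <= `|\sum_(i < N) eta i w *: (x i.+1 - x i)|.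
  apply: cross => //; last by rewrite /x u0.
  by move=> i iN; apply: osc_window => //; rewrite lexx u_homo.
set D := \sum_(i < N) _ in cross.
have DE j : D ord0 j = \sum_(i < N) eta i w * (x i.+1 ord0 j - x i ord0 j).
  by rewrite summxE; apply: eq_bigr => i _; rewrite !mxE.
have o0 := osc_ge0 w.
have qle : (1 + (3 * lam + osc w)) ^+ 2 <= Q w.
  have := @eta_Q N w (leqnn N).
  have h' : lam < Mx N w by have := lam1; lra.
  rewrite /Q h' mulr1 => _; set o := osc w in o0 *.
  apply: (@le_trans _ _ ((4 * lam + o) ^+ 2)).
    have l1 := lam1; rewrite lerXn2r ?nnegrE//.
      lra.
    lra.
    lra.
  by have := sqr_ge0 (4 * lam - o); rewrite sqrrB sqrrD; lra.
have Dj j : (D ord0 j) ^+ 2 <= 2 * DI j w ^+ 2 + 2 * (C * delta) ^+ 2 * Q w.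
  have dist : `|D ord0 j - DI j w| <= C * delta * (1 + (3 * lam + osc w)).
    rewrite DE /DI -sumrB (le_trans (ler_norm_sum _ _ _))//.
    apply: (@le_trans _ _ (\sum_(i < N) C * mesh * (1 + (3 * lam + osc w)))).
      apply: ler_sum => i _; rewrite -mulrBr.
      have [e0|e0] := eqVneq (eta i w) 0.
        rewrite [eta i w]e0 mul0r normr0 !mulr_ge0// ?ltW//; have := lam1; lra.
      have e1 : eta i w = 1 by move: e0; rewrite /eta /band; case: (_ && _); rewrite ?eqxx.
      rewrite e1 mul1r -(uS i); apply: drift => //.
      - exact: u_homo.
      - exact: u_leT.
      - by move=> r ru; apply: (eta_window _ ru e0).
    rewrite sumr_const card_ord -[leLHS]mulr_natl.
    have -> : delta = mesh * N%:R by rewrite /mesh divfK.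
    by rewrite le_eqVlt; apply/orP; left; apply/eqP; ring.
  have h2 : (D ord0 j - DI j w) ^+ 2 <= (C * delta) ^+ 2 * Q w.
    apply: (@le_trans _ _ ((C * delta * (1 + (3 * lam + osc w))) ^+ 2)).
      rewrite -real_normK ?num_real// lerXn2r ?nnegrE//; exact: le_trans dist.
    by rewrite exprMn ler_wpM2l ?sqr_ge0.
  have -> : D ord0 j = DI j w + (D ord0 j - DI j w) by ring.
  by have := sqr_ge0 (DI j w - (D ord0 j - DI j w)); rewrite sqrrB sqrrD; lra.
have Dn : `|D| ^+ 2 <= \sum_j (2 * DI j w ^+ 2 + 2 * (C * delta) ^+ 2 * Q w).
  apply: (@le_trans _ _ (enorm D ^+ 2)).
    by rewrite lerXn2r ?nnegrE ?enorm_ge0// norm_le_enorm.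
  by rewrite sqr_enorm big_ord1; apply: ler_sum.
apply: (@le_trans _ _ (2 * `|D| ^+ 2 + 2 * osc w ^+ 2)); last by rewrite lerD2r ler_wpM2l.
apply: (@le_trans _ _ ((`|D| + osc w) ^+ 2)).
  rewrite (_ : 4 * _ = (2 * lam) ^+ 2); last by ring.
  by have l1 := lam1; rewrite lerXn2r ?nnegrE ?addr_ge0//; lra.
by have := sqr_ge0 (`|D| - osc w); rewrite sqrrB sqrrD; lra.
Qed.

Lemma good_lambda_grid :
  \int[P]_w ((3 * lam < Mx N w)%R%:R : R) <= \int[P]_w ((lam < `|X a w|)%R%:R : R)
    + kappa * delta * \int[P]_w ((lam < Mx N w)%R%:R : R)
    + (kappa * T + 1) * \int[P]_w (osc w ^+ 2).
Proof.
rewrite /kappa; set kap0 : R := d%:R * (128 * m%:R + 4 * T) * C ^+ 2.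
have l1 := lam1; have dT : delta <= T by have := adT; have := a0; lra.
have iosc := sqint_sqr sqint_osc.
have iM c : P.-integrable setT (fun w => ((c < Mx N w)%R%:R : R)%:E).
  by apply: exceed_integrable; exact: Mx_measurable.
have aT : 0 <= a <= T by rewrite a0; have := adT; have := d0; lra.
have mXa : measurable_fun setT (fun w => `|X a w| : R).
  by apply: measurable_mx_norm => j; exact: (S2_measurable cP bmW rX0 SX).
pose G w : R := ((`|X a w| <= lam) && (3 * lam < Mx N w))%R%:R.
have mG : measurable_fun setT G.
  apply: measurable_bool_natr; apply: measurable_and.
    by apply: measurable_fun_ler => //; exact: measurable_cst.
  by apply: measurable_fun_ltr; [exact: measurable_cst|exact: Mx_measurable].
have iG : P.-integrable setT (fun w => (G w)%:E).
  apply: sqint_integrable; apply: (sqint_le mG (sqint_cst P 1)) => w.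
  by rewrite /G; case: (_ && _); rewrite ?normr0 ?normr1.
(* Either |X_a| already exceeds lam, or the path starts below the band and crosses all of it, which
   is the event of [G]. *)
have split_ : \int[P]_w ((3 * lam < Mx N w)%R%:R : R) <= \int[P]_w ((lam < `|X a w|)%R%:R : R) + \int[P]_w G w.
  rewrite -RintegralD//; last exact: exceed_integrable.
  have iX := exceed_integrable P lam mXa.
  apply: (le_Rintegral measurableT (iM (3 * lam)) (integrable_EFinD measurableT iX iG)).
  by move=> w _; rewrite /G; case: (leP `|X a w| lam) => _; case: (3 * lam < _) => /=; rewrite ?mulr0n ?mulr1n; lra.
rewrite -addrA; apply: (le_trans split_); rewrite lerD2l.
pose S w := \sum_j (2 * DI j w ^+ 2 + 2 * (C * delta) ^+ 2 * Q w).
have iSj j : P.-integrable setT (fun w => (2 * DI j w ^+ 2 + 2 * (C * delta) ^+ 2 * Q w)%:E).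
  by apply: integrable_EFinD => //; apply: integrable_EFinZl => //; exact: sqint_sqr.
have iS : P.-integrable setT (fun w => (S w)%:E) by apply: integrable_EFin_sum.
have main : \int[P]_w (4 * lam ^+ 2 * G w) <= \int[P]_w (2 * S w + 2 * osc w ^+ 2).
  apply: ge0_ae_le_Rintegral => //.
  - by apply: measurable_funM => //; exact: measurable_cst.
  - by move=> w; rewrite mulr_ge0// (mulr_ge0 (ler0n _ 4) (sqr_ge0 _)).
  - move=> w; rewrite addr_ge0 ?(mulr_ge0 (ler0n _ 2) (sqr_ge0 _))// mulr_ge0// sumr_ge0// => j _.
    rewrite addr_ge0 ?(mulr_ge0 (ler0n _ 2) (sqr_ge0 _))//.
    by rewrite mulr_ge0 ?Q_ge0// (mulr_ge0 (ler0n _ 2) (sqr_ge0 _)).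
  - by apply: integrable_EFinD => //; apply: integrable_EFinZl.
have ES : \int[P]_w S w = \sum_j (2 * \int[P]_w (DI j w ^+ 2) + 2 * (C * delta) ^+ 2 * \int[P]_w Q w).
  rewrite Rintegral_sum//; apply: eq_bigr => j _.
  rewrite RintegralD//; [|by apply: integrable_EFinZl => //; exact: sqint_sqr|exact: integrable_EFinZl].
  by rewrite !RintegralZl//; exact: sqint_sqr.
have EQ : \int[P]_w Q w = 32 * lam ^+ 2 * \int[P]_w ((lam < Mx N w)%R%:R : R) + 2 * \int[P]_w (osc w ^+ 2).
  rewrite /Q RintegralD//; [|exact: integrable_EFinZl..].
  by rewrite (RintegralZl _ measurableT (iM lam)) (RintegralZl _ measurableT iosc).
move: main; rewrite RintegralZl// RintegralD//; [|exact: integrable_EFinZl..].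
rewrite !RintegralZl//.
set g := \int[P]_w G w; set p := \int[P]_w ((lam < Mx N w)%R%:R : R) in EQ *.
set o := \int[P]_w (osc w ^+ 2) in EQ *; set s := \int[P]_w S w in ES *.
set q := \int[P]_w Q w in EQ ES.
have p0 : 0 <= p by apply: Rintegral_ge0 => w _.
have o0 : 0 <= o by apply: Rintegral_ge0 => w _; rewrite sqr_ge0.
have q0 : 0 <= q by apply: Rintegral_ge0.
have sq : s <= d%:R * ((64 * m%:R + 2 * T) * C ^+ 2 * delta * q).
  rewrite ES; apply: (@le_trans _ _ (\sum_(j < d) (64 * m%:R + 2 * T) * C ^+ 2 * delta * q)).
    apply: ler_sum => j _; have := DI_energy j; rewrite -/q => h.
    have h2 : 2 * (C * delta) ^+ 2 * q <= 2 * T * C ^+ 2 * delta * q.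
      rewrite ler_wpM2r// exprMn (_ : 2 * T * _ * _ = 2 * (C ^+ 2 * (T * delta))); last by ring.
      by rewrite ler_wpM2l// ler_wpM2l ?sqr_ge0// expr2 ler_wpM2r// ltW.
    apply: le_trans (lerD (ler_wpM2l _ h) h2) _ => //.
    by rewrite le_eqVlt; apply/orP; left; apply/eqP; ring.
  by rewrite sumr_const card_ord -[leLHS]mulr_natl.
move=> main.
have {sq}main : 4 * lam ^+ 2 * g <= kap0 * delta * q + 2 * o.
  apply: (le_trans main); rewrite lerD2r (le_trans (ler_wpM2l _ sq))//.
  by rewrite le_eqVlt; apply/orP; left; apply/eqP; rewrite /kap0; ring.
have k0 : 0 <= kap0 by rewrite /kap0 !mulr_ge0 ?sqr_ge0// addr_ge0 ?mulr_ge0// ltW.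
have l2 : 1 <= lam ^+ 2 by rewrite exprn_ege1.
have kd : kap0 * delta <= kap0 * T by rewrite ler_wpM2l.
have kd0 : 0 <= kap0 * delta by rewrite mulr_ge0// ltW.
have : 4 * lam ^+ 2 * g <= 4 * lam ^+ 2 * (8 * kap0 * delta * p + (8 * kap0 * T + 1) * o).
  apply: (le_trans main); rewrite EQ.
  rewrite (_ : kap0 * delta * (32 * lam ^+ 2 * p + 2 * o) + 2 * o =
     4 * lam ^+ 2 * (8 * kap0 * delta * p) + (2 * (kap0 * delta) * o + 2 * o)); last by ring.
  rewrite mulrDr lerD2l.
  (* As lam >= 1, dividing by 4 lam^2 does not enlarge the oscillation term. *)
  apply: (@le_trans _ _ (4 * 1 * ((8 * kap0 * T + 1) * o))).
    rewrite -mulrDl [leRHS]mulrA ler_wpM2r//; lra.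
  rewrite ler_wpM2r//; last lra.
  by rewrite mulr_ge0//; lra.
by rewrite ler_pM2l//; lra.
Qed.

End grid.

End good_lambda.

Lemma dominated_Rintegral_cvg d (T : measurableType d) (R : realType)
    (mu : {measure set T -> \bar R}) (f_ : nat -> T -> R) (f g : T -> R) :
  (forall n, measurable_fun setT (f_ n)) ->
  (forall x, f_ n x @[n --> \oo] --> f x) ->
  mu.-integrable setT (fun x => (g x)%:E) ->
  (forall n x, `|f_ n x| <= g x) ->
  \int[mu]_x f_ n x @[n --> \oo] --> \int[mu]_x f x.
Proof.
move=> mf f_f ig fg.
have mf' n : measurable_fun setT (EFin \o f_ n) by exact/measurable_EFinP.
have cf (x : T) : [set: T] x -> (EFin \o f_ n) x @[n --> \oo] --> (EFin \o f) x.
  by move=> _; apply: cvg_EFin; [exact: nearW|exact: f_f].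
have b (n : nat) (x : T) : [set: T] x -> (`|(EFin \o f_ n) x| <= (g x)%:E)%E.
  by move=> _; rewrite /= lee_fin.
have gf (x : T) : [set: T] x -> (g x)%:E \is a fin_num by [].
have h := dominated_cvg measurableT mf' cf gf ig b.
have imf : mu.-integrable setT (EFin \o f).
  have mfl : measurable_fun setT f by apply: (measurable_fun_cvg (h := f_)) => // x _; exact: f_f.
  apply: (le_integrable_EFin _ mfl _ ig) => // x _.
  apply: (ler_cvg_to (cvg_norm (f_f x)) (cvg_cst (g x))).
  exact: nearW.
have ffin := integrable_fin_num measurableT imf.
rewrite -(fineK ffin) in h.
exact: (fine_cvg h).
Qed.

(** Monotone convergence for truncations: they bound f from some rank on that depends on the point,
    so a bound on all their integrals passes to f. *)
Lemma monotone_limit_le d (T : measurableType d) (R : realType)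
    (mu : {measure set T -> \bar R}) (g : nat -> T -> \bar R) (f : T -> \bar R) B :
  (forall n, measurable_fun setT (g n)) -> (forall n x, 0 <= g n x)%E ->
  (forall x n m, (n <= m)%N -> g n x <= g m x)%E ->
  (forall x, exists n, f x <= g n x)%E -> (forall n, \int[mu]_x g n x <= B)%E ->
  (\int[mu]_x f x <= B)%E.
Proof.
move=> mg g0 nd fg gB.
have h := @cvg_monotone_convergence _ _ _ mu _ measurableT g mg (fun n x _ => g0 n x)
  (fun x _ n m => nd x n m).
have nd' x : nondecreasing_seq (g ^~ x) by move=> n m; exact: nd.
apply: (@le_trans _ _ (\int[mu]_x limn (g ^~ x))%E).
  apply: le_integral_nomeas => x _; have [n fgn] := fg x.
  by apply: le_trans fgn _; rewrite (cvg_lim _ (ereal_nondecreasing_cvgn (nd' x)))//; apply: ereal_sup_ubound; exists n.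
rewrite -(cvg_lim _ h)//; apply: lime_le; first by apply/cvg_ex; eexists; exact: h.
by near=> n.
Unshelve. all: by end_near. Qed.

Lemma powR_exprn (R : realType) (a r : R) n : 0 <= a -> (a `^ r) ^+ n = (a ^+ n) `^ r.
Proof.
by move=> a0; rewrite -(powR_mulrn n (powR_ge0 a r)) -powRrM mulrC powRrM powR_mulrn.
Qed.

(** * From tail inequalities to moments *)

Section tail_series.
Variable R : realType.
Implicit Types (rho x r : R).

(* A step function comparable to [x `^ r] when [rho = 3 `^ r]. *)
Definition tail_series rho K x : R := \sum_(k < K) rho ^+ k * (3 ^+ k < x)%R%:R.

Lemma tail_series_ge0 rho K x : 0 <= rho -> 0 <= tail_series rho K x.
Proof. by move=> rho0; apply: sumr_ge0 => k _; rewrite mulr_ge0// exprn_ge0. Qed.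

Lemma tail_series_homo rho K x y : 0 <= rho -> x <= y ->
  tail_series rho K x <= tail_series rho K y.
Proof.
move=> rho0 xy; apply: ler_sum => k _; rewrite ler_wpM2l ?exprn_ge0//.
case: (boolP (3 ^+ k < x)%R) => [kx|_]; last by rewrite ler0n.
by rewrite (lt_le_trans kx xy).
Qed.

(** For x between 3^K and 3^(K+1), the power is at most (3^r)^(K+1), that is 3^r times the last
    active term of the series. The 1 accounts for x <= 1. *)
Lemma powR_le_tail_series r K x : 1 <= r -> 0 <= x -> x <= 3 ^+ K ->
  x `^ r <= 1 + 3 `^ r * tail_series (3 `^ r) K x.
Proof.
move=> r1 x0; have r0 : 0 <= r by exact: le_trans r1.
have rho0 := powR_ge0 3 r.
elim: K => [|K IH] xK.
  rewrite /tail_series big_ord0 mulr0 addr0.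
  have := @ge0_ler_powR R r r0 x 1; rewrite !nnegrE x0 ler01 => /(_ isT isT xK).
  by rewrite powR1.
have TS : tail_series (3 `^ r) K.+1 x = tail_series (3 `^ r) K x + 3 `^ r ^+ K * (3 ^+ K < x)%R%:R.
  by rewrite /tail_series big_ord_recr.
rewrite TS; case: (leP x (3 ^+ K)) => xK'; first by rewrite mulr0 addr0 IH.
rewrite mulr1 mulrDr -exprS.
have h1 : x `^ r <= (3 `^ r) ^+ K.+1.
  have -> : (3 `^ r) ^+ K.+1 = (3 ^+ K.+1) `^ r.
    exact: powR_exprn.
  by apply: ge0_ler_powR; rewrite ?nnegrE// exprn_ge0.
have := mulr_ge0 rho0 (tail_series_ge0 K x rho0); lra.
Qed.

(** As r >= 1, the ratio 3^r is at least 2, so a geometric sum is at most twice its last term; the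
    last active term is at most x^r. *)
Lemma tail_series_le_powR r K x : 1 <= r -> 0 <= x ->
  tail_series (3 `^ r) K x <= 2 * x `^ r.
Proof.
move=> r1 x0; have r0 : 0 <= r by exact: le_trans r1.
have rho0 := powR_ge0 3 r.
have rho2 : 2 <= 3 `^ r.
  have := @ler_powR R 3 (ler1n _ 3) _ _ r1; rewrite powRr1//; lra.
have geo n : \sum_(k < n.+1) (3 `^ r) ^+ k <= 2 * (3 `^ r) ^+ n.
  elim: n => [|n IH]; first by rewrite big_ord_recr big_ord0 /= add0r expr0; lra.
  rewrite big_ord_recr /= exprS; have : 0 <= (3 `^ r) ^+ n by exact: exprn_ge0.
  by move: IH; nra.
elim: K => [|K IH]; first by rewrite /tail_series big_ord0 mulr_ge0// powR_ge0.
have [xK|xK] := leP x (3 ^+ K).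
  by rewrite /tail_series big_ord_recr /= ltNge xK mulr0 addr0 IH.
apply: (@le_trans _ _ (\sum_(k < K.+1) (3 `^ r) ^+ k)).
  by apply: ler_sum => k _; case: (_ < x); rewrite ?mulr1 ?mulr0 ?exprn_ge0.
apply: (le_trans (geo K)); rewrite ler_wpM2l//.
have -> : (3 `^ r) ^+ K = (3 ^+ K) `^ r by exact: powR_exprn.
by apply: ge0_ler_powR; rewrite ?nnegrE ?exprn_ge0// ltW.
Qed.

Lemma powR_le1D x (r q : R) : 1 <= r -> r <= q -> 0 <= x -> x `^ r <= 1 + x `^ q.
Proof.
move=> r1 rq x0; have r0 : 0 <= r by exact: le_trans r1.
have [x1|/ltW x1] := leP x 1.
  have := @ge0_ler_powR R r r0 x 1; rewrite !nnegrE x0 ler01 => /(_ isT isT x1).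
  by rewrite powR1; have := powR_ge0 x q; lra.
by have := ler_powR x1 rq; lra.
Qed.

End tail_series.

Section good_lambda_moment.
Variables (R : realType) (disp : measure_display) (Omega : measurableType disp).
Variable P : probability Omega R.

Definition tail_moment rho K (U : Omega -> R) := \int[P]_w tail_series rho K (U w).

Lemma tail_series_integrable rho K U : measurable_fun setT U ->
  P.-integrable setT (fun w => (tail_series rho K (U w))%:E).
Proof.
move=> mU; apply: integrable_EFin_sum => // k _; apply: integrable_EFinZl => //.
exact: exceed_integrable.
Qed.

Lemma tail_momentE rho K U : measurable_fun setT U ->
  tail_moment rho K U = \sum_(k < K) rho ^+ k * \int[P]_w ((3 ^+ k < U w)%R%:R : R).
Proof.
move=> mU; rewrite /tail_moment Rintegral_sum//; last first.
  by move=> k _; apply: integrable_EFinZl => //; exact: exceed_integrable.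
by apply: eq_bigr => k _; rewrite RintegralZl//; exact: exceed_integrable.
Qed.

(** The inequality at lam = 3^k, weighted by rho^(k+1), bounds the term of index k+1 in the tail
    moment of [M n]; the term of index 0 is at most 1. With rho eps <= 1/2 the tail moment of [M n]
    on the right is absorbed, which is legitimate as it is a finite sum. The error disappears in the
    limit because V does not depend on n. *)
Lemma tail_moment_good_lambda rho eps (U V : Omega -> R) (M : nat -> Omega -> R) (e : nat -> R) :
  0 <= rho -> rho * eps <= 2^-1 -> measurable_fun setT U -> measurable_fun setT V ->
  (forall n, measurable_fun setT (M n)) -> (forall n w, V w <= M n w) ->
  (forall n lam, 1 <= lam -> \int[P]_w ((3 * lam < M n w)%R%:R : R) <=
     \int[P]_w ((lam < U w)%R%:R : R) + eps * \int[P]_w ((lam < M n w)%R%:R : R) + e n) ->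
  e n @[n --> \oo] --> 0 ->
  forall K, tail_moment rho K V <= 2 + 2 * rho * tail_moment rho K U.
Proof.
move=> rho0 rhoe mU mV mM VM gl e0 K.
pose c : R := \sum_(k < K) rho ^+ k.
have c0 : 0 <= c by apply: sumr_ge0 => k _; exact: exprn_ge0.
have mom0 A : 0 <= tail_moment rho K A.
  by apply: Rintegral_ge0 => w _; exact: tail_series_ge0.
have step n : tail_moment rho K V <= 2 + 2 * rho * tail_moment rho K U + 2 * rho * c * e n.
  have VMn : tail_moment rho K V <= tail_moment rho K (M n).
    apply: le_Rintegral => //; try exact: tail_series_integrable.
    by move=> w _; exact: tail_series_homo.
  have Mn : tail_moment rho K (M n) <= 1 + rho * (tail_moment rho K U + eps * tail_moment rho K (M n) + c * e n).
    have p1 : \int[P]_w ((3 ^+ 0 < M n w)%R%:R : R) <= 1.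
      apply: (@le_trans _ _ (\int[P]_w 1)).
        apply: le_Rintegral => //; first exact: exceed_integrable.
          exact: (sqint_integrable (sqint_cst P 1)).
        by move=> w _; case: (_ < _).
      by rewrite Rintegral_cst//= probability_setT mul1r.
    apply: (@le_trans _ _ (1 + rho * \sum_(k < K) rho ^+ k * \int[P]_w ((3 ^+ k.+1 < M n w)%R%:R : R))).
      rewrite tail_momentE//; case: K {c c0 mom0 VMn} => [|K].
        by rewrite !big_ord0 mulr0 addr0.
      rewrite big_ord_recl expr0 mul1r lerD// big_ord_recr /= mulrDr mulr_sumr.
      apply: (@le_trans _ _ (\sum_(i < K) rho * (rho ^+ i * \int[P]_w ((3 ^+ i.+1 < M n w)%R%:R : R)))).
        by apply: ler_sum => i _; rewrite /bump leq0n add1n exprS mulrA.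
      rewrite lerDl !mulr_ge0 ?exprn_ge0//; exact: Rintegral_ge0.
    rewrite lerD2l ler_wpM2l// !tail_momentE// mulr_sumr /c mulr_suml -!big_split/=.
    apply: ler_sum => k _.
    have := gl n (3 ^+ k); rewrite exprn_ege1 ?ler1n// => /(_ isT); rewrite -exprS => h.
    apply: le_trans (ler_wpM2l (exprn_ge0 k rho0) h) _.
    by rewrite le_eqVlt; apply/orP; left; apply/eqP; ring.
  have := ler_wpM2r (mom0 (M n)) rhoe; lra.
apply/ler_addgt0Pr => x x0.
have k0 : 0 < 2 * rho * c + 1 by rewrite ltr_wpDl// !mulr_ge0.
have : \forall n \near \oo, e n < x / (2 * rho * c + 1).
  have xk : 0 < x / (2 * rho * c + 1) by rewrite divr_gt0.
  by near=> n; apply: (le_lt_trans (ler_norm _)); near: n; by have /cvgr0Pnorm_lt := e0; apply.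
move=> [n _ /(_ n (leqnn n)) /=]; rewrite ltr_pdivlMr// => en.
apply: (le_trans (step n)); rewrite lerD2l.
have [h|h] := leP 0 (e n); first by nra.
have : 2 * rho * c * e n <= 0 by rewrite mulr_ge0_le0//; [rewrite !mulr_ge0|exact: ltW].
lra.
Unshelve. all: by end_near. Qed.

End good_lambda_moment.

Section moments.
Variables (R : realType) (disp : measure_display) (Omega : measurableType disp).
Variables (P : probability Omega R) (T : R) (d k m : nat).
Variables (X0 : Omega -> 'rV[R]_d) (W : R -> Omega -> 'rV[R]_m).
Variable D : data R d k m.
Hypothesis T0 : 0 < T.
Hypothesis cP : measure_is_complete P.
Hypothesis bmW : brownian_motion P T W.
Hypothesis rX0 : random_vector X0.
Hypothesis iX0 : indep_gens P (rv_gens [set tt] (fun _ => X0)) (rv_gens `[0, T] W).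
Variable q : R.
Hypothesis X0q : (\int[P]_w (enorm (X0 w) `^ q)%:E < +oo)%E.
Hypothesis mD : measurable_data T D.
Hypothesis lipD : forward_lipschitz T D.
Variables (L : R -> Omega -> R) (X : R -> Omega -> 'rV[R]_d).
Hypothesis VL : in_V P T X0 W L.
Hypothesis solX : forward_solution P T X0 W D L X.

Let SX : in_S2 P T X0 W X. Proof. by case: solX. Qed.
Let pX w := S2_path SX w.

(** Uniform continuity makes the oscillation of each path vanish, and (2 sup |X|)^2, integrable
    because X is in S^2, dominates its square. *)
Lemma osc_cvg0 (h : R) : 0 < h ->
  \int[P]_w (path_osc T X (2 * (h / n.+1%:R)) w ^+ 2) @[n --> \oo] --> (0 : R).
Proof.
move=> h0; have T0' : 0 <= T by exact: ltW.
have o0 e w : 0 <= path_osc T X e w by exact: (path_osc_ge0 T0' pX).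
have -> : (0 : R) = \int[P]_w (0 : R) by rewrite Rintegral_cst// mul0r.
apply: (dominated_Rintegral_cvg (g := fun w => 4 * path_sup T X w ^+ 2)).
- move=> n; apply: measurable_funX; apply: (measurable_path_osc T0' pX) => s t sT tT.
  apply: measurable_mx_norm => j.
  rewrite (_ : (fun w => _) = fun w => X s w ord0 j - X t w ord0 j); last first.
    by apply/funext => w; rewrite !mxE.
  by apply: measurable_funB; exact: (S2_measurable cP bmW rX0 SX).
- move=> w; apply/cvgr0Pnorm_le => /= e e0.
  have se0 : 0 < Num.sqrt e by rewrite sqrtr_gt0.
  have [h1 h10 H] := path_osc_small T0' pX w se0.
  have : \forall n \near \oo, 2 * h / h1 <= n%:R :> R by exact: nbhs_infty_ger.
  apply: filterS => n hn.
  rewrite ger0_norm ?sqr_ge0// -(sqr_sqrtr (ltW e0)) lerXn2r ?nnegrE ?sqrtr_ge0//.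
  apply: H; rewrite mulrA ler_pdivrMr// -ler_pdivrMl// mulrC.
  by apply: le_trans hn _; rewrite ler_nat.
- by apply: integrable_EFinZl => //; exact: sqint_sqr (S2_sqint T0 cP bmW rX0 SX).
- move=> n w; rewrite ger0_norm ?sqr_ge0//.
  have -> : 4 * path_sup T X w ^+ 2 = (2 * path_sup T X w) ^+ 2 by ring.
  rewrite lerXn2r ?nnegrE//.
    by rewrite mulr_ge0//; exact: (path_sup_ge0 T0' pX).
  exact: (path_osc_le_sup T0' pX).
Qed.

Let mX t : 0 <= t <= T -> measurable_fun setT (fun w => `|X t w| : R).
Proof. by move=> tT; apply: measurable_mx_norm => j; exact: (S2_measurable cP bmW rX0 SX). Qed.

Lemma tail_moment_step rho : 1 <= rho -> exists2 delta0 : R, 0 < delta0 &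
  forall a s, 0 <= a -> a <= s -> s <= T -> s - a <= delta0 -> forall K,
    tail_moment P rho K (fun w => `|X s w|) <=
    2 + 2 * rho * tail_moment P rho K (fun w => `|X a w|).
Proof.
move=> rho1; have rho0 : 0 <= rho by exact: le_trans rho1.
have [C [Z [I [C0 itoI ZX driftX X00]]]] := forward_increments T0 cP bmW rX0 mD lipD VL SX solX.
set kap := kappa T d m C.
have kap0 : 0 <= kap by rewrite /kap /kappa !mulr_ge0 ?sqr_ge0// addr_ge0 ?mulr_ge0// ltW.
have den0 : 0 < 2 * (rho * kap) + 1 by have := mulr_ge0 rho0 kap0; lra.
(* Chosen so that rho * kap * delta0 <= 1/2; the 1 keeps the denominator positive when kap is 0. *)
exists (2 * (rho * kap) + 1)^-1; first by rewrite invr_gt0.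
move=> a s a0 as_ sT sad K.
have aT : 0 <= a <= T by rewrite a0 (le_trans as_).
have sT' : 0 <= s <= T by rewrite (le_trans a0).
move: as_; rewrite le_eqVlt => /predU1P[<-|as_].
  have m0 : 0 <= tail_moment P rho K (fun w => `|X a w|).
    by apply: Rintegral_ge0 => w _; exact: tail_series_ge0.
  by nra.
have d0 : 0 < s - a by rewrite subr_gt0.
have adT : a + (s - a) <= T by rewrite subrKC.
pose u n i : R := a + i%:R * ((s - a) / n.+1%:R).
have uN n : u n n.+1 = s by rewrite /u mulrC divfK// subrKC.
have uT n i : (i <= n.+1)%N -> 0 <= u n i <= T.
  move=> iN; have h0 : 0 <= (s - a) / n.+1%:R by rewrite divr_ge0// ltW.
  apply/andP; split; first by rewrite addr_ge0// 1?mulr_ge0.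
  by apply: le_trans sT; rewrite -[leRHS](uN n) lerD2l ler_wpM2r// ler_nat.
pose M n w := running_max (fun i => X (u n i) w) n.+1.
apply: (@tail_moment_good_lambda _ _ _ P rho (kap * (s - a)) _ _ M
  (fun n => (kap * T + 1) * \int[P]_w (path_osc T X (2 * ((s - a) / n.+1%:R)) w ^+ 2))) => //.
- rewrite mulrA; apply: (@le_trans _ _ (rho * kap * (2 * (rho * kap) + 1)^-1)); first by rewrite ler_wpM2l// mulr_ge0.
  rewrite ler_pdivrMr//; have := mulr_ge0 rho0 kap0; lra.
- exact: mX.
- exact: mX.
- move=> n; rewrite /M; elim: {1 3}n.+1 (leqnn n.+1) => [|i IH] iN; first by apply: mX; exact: uT.
  by apply: measurable_maxr; [exact: IH (ltnW iN)|apply: mX; exact: uT].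
- by move=> n w; rewrite -{1}(uN n); exact: le_running_max.
- move=> n lam lam1.
  exact: (good_lambda_grid T0 cP bmW rX0 iX0 SX C0 itoI ZX driftX n a0 d0 adT lam1).
- rewrite -[X in _ --> X](mulr0 (kap * T + 1)); apply: cvgMr; exact: osc_cvg0.
Qed.

(** The step length depends neither on the starting time nor on K, so finitely many steps reach T
    and the bound remains uniform in K. *)
Lemma tail_moment_bound rho : 1 <= rho ->
  (exists B : R, forall K, tail_moment P rho K (fun w => `|X 0 w|) <= B) ->
  exists B : R, forall s, 0 <= s <= T -> forall K, tail_moment P rho K (fun w => `|X s w|) <= B.
Proof.
move=> rho1 [B0 HB0]; have [delta0 delta00 step] := tail_moment_step rho1.
suff h (n : nat) : exists B : R, forall s, 0 <= s <= T -> s <= n%:R * delta0 ->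
    forall K, tail_moment P rho K (fun w => `|X s w|) <= B.
  have [B HB] := h (Num.trunc (T / delta0)).+1; exists B => s /andP[s0 sT]; apply: HB; first by rewrite s0.
  rewrite -ler_pdivrMr//; apply: ltW; apply: (le_lt_trans _ (truncnS_gt _)).
  by rewrite ler_wpM2r// invr_ge0 ltW.
elim: n => [|n [B HB]].
  exists B0 => s /andP[s0 sT]; rewrite mul0r => s0'.
  by have -> : s = 0 by apply/eqP; rewrite eq_le s0 s0'.
exists (Num.max B (2 + 2 * rho * B)) => s /andP[s0 sT] sn K; rewrite le_max.
have [h|h] := leP s (n%:R * delta0); first by rewrite HB// s0.
apply/orP; right.
have nd0 : 0 <= n%:R * delta0 by rewrite mulr_ge0// ltW.
apply: (le_trans (step (n%:R * delta0) s nd0 (ltW h) sT _ K)).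
  by move: sn; rewrite -natr1 mulrDl; lra.
rewrite lerD2l ler_wpM2l//; first by rewrite mulr_ge0// (le_trans _ rho1).
by apply: HB => //; rewrite nd0 (le_trans (ltW h)).
Qed.

Lemma forward_moment (r : R) : 1 <= r -> r <= q ->
  exists B : R, forall s, 0 <= s <= T -> (\int[P]_w (`|X s w| `^ r)%:E <= B%:E)%E.
Proof.
move=> r1 rq; have rho1 : 1 <= 3 `^ r.
  by have := @ler_powR R 3 (ler1n _ 3) _ _ r1; rewrite powRr1//; lra.
have rho0 : 0 <= 3 `^ r by exact: powR_ge0.
have q0 : 0 <= q by rewrite (le_trans _ rq)// (le_trans _ r1).
have mX0 : measurable_fun setT (fun w => `|X0 w| `^ q).
  apply: (@measurableT_comp _ _ _ _ _ _ (@powR R ^~ q)) => //.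
  by apply: measurable_mx_norm => j; exact: rX0.
have iX0q : P.-integrable setT (fun w => (`|X0 w| `^ q)%:E).
  apply/integrableP; split; first exact/measurable_EFinP.
  apply: le_lt_trans X0q; apply: le_integral_nomeas => w _.
  rewrite gee0_abs ?lee_fin ?powR_ge0// ge0_ler_powR ?nnegrE ?enorm_ge0//.
  exact: norm_le_enorm.
have [C [Z [I [_ _ _ _ X00]]]] := forward_increments T0 cP bmW rX0 mD lipD VL SX solX.
have [|B HB] := tail_moment_bound rho1.
  exists (\int[P]_w (2 * (1 + `|X0 w| `^ q))) => K.
  apply: ge0_ae_le_Rintegral.
  - have T00 : 0 <= (0 : R) <= T by rewrite lexx ltW.
    by have /integrableP[/measurable_EFinP] := tail_series_integrable P (3 `^ r) K (mX T00).
  - by move=> w; exact: tail_series_ge0.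
  - by move=> w; rewrite mulr_ge0// addr_ge0// powR_ge0.
  - apply: integrable_EFinZl => //; apply: integrable_EFinD => //.
    exact: (sqint_integrable (sqint_cst P 1)).
  - apply: filterS X00 => w ->; apply: (le_trans (tail_series_le_powR _ r1 _)) => //.
    by rewrite ler_wpM2l// powR_le1D.
exists (1 + 3 `^ r * B) => s sT.
(* |X_s| is cut at 3^K, the range in which K terms of the series control the power. *)
apply: (@monotone_limit_le _ _ _ P (fun K w => (Num.min `|X s w| (3 ^+ K) `^ r)%:E)).
- move=> K; apply/measurable_EFinP; apply: (@measurableT_comp _ _ _ _ _ _ (@powR R ^~ r)) => //.
  by apply: measurable_minr => //; exact: mX.
- by move=> K w; rewrite lee_fin powR_ge0.
- move=> w n K nK; rewrite lee_fin ge0_ler_powR ?nnegrE//.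
  + by rewrite (le_trans _ r1).
  + by rewrite le_min !ge_min lexx /= ler_weXn2l ?ler1n// orbT.
- move=> w; exists (Num.trunc `|X s w|).+1; rewrite min_l//.
  apply: ltW; apply: (lt_le_trans (truncnS_gt _)).
  rewrite -natrX ler_nat; apply: ltnW; exact: ltn_expl.
- move=> K.
  have iT := tail_series_integrable P (3 `^ r) K (mX sT).
  apply: (@le_trans _ _ (\int[P]_w (1 + 3 `^ r * tail_series (3 `^ r) K `|X s w|)%:E)%E).
    apply: le_integral_nomeas => w _; rewrite lee_fin.
    have m0 : 0 <= Num.min `|X s w| (3 ^+ K) by rewrite le_min normr_ge0 exprn_ge0.
    apply: (le_trans (powR_le_tail_series r1 m0 _)); first by rewrite ge_min; apply/orP; right.
    by rewrite lerD2l ler_wpM2l// tail_series_homo// ge_min lexx.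
  have i1 := sqint_integrable (sqint_cst P 1).
  have iS := integrable_EFinD measurableT i1 (integrable_EFinZl measurableT (3 `^ r) iT).
  rewrite -(fineK (integrable_fin_num measurableT iS)) lee_fin.
  rewrite -/(Rintegral _ _ _) RintegralD//; last exact: integrable_EFinZl.
  rewrite RintegralZl// Rintegral_cst//= probability_setT mul1r lerD2l ler_wpM2l//.
  exact: HB.
Qed.

End moments.

(** * Stieltjes integrals *)

Section stieltjes_measure.
Variable R : realType.
Implicit Types (F : R -> R) (a b t : R).

Lemma stieltjes_itvoc F a b : {homo F : x y / x <= y} ->
  (forall x, F y @[y --> x^'+] --> F x) -> a <= b ->
  stieltjes F `]a, b]%classic = (F b - F a)%:E.
Proof.
move=> ndF rcF ab; rewrite /stieltjes; case: pselect => [h|]; last first.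
  case; pose G : cumulative R R := HB.pack_for (cumulative R R) F
    (isCumulative.Build _ _ _ F ndF rcF).
  by exists G.
move: (projT2 (cid h)); set G := projT1 (cid h) => GF.
transitivity (wlength G `]a, b]%classic); last by rewrite wlength_itv_bnd// GF.
exact: (measurable_mu_extE (wlength G) (is_ocitv a b)).
Qed.

(** The measure is computed on half-open intervals, so the open one is exhausted by the intervals ]t
    - 1, t - 1/(n+1)], on which F has no increment. *)
Lemma stieltjes_null_itvoo F t : {homo F : x y / x <= y} ->
  (forall x, F y @[y --> x^'+] --> F x) -> (forall s, s < t -> F s = F (t - 1)) ->
  stieltjes F `]t - 1, t[%classic = 0%E.
Proof.
move=> ndF rcF Ft; apply: measure_negligible; first exact: measurable_itv.
rewrite itv_bnd_open_bigcup; apply: negligible_bigcup => n.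
apply/negligibleP; first exact: measurable_itv.
have n0 : 0 < n.+1%:R^-1 :> R by rewrite invr_gt0.
apply: (etrans (stieltjes_itvoc ndF rcF _)).
  by rewrite lerD2l lerN2 invf_le1// ler1n.
by rewrite (Ft (t - n.+1%:R^-1)) ?subrr// ltrBlDr ltrDl.
Qed.

End stieltjes_measure.

Section V_path.
Variables (R : realType) (T : R).
Hypothesis T0 : 0 < T.

Definition V_path (l : R -> R) := [/\ forall s, 0 <= s <= T -> 0 <= l s <= 1,
  forall s u, 0 <= s -> s <= u -> u <= T -> l u <= l s,
  forall s, 0 <= s -> s < T -> l u @[u --> s^'+] --> l s & l T = 0].

Variable l : R -> R.
Hypothesis Vl : V_path l.

Let F s := if s < 0 then 0 else 1 - l (Num.min s T).

Let min_itv s : 0 <= s -> 0 <= Num.min s T <= T.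
Proof. by move=> s0; rewrite le_min s0 (ltW T0) /= ge_min lexx orbT. Qed.

Let F_nd : {homo F : x y / x <= y}.
Proof.
case: Vl => l01 lnd _ _ x y xy; rewrite /F.
case: (ltP x 0) => x0; case: (ltP y 0) => y0 //.
- by have /andP[_] := l01 _ (min_itv y0); rewrite subr_ge0.
- lra.
- have /andP[h1 _] := min_itv x0; have /andP[_ h2] := min_itv y0.
  by rewrite lerB// lnd// le_min !ge_min xy lexx /= orbT.
Qed.

Let F_rc x : F y @[y --> x^'+] --> F x.
Proof.
case: Vl => l01 lnd rc lT.
have [x0|x0] := ltP x 0.
  apply: (@cvg_trans _ ((fun=> 0 : R) y @[y --> x^'+])).
    apply: near_eq_cvg; near=> y; rewrite /F; case: ltP => // y0.
    exfalso; have : y < 0 by near: y; exact: nbhs_right_lt.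
    by rewrite ltNge y0.
  by rewrite /F x0; exact: cvg_cst.
have [xT|xT] := ltP x T.
  apply: (@cvg_trans _ (1 - l y @[y --> x^'+])).
    apply: near_eq_cvg; near=> y; rewrite /F.
    have xy : x < y by near: y; exact: nbhs_right_gt.
    have yT : y < T by near: y; exact: nbhs_right_lt.
    by rewrite ltNge (le_trans x0 (ltW xy)) /= min_l// ltW.
  rewrite /F ltNge x0 /= min_l; last exact: ltW.
  by apply: cvgB; [exact: cvg_cst|exact: rc].
apply: (@cvg_trans _ ((fun=> 1 : R) y @[y --> x^'+])).
  apply: near_eq_cvg; near=> y; rewrite /F.
  have xy : x < y by near: y; exact: nbhs_right_gt.
  by rewrite ltNge (le_trans x0 (ltW xy)) /= min_r ?lT ?subr0// (le_trans xT)// ltW.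
by rewrite /F ltNge x0 /= min_r// lT subr0; exact: cvg_cst.
Unshelve. all: by end_near. Qed.

Local Notation mu := (neg_dmeasure T l).

Lemma V_mu_itv a b : 0 <= a -> a <= b -> b <= T ->
  mu `]a, b]%classic = (l a - l b)%:E.
Proof.
move=> a0 ab bT; rewrite /neg_dmeasure -/F stieltjes_itvoc//.
have b0 := le_trans a0 ab; have aT := le_trans ab bT.
by rewrite /F !ltNge a0 b0 /= !min_l//; congr EFin; ring.
Qed.

Section started.
Variable t : R.
Hypothesis tT : 0 <= t <= T.
Hypothesis lt1 : forall s, 0 <= s -> s < t -> l s = 1.

Lemma V_mu_total : mu `[t, T]%classic = 1%:E.
Proof.
have [l01 _ _ lT] := Vl.
have /andP[t0 tT'] := tT.
have Ft s : s < t -> F s = 0.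
  move=> st; rewrite /F; case: ltP => // s0.
  by rewrite min_l ?lt1 ?subrr// ltW// (lt_le_trans st).
(* F is 0 at every point left of t, either by the convention before time 0 or because l is 1 there;
   t - 1 is such a point even for t = 0. *)
have E : mu `]t - 1, T]%classic = 1%:E.
  rewrite /neg_dmeasure -/F stieltjes_itvoc//; last by lra.
  rewrite (Ft (t - 1)); last by lra.
  by rewrite /F ltNge (ltW T0) /= minxx lT !subr0.
have N : mu `]t - 1, t[%classic = 0%E.
  apply: stieltjes_null_itvoo => // s st; rewrite -/(F s) -/(F (t - 1)) !Ft//; lra.
transitivity (mu (`](t - 1)%R, t[%classic) + mu (`[t, T]%classic))%E; first by rewrite N add0e.
rewrite -E; have -> : `]t - 1, T]%classic = `]t - 1, t[ `|` `[t, T].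
  by rewrite -itv_bndbnd_setU// ?bnd_simp//; lra.
apply/esym; rewrite measureU//; try exact: measurable_itv.
apply/seteqP; split => // s [] /=; rewrite !in_itv/= => /andP[_ st] /andP[ts _].
by move: st; rewrite ltNge ts.
Qed.

(** The initial atom is read off from its complement in [t, T]: total mass one, less the mass l t of
    ]t, T]. *)
Lemma V_mu_set1 : mu [set t] = (1 - l t)%:E.
Proof.
have [l01 _ _ lT] := Vl.
have /andP[t0 tT'] := tT.
have E := V_mu_total.
have : (mu [set t] + mu `]t, T]%classic = 1%:E)%E.
  rewrite -E -(@setU1itv _ _ (BRight T) t false) ?bnd_simp// measureU//.
  apply/seteqP; split => // s [] /= ->; rewrite in_itv/= ltxx.
  by [].
rewrite (V_mu_itv t0 tT' (lexx T)) lT subr0.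
case: (mu [set t]) => [r| |] //= => -[].
by move=> <-; rewrite addrK.
Qed.

Lemma V_mu_subitv A : measurable (A : set (measurableTypeR R)) -> A `<=` `[t, T] -> (mu A <= 1)%E.
Proof.
by move=> mA AT; rewrite -V_mu_total; apply: le_measure; rewrite ?inE//; exact: measurable_itv.
Qed.

Lemma path_cont_measurable (g : R -> R) : path_cont T g ->
  measurable_fun (`[0, T] : set (measurableTypeR R)) g.
Proof.
by move=> /path_contP cg; apply: subspace_continuous_measurable_fun => //; exact: measurable_itv.
Qed.

Lemma V_mu_integrable (g : R -> R) (A : set (measurableTypeR R)) M : measurable A -> A `<=` `[t, T] ->
  measurable_fun A g -> (forall s, A s -> `|g s| <= M) ->
  mu.-integrable A (fun s => (g s)%:E).
Proof.
move=> mA AT mg gM; apply: measurable_bounded_integrable => //.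
- exact: (le_lt_trans (V_mu_subitv mA AT) (ltry 1)).
- exists M; split; first by rewrite num_real.
  by move=> y My s As; apply: le_trans (ltW My); exact: gM.
Qed.

Lemma V_mu_path_integrable (g : R -> R) (A : set (measurableTypeR R)) : measurable A -> A `<=` `[t, T] ->
  path_cont T g -> mu.-integrable A (fun s => (g s)%:E).
Proof.
move=> mA AT cg; have [M M0 gM] := path_bounded cg.
have A0T : A `<=` `[0, T].
  move=> s /AT; rewrite /= !in_itv/= => /andP[ts ->]; rewrite andbT.
  by case/andP: tT => t0 _; exact: le_trans ts.
apply: (V_mu_integrable (M := M)) => //.
  by apply: measurable_funS (path_cont_measurable cg) => //; exact: measurable_itv.
by move=> s /A0T; rewrite /= in_itv/=; exact: gM.
Qed.

(** Right endpoints match the half-open intervals, on which mu is an increment of l; the atom 1 - l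
    t at the starting point is a separate term. The error is e times the mass l t of the rest. *)
Lemma riemann_stieltjes (g : R -> R) (u : nat -> R) (e : R) n : 0 <= e -> path_cont T g ->
  (forall i j, (i <= j)%N -> u i <= u j) -> u 0%N = t -> u n = T ->
  (forall i s, (i < n)%N -> u i <= s <= u i.+1 -> `|g s - g (u i.+1)| <= e) ->
  `|\int[mu]_(s in `[t, T]) g s -
    (g t * (1 - l t) + \sum_(i < n) g (u i.+1) * (l (u i) - l (u i.+1)))| <= e.
Proof.
move=> e0 cg undd u0 uT ge; have [l01 lnd _ lT] := Vl.
have /andP[t0 tT'] := tT.
have uit i : t <= u i by rewrite -u0 undd.
have step j : (j <= n)%N -> `|\int[mu]_(s in `]t, u j]) g s -
    \sum_(i < j) g (u i.+1) * (l (u i) - l (u i.+1))| <= e * (l t - l (u j)).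
  elim: j => [|j IH] jn.
    by rewrite big_ord0 u0 set_itvoc0 Rintegral_set0 !subrr normr0 mulr0.
  have ujT : u j.+1 <= T by rewrite -uT undd.
  have jj : u j <= u j.+1 by rewrite undd.
  have uj0 : 0 <= u j by rewrite (le_trans t0).
  have ig A : measurable (A : set (measurableTypeR R)) -> A `<=` `]t, u j.+1] -> mu.-integrable A (fun s => (g s)%:E).
    move=> mA AS; apply: V_mu_path_integrable => // s /AS; rewrite /= !in_itv/= => /andP[/ltW -> h].
    exact: le_trans ujT.
  have sp : `]t, u j.+1]%classic = `]t, u j] `|` `]u j, u j.+1].
    by rewrite -itv_bndbnd_setU// ?bnd_simp.
  have sub2 : `]u j, u j.+1]%classic `<=` `]t, u j.+1]%classic.
    by move=> s; rewrite /= !in_itv/= => /andP[h ->]; rewrite andbT (le_lt_trans _ h).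
  rewrite sp Rintegral_setU//; first last.
  - apply/eqP; apply/seteqP; split => // s [] /=; rewrite !in_itv/= => /andP[_ h1] /andP[h2 _].
    by move: h2; rewrite ltNge h1.
  - by rewrite -sp; apply: ig => //; exact: measurable_itv.
  rewrite big_ord_recr /=.
  set a := \int[mu]_(s in `]t, u j]) g s in IH *; set S := \sum_(i < j) _ in IH *.
  have {}IH := IH (ltnW jn).
  have piece : `|\int[mu]_(s in `]u j, u j.+1]) g s - g (u j.+1) * (l (u j) - l (u j.+1))|
      <= e * (l (u j) - l (u j.+1)).
    have ij : mu.-integrable `]u j, u j.+1]%classic (fun s => (g s)%:E).
      by apply: ig => //; exact: measurable_itv.
    have ic c : mu.-integrable `]u j, u j.+1]%classic (fun=> (c : R)%:E).
      apply: (V_mu_integrable (M := `|c|)) => //.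
      by move=> s /sub2; rewrite /= !in_itv/= => /andP[/ltW -> h]; exact: le_trans ujT.
    have Ec c : \int[mu]_(s in `]u j, u j.+1]) c = c * (l (u j) - l (u j.+1)).
      by rewrite Rintegral_cst; [rewrite V_mu_itv|exact: measurable_itv].
    rewrite -Ec -[X in _ <= X]Ec -RintegralB//; last exact: ic.
    apply: Rintegral_abs_le; [exact: measurable_itv| |exact: ic].
    by move=> s; rewrite /= in_itv/= => /andP[/ltW h1 h2]; apply: ge => //; rewrite h1 h2.
  have -> : a + \int[mu]_(s in `]u j, u j.+1]) g s - (S + g (u j.+1) * (l (u j) - l (u j.+1))) =
    (a - S) + (\int[mu]_(s in `]u j, u j.+1]) g s - g (u j.+1) * (l (u j) - l (u j.+1))) by ring.
  apply: (le_trans (ler_normD _ _)); apply: (le_trans (lerD IH piece)).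
  by rewrite le_eqVlt; apply/orP; left; apply/eqP; ring.
have ig A : measurable (A : set (measurableTypeR R)) -> A `<=` `[t, T] -> mu.-integrable A (fun s => (g s)%:E).
  by move=> mA AT; exact: V_mu_path_integrable.
have sp : `[t, T]%classic = [set t] `|` `]t, T] by rewrite (setU1itv false).
rewrite sp Rintegral_setU//; first last.
- by apply/eqP; apply/seteqP; split => // s [] /= ->; rewrite in_itv/= ltxx.
- by rewrite -sp; apply: ig => //; exact: measurable_itv.
have -> : \int[mu]_(s in [set t]) g s = g t * (1 - l t).
  transitivity (\int[mu]_(s in [set t]) (g t)).
    by apply: eq_Rintegral => s; rewrite inE /= => ->.
  by rewrite Rintegral_cst// V_mu_set1.
have := step n (leqnn n); rewrite uT lT subr0 => h.
rewrite opprD addrACA subrr add0r; apply: (le_trans h).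
have /andP[_ h2] := l01 t tT.
have /andP[h1 _] := l01 t tT.
by rewrite ler_piMr.
Qed.

End started.

End V_path.

(** * Riemann sums and exchange of the order of integration *)

Section grid.
Variables (R : realType) (T t : R).
Hypothesis tT : 0 <= t <= T.

(** With n + 1 steps there is no division by zero. All points coincide when t = T, so the grid is
    only weakly increasing. *)
Definition ugrid (n i : nat) : R := t + i%:R * ((T - t) / n.+1%:R).

Let mesh0 n : 0 <= (T - t) / n.+1%:R.
Proof. by case/andP: tT => _ h; rewrite divr_ge0// subr_ge0. Qed.

Lemma ugrid0 n : ugrid n 0 = t.
Proof. by rewrite /ugrid mul0r addr0. Qed.

Lemma ugridT n : ugrid n n.+1 = T.
Proof. by rewrite /ugrid mulrC divfK// subrKC. Qed.

Lemma ugrid_homo n i j : (i <= j)%N -> ugrid n i <= ugrid n j.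
Proof. by move=> ij; rewrite lerD2l ler_wpM2r// ler_nat. Qed.

Lemma ugrid_itv n i : (i <= n.+1)%N -> t <= ugrid n i <= T.
Proof. by move=> iN; have := ugrid_homo n (leq0n i); have := ugrid_homo n iN; rewrite ugrid0 ugridT => -> ->. Qed.

Lemma ugridS n i : ugrid n i.+1 - ugrid n i = (T - t) / n.+1%:R.
Proof. by rewrite /ugrid -natr1 mulrDl mul1r; set x := _ / _; ring. Qed.

Lemma ugrid_mesh (e : R) : 0 < e -> \forall n \near \oo, (T - t) / n.+1%:R < e.
Proof.
move=> e0; have : \forall n \near \oo, (T - t) / e <= n%:R :> R by exact: nbhs_infty_ger.
apply: filterS => n hn; rewrite ltr_pdivrMr// mulrC -ltr_pdivrMr//.
by apply: (le_lt_trans hn); rewrite ltr_nat.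
Qed.

End grid.

(** In its uses y is a control. Summation by parts moves the increments onto the integrand and
    evaluates the control at the left end of each step, hence in an adapted way. *)
Lemma abel_stieltjes (R : comNzRingType) (x y : nat -> R) n : x 0%N = 0 -> y n = 0 ->
  \sum_(i < n) x i.+1 * (y i - y i.+1) = \sum_(i < n) (x i.+1 - x i) * y i.
Proof.
move=> x0 yn; apply/eqP; rewrite -subr_eq0 -sumrB.
apply/eqP; transitivity (x 0%N * y 0%N - x n * y n); last by rewrite x0 yn mul0r mulr0 subrr.
elim: n {yn} => [|n IH]; first by rewrite big_ord0 subrr.
by rewrite big_ord_recr /= IH; ring.
Qed.

Section riemann.
Variables (R : realType) (T : R).
Hypothesis T0 : 0 < T.
Variable l : R -> R.
Hypothesis Vl : V_path T l.
Variable t : R.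
Hypothesis tT : 0 <= t <= T.
Hypothesis lt1 : forall s, 0 <= s -> s < t -> l s = 1.

Local Notation mu := (neg_dmeasure T l).
Local Notation leb := (@lebesgue_measure R).
Local Notation u := (ugrid T t).

Lemma riemann_cvg (g : R -> R) : path_cont T g ->
  (g t * (1 - l t) + \sum_(i < n.+1) g (u n i.+1) * (l (u n i) - l (u n i.+1)))
    @[n --> \oo] --> \int[mu]_(s in `[t, T]) g s.
Proof.
move=> cg; apply/cvgrPdist_le => /= e e0.
have [h h0 gh] := path_unif cg e0.
have /andP[t0 tT'] := tT.
apply: filterS (ugrid_mesh T t h0) => n nh.
have un i : (i <= n.+1)%N -> 0 <= u n i <= T.
  by move=> /(ugrid_itv tT) /andP[h1 ->]; rewrite (le_trans t0).
apply: (riemann_stieltjes T0 Vl tT lt1 (ltW e0) cg (ugrid_homo tT n) (ugrid0 T t n) (ugridT T t n)).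
move=> i s iN /andP[h1 h2]; apply/ltW; have sn := ugridS T t n i.
have /andP[a1 a2] := un i (ltnW iN); have /andP[b1 b2] := un i.+1 iN.
apply: gh; [by rewrite (le_trans a1)// (le_trans h2)|by rewrite b1|].
rewrite distrC ger0_norm ?subr_ge0//; apply: le_lt_trans nh; rewrite -sn; lra.
Qed.

Lemma riemann_abel_cvg (g : R -> R) : path_cont T g -> g t = 0 ->
  (\sum_(i < n.+1) (g (u n i.+1) - g (u n i)) * l (u n i))
    @[n --> \oo] --> \int[mu]_(s in `[t, T]) g s.
Proof.
move=> cg gt0; have [_ _ _ lT] := Vl.
rewrite (_ : (fun n => _) = fun n => g t * (1 - l t) +
    \sum_(i < n.+1) g (u n i.+1) * (l (u n i) - l (u n i.+1))); first exact: riemann_cvg.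
apply/funext => n; rewrite gt0 mul0r add0r.
by rewrite (@abel_stieltjes _ (fun i => g (u n i)) (fun i => l (u n i))) ?ugrid0 ?ugridT.
Qed.

Section fubini.
Variables (g : R -> R) (M : R).
Hypothesis mg : measurable_fun (`[0, T] : set (measurableTypeR R)) g.
Hypothesis gM : forall s, 0 <= s <= T -> `|g s| <= M.
Hypothesis ml : measurable_fun (`[0, T] : set (measurableTypeR R)) l.

Let M0 : 0 <= M.
Proof. exact: le_trans (normr_ge0 _) (gM tT). Qed.

Lemma bounded_leb_integrable (f : R -> R) (c : R) (i : interval R) : [set` i] `<=` `[0, T] ->
  measurable_fun (`[0, T] : set (measurableTypeR R)) f ->
  (forall s, 0 <= s <= T -> `|f s| <= c) -> leb.-integrable [set` i] (fun s => (f s)%:E).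
Proof.
move=> iT mf fc; apply: (@le_integrable_EFin _ _ _ _ _ _ _ (fun=> c)) => //.
- by apply: measurable_funS mf => //; exact: measurable_itv.
- by move=> s /iT; rewrite /= in_itv/=; exact: fc.
- exact: integrable_cst_itv iT.
Qed.

Lemma primitive_lip x y : 0 <= x -> x <= y -> y <= T ->
  `|\int[leb]_(s in `[t, y]) g s - \int[leb]_(s in `[t, x]) g s| <= M * (y - x).
Proof.
move=> x0 xy yT; have /andP[t0 tT'] := tT.
(* Before t the interval of integration is empty, so the primitive is extended by 0. *)
have [xt|tx] := ltP x t.
  rewrite [`[t, x]%classic]set_itv_ge ?bnd_simp -?ltNge// Rintegral_set0 subr0.
  have [yt|ty] := ltP y t.
    rewrite set_itv_ge ?bnd_simp -?ltNge// Rintegral_set0 normr0 mulr_ge0// subr_ge0//.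
  have sT : `[t, y] `<=` `[0, T].
    by move=> s; rewrite /= !in_itv/= => /andP[h1 h2]; rewrite (le_trans t0 h1) (le_trans h2).
  apply: (@le_trans _ _ (M * (y - t))); last by rewrite ler_wpM2l// lerB// ltW.
  apply: (le_trans (Rintegral_abs_le (g := fun=> M) _ _ _)) => //.
  - by move=> s /sT; rewrite /= in_itv/=; exact: gM.
  - exact: integrable_cst_itv sT.
  - rewrite Rintegral_cst//= lebesgue_measure_itv/= lte_fin.
    move: ty; rewrite le_eqVlt => /predU1P[->|ty]; first by rewrite ltxx /= subrr !mulr0.
    by rewrite ty.
have sT : `[t, y] `<=` `[0, T].
  by move=> s; rewrite /= !in_itv/= => /andP[h1 h2]; rewrite (le_trans t0 h1) (le_trans h2).
rewrite Rintegral_itvB ?bnd_simp//; last exact: (bounded_leb_integrable sT mg gM).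
have sT' : `]x, y] `<=` `[0, T].
  by move=> s; rewrite /= !in_itv/= => /andP[/ltW h1 h2]; rewrite (le_trans x0 h1) (le_trans h2).
apply: (le_trans (Rintegral_abs_le (g := fun=> M) _ _ _)) => //.
- by move=> s /sT'; rewrite /= in_itv/=; exact: gM.
- exact: integrable_cst_itv sT'.
- rewrite Rintegral_cst//= lebesgue_measure_itv/= lte_fin.
  move: xy; rewrite le_eqVlt => /predU1P[->|xy]; first by rewrite ltxx /= subrr !mulr0.
  by rewrite xy.
Qed.

Lemma primitive_cont : path_cont T (fun x => \int[leb]_(s in `[t, x]) g s).
Proof.
move=> x /andP[x0 xT] e e0; exists (e / (M + 1)); first by rewrite divr_gt0// ltr_pwDr.
move=> y /andP[y0 yT] yx.
have h : `|\int[leb]_(s in `[t, y]) g s - \int[leb]_(s in `[t, x]) g s| <= M * `|y - x|.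
  have [xy|/ltW yx'] := leP x y.
    by rewrite [`|y - x|]ger0_norm ?subr_ge0//; exact: primitive_lip.
  by rewrite distrC [`|y - x|]distrC [`|x - y|]ger0_norm ?subr_ge0//; exact: primitive_lip.
apply: (le_lt_trans h); move: yx; rewrite ltr_pdivlMr ?ltr_pwDr// => yx.
by have := normr_ge0 (y - x); nra.
Qed.

(** Both sides are limits of the sums of (G u_(i+1) - G u_i) l u_i, G being the primitive of g. On
    the side of mu this is [riemann_abel_cvg]; on the Lebesgue side, monotonicity of l makes the
    errors telescope to at most M times the mesh times l t. *)
Lemma stieltjes_fubini :
  \int[leb]_(s in `[t, T]) (g s * l s) =
  \int[mu]_(x in `[t, T]) (\int[leb]_(s in `[t, x]) g s).
Proof.
have [l01 lnd _ lT] := Vl; have /andP[t0 tT'] := tT.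
pose G x := \int[leb]_(s in `[t, x]) g s.
have G0 : G t = 0 by rewrite /G set_itv1 Rintegral_set1.
have h := riemann_abel_cvg primitive_cont G0; rewrite -/G in h.
apply: cvg_unique h => //.
have glM s : 0 <= s <= T -> `|g s * l s| <= M.
  move=> sT; have /andP[a b] := l01 s sT.
  by rewrite normrM (ger0_norm a) (le_trans _ (gM sT))// ler_piMr.
have mgl : measurable_fun (`[0, T] : set (measurableTypeR R)) (fun s => g s * l s).
  exact: measurable_funM.
have un n i : (i <= n.+1)%N -> 0 <= u n i <= T.
  by move=> /(ugrid_itv tT) /andP[h1 ->]; rewrite (le_trans t0).
have step n j : (j <= n.+1)%N ->
   `|\int[leb]_(s in `[t, u n j]) (g s * l s) - \sum_(i < j) (G (u n i.+1) - G (u n i)) * l (u n i)|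
    <= M * ((T - t) / n.+1%:R) * (l t - l (u n j)).
  elim: j => [|j IH] jn.
    by rewrite big_ord0 ugrid0 set_itv1 Rintegral_set1 !subrr normr0 mulr0.
  have {}IH := IH (ltnW jn); rewrite big_ord_recr /=.
  have /andP[b0 bT] := un n j.+1 jn; have /andP[a0 aT] := un n j (ltnW jn).
  have ab := ugrid_homo tT n (leqnSn j); have ta : t <= u n j by have /andP[] := ugrid_itv tT (ltnW jn).
  set a := u n j in IH a0 aT ab ta *; set b := u n j.+1 in b0 bT ab *.
  have sb : `[t, b] `<=` `[0, T].
    by move=> s; rewrite /= !in_itv/= => /andP[h1 h2]; rewrite (le_trans t0 h1) (le_trans h2).
  have sab : `]a, b] `<=` `[0, T].
    by move=> s; rewrite /= !in_itv/= => /andP[/ltW h1 h2]; rewrite (le_trans a0 h1) (le_trans h2).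
  have e1 : \int[leb]_(s in `[t, b]) (g s * l s) = \int[leb]_(s in `[t, a]) (g s * l s) + \int[leb]_(s in `]a, b]) (g s * l s).
    have := bounded_leb_integrable sb mgl glM => ib.
    by rewrite -(Rintegral_itvB (x := a) ib) ?bnd_simp//; ring.
  have e2 : G b - G a = \int[leb]_(s in `]a, b]) g s.
    by rewrite Rintegral_itvB ?bnd_simp//; exact: (bounded_leb_integrable sb mg gM).
  have ig := bounded_leb_integrable sab mg gM.
  have igl := bounded_leb_integrable sab mgl glM.
  have e3 : `|\int[leb]_(s in `]a, b]) (g s * l s) - (G b - G a) * l a| <= M * (b - a) * (l a - l b).
    rewrite e2 mulrC -RintegralZl// -RintegralB//; last exact: (integrable_EFinZl _ (l a) ig).
    apply: (@le_trans _ _ (\int[leb]_(s in `]a, b]) (M * (l a - l b)))).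
      apply: Rintegral_abs_le => //; last exact: integrable_cst_itv sab.
      move=> s sab'; have := sab s sab'; move: sab'; rewrite /= !in_itv/= => /andP[h1 h2] sT.
      rewrite mulrC -mulrBl normrM mulrC; apply: ler_pM => //; first exact: gM.
      have l1 := lnd a s a0 (ltW h1) (le_trans h2 bT).
      have l2 := lnd s b (le_trans a0 (ltW h1)) h2 bT.
      by rewrite ler_norml; lra.
    rewrite Rintegral_cst//= lebesgue_measure_itv/= lte_fin.
    move: ab; rewrite le_eqVlt => /predU1P[->|ab]; first by rewrite ltxx /= !subrr !mulr0.
    by rewrite ab /= mulrAC.
  rewrite e1.
  set x := \int[leb]_(s in `]a, b]) _ in e3 *; set y := \int[leb]_(s in `[t, a]) _ in IH *.
  set S := \sum_(i < j) _ in IH *; set z := _ * l a in e3 *.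
  have -> : y + x - (S + z) = (y - S) + (x - z) by ring.
  apply: (le_trans (ler_normD _ _)); apply: (le_trans (lerD IH e3)).
  have := ugridS T t n j; rewrite -/a -/b => ->.
  by rewrite le_eqVlt; apply/orP; left; apply/eqP; ring.
apply/cvgrPdist_le => /= e e0.
have e1 : 0 < e / (M + 1) by rewrite divr_gt0// ltr_pwDr.
apply: filterS (ugrid_mesh T t e1) => n; rewrite ltr_pdivlMr ?ltr_pwDr// => nh.
have := step n n.+1 (leqnn _); rewrite ugridT lT subr0 => hs; apply: (le_trans hs).
have /andP[l0 l1] := l01 t tT.
have m0 : 0 <= (T - t) / n.+1%:R by rewrite divr_ge0// subr_ge0.
apply: (@le_trans _ _ (M * ((T - t) / n.+1%:R))); first by rewrite ler_piMr// mulr_ge0.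
by apply: ltW; apply: le_lt_trans nh; rewrite mulrC ler_wpM2l// lerDl.
Qed.

End fubini.

End riemann.

(** * Running reward and obstacle *)

Lemma tonelli_path_integral (R : realType) (disp : measure_display)
    (Omega : measurableType disp) (P : probability Omega R)
    (B : set (measurableTypeR R)) (f : R -> Omega -> R) : measurable B ->
  measurable_fun (B `*` setT : set (measurableTypeR R * Omega)) (fun p => f p.1 p.2) ->
  (forall r w, 0 <= f r w) ->
  (\int[P]_w \int[lebesgue_measure]_(r in B) (f r w)%:E =
   \int[lebesgue_measure]_(r in B) \int[P]_w (f r w)%:E)%E.
Proof.
move=> mB mf f0.
pose F := ((fun q : measurableTypeR R * Omega => (f q.1 q.2)%:E) \_ (B `*` setT))%E.
have mBT : measurable (B `*` setT : set (measurableTypeR R * Omega)) by exact: measurableX.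
have mF : measurable_fun setT F.
  by apply: (measurable_restrictT _ mBT).1; exact/measurable_EFinP.
have F0 p : (0 <= F p)%E by rewrite /F patchE; case: ifP => // _; rewrite lee_fin.
have FE r w : F (r, w) = if r \in B then (f r w)%:E else 0%E.
  rewrite /F patchE; congr (if _ then _ else _).
  by apply/idP/idP => /set_mem h; apply/mem_set => //; case: h.
have h := fubini_tonelli (m1 := lebesgue_measure) (m2 := P) F mF F0.
transitivity (\int[P]_w \int[lebesgue_measure]_r F (r, w))%E.
  apply: eq_integral => w _; rewrite integral_mkcond; apply: eq_integral => r _.
  by rewrite FE patchE.
rewrite -h [RHS]integral_mkcond; apply: eq_integral => r _; rewrite patchE.
case: ifPn => rB; first by apply: eq_integral => w _; rewrite FE rB.
by under eq_integral do rewrite FE (negbTE rB); rewrite integral0.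
Qed.

Section coefficients.
Variables (R : realType) (disp : measure_display) (Omega : measurableType disp).
Variables (P : probability Omega R) (T q : R) (d k m : nat).
Variables (X0 : Omega -> 'rV[R]_d) (W : R -> Omega -> 'rV[R]_m).
Variable D : data R d k m.
Hypothesis T0 : 0 < T.
Hypothesis q4 : 4 <= q.
Hypothesis cP : measure_is_complete P.
Hypothesis bmW : brownian_motion P T W.
Hypothesis rX0 : random_vector X0.
Hypothesis iX0 : indep_gens P (rv_gens [set tt] (fun _ => X0)) (rv_gens `[0, T] W).
Hypothesis X0q : (\int[P]_w (enorm (X0 w) `^ q)%:E < +oo)%E.
Hypothesis mD : measurable_data T D.
Hypothesis lipD : forward_lipschitz T D.
Hypothesis regD : backward_regular T q D.
Variables (L : R -> Omega -> R) (X : R -> Omega -> 'rV[R]_d).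
Hypothesis VL : in_V P T X0 W L.
Hypothesis solX : forward_solution P T X0 W D L X.

Local Notation leb := (@lebesgue_measure R).
Local Notation filt := (filt P X0 W).
Local Notation Fmeas t f :=
  (measurable_fun (setT : set (g_sigma_algebraType (filt t))) (f : Omega -> R)).

Let SX : in_S2 P T X0 W X. Proof. by case: solX. Qed.
Let mT : measurable (`[0, T] : set (measurableTypeR R)). Proof. exact: measurable_itv. Qed.

Lemma in_V_path (Lh : R -> Omega -> R) w : in_V P T X0 W Lh -> V_path T (Lh ^~ w).
Proof.
move=> [_ _ L01 Lnd [rc _ LT]]; split.
- by move=> s sT; apply: L01; rewrite in_itv.
- move=> s u s0 su uT; apply: Lnd => //; rewrite in_itv/=.
    by rewrite s0 (le_trans su).
  by rewrite uT (le_trans s0).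
- by move=> s; exact: rc.
- exact: LT.
Qed.

Lemma V_Fmeas (Lh : R -> Omega -> R) t : in_V P T X0 W Lh -> 0 <= t <= T -> Fmeas t (Lh t).
Proof.
move=> [_ aL _ _ _] tT; have := aL t; rewrite in_itv/= => /(_ tT ord0 ord0).
by under eq_fun do rewrite mxE.
Qed.

(** The integrand of the mean field of [c_fbar] grows like |x|^r, so the moment of order r, bounded
    uniformly in time, bounds this mean field by a constant [M]; f is then compared with its value
    at mean field 0. *)
Lemma running_growth : exists C r : R, [/\ 0 <= C, 1 <= r, r <= q & forall (s : R) w, 0 <= s <= T ->
  `|running P D L X s w| <= C * (1 + `|X s w| `^ r)].
Proof.
have [[K [r [K0 r1 rq [lipf grow _]]]] _] := regD.
have rq' : r <= q by rewrite (le_trans (ltW rq))//; have := q4; lra.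
have r0 : 0 <= r by exact: le_trans r1.
have [B HB] := forward_moment T0 cP bmW rX0 iX0 X0q mD lipD VL solX r1 rq'.
pose a : R := d%:R `^ r.
have a0 : 0 <= a by exact: powR_ge0.
have er (x : 'rV[R]_d) : enorm x `^ r <= a * `|x| `^ r.
  rewrite /a -powRM// ge0_ler_powR ?nnegrE ?enorm_ge0// ?mulr_ge0//.
  exact: enorm_le_norm.
have gr s x : 0 <= s <= T -> `|c_f D s x 0| <= K * (1 + a * `|x| `^ r) /\
    enorm (c_fbar D s x) <= K * (1 + a * `|x| `^ r).
  move=> sT; have := grow s; rewrite in_itv/= => /(_ sT x).
  have := normr_ge0 (c_f D s x 0); have := normr_ge0 (c_h D s x 0).
  have := enorm_ge0 (c_fbar D s x).
  have := ler_wpM2l K0 (er x); rewrite !mulrDr; split; lra.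
have iXr s : 0 <= s <= T -> P.-integrable setT (fun w => (`|X s w| `^ r)%:E).
  move=> sT; apply/integrableP; split.
    apply/measurable_EFinP; apply: (@measurableT_comp _ _ _ _ _ _ (@powR R ^~ r)) => //.
    by apply: measurable_mx_norm => j; exact: (S2_measurable cP bmW rX0 SX).
  under eq_integral do rewrite gee0_abs ?lee_fin ?powR_ge0//.
  exact: le_lt_trans (HB s sT) (ltry _).
pose M := K * (1 + a * B).
have mfM s : 0 <= s <= T -> `|mean_field P (c_fbar D) X L s| <= M.
  move=> sT; have i1 := sqint_integrable (sqint_cst P 1).
  have iB := integrable_EFinZl measurableT K
    (integrable_EFinD measurableT i1 (integrable_EFinZl measurableT a (iXr s sT))).
  apply: (le_trans (mean_field_bound VL sT iB _ _)).
  - by move=> w; rewrite mulr_ge0// addr_ge0// mulr_ge0// powR_ge0.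
  - move=> w j; apply: (le_trans (le_entry_enorm _ _ _)).
    by have [] := gr s (X s w) sT.
  - rewrite RintegralZl//; last first.
      exact: (integrable_EFinD measurableT i1 (integrable_EFinZl measurableT a (iXr s sT))).
    rewrite RintegralD//; last exact: (integrable_EFinZl measurableT a (iXr s sT)).
    rewrite (RintegralZl a measurableT (iXr s sT)) Rintegral_cst//= probability_setT mul1r.
    rewrite ler_wpM2l// lerD2l ler_wpM2l//.
    by rewrite -lee_fin /Rintegral fineK ?HB// (integrable_fin_num measurableT (iXr s sT)).
have M0 : 0 <= M.
  by apply: le_trans (mfM 0 _) => //; rewrite lexx ltW.
exists (K * (1 + a + k%:R * M)), r; split => // [|s w sT].
  by rewrite mulr_ge0// !addr_ge0// mulr_ge0.
have [h1 _] := gr s (X s w) sT.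
have := lipf s; rewrite in_itv/= => /(_ sT (X s w) 0 (mean_field P (c_fbar D) X L s)).
rewrite subr0 -/(running P D L X s w) => h2.
have h3 := enorm_le_norm (mean_field P (c_fbar D) X L s).
have h4 : K * enorm (mean_field P (c_fbar D) X L s) <= K * (k%:R * M).
  by rewrite ler_wpM2l// (le_trans h3)// ler_wpM2l// mfM.
have := ler_normD (c_f D s (X s w) 0) (running P D L X s w - c_f D s (X s w) 0).
rewrite addrC subrK => h5; apply: (le_trans h5); apply: (le_trans (lerD h1 (le_trans h2 h4))).
have x0 := powR_ge0 `|X s w| r.
rewrite -subr_ge0 (_ : _ - _ = K * (a + `|X s w| `^ r + k%:R * M * `|X s w| `^ r)); last by ring.
by rewrite mulr_ge0// addr_ge0 ?addr_ge0// mulr_ge0// mulr_ge0.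
Qed.

Lemma running_measurable w : measurable_fun (`[0, T] : set (measurableTypeR R)) (fun s => running P D L X s w).
Proof.
apply: (measurable_fun_comp3 mT (T := T) (g := fun s x z => c_f D s x z)).
- by case: mD => _ [].
- exact: measurable_id.
- by move=> r; rewrite /= in_itv.
- move=> i; exact: (measurable_path mT (f := fun r w => X r w ord0 i) (S2_joint cP bmW rX0 SX i) w).
- move=> i; apply: (mean_field_measurable T0 cP bmW rX0 SX VL).
  by case: mD => _ [].
Qed.

Lemma running_bounded w : exists M : R, forall s, 0 <= s <= T -> `|running P D L X s w| <= M.
Proof.
have [C [r [C0 r1 _ g]]] := running_growth.
exists (C * (1 + path_sup T X w `^ r)) => s sT; apply: (le_trans (g s w sT)).
rewrite ler_wpM2l// lerD2l ge0_ler_powR ?nnegrE//.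
- by rewrite (le_trans _ r1).
- exact: (path_sup_ge0 (ltW T0) (S2_path SX)).
- exact: (S2_le_sup T0 SX).
Qed.

(** The moment bound has the supremum over time outside the expectation. The majorant is therefore
    the time integral of the growth bound, integrable by Tonelli, rather than a supremum over
    time. *)
Lemma running_dominated : exists G : Omega -> R,
  P.-integrable setT (fun w => (G w)%:E) /\
  forall (i : interval R) w, [set` i] `<=` `[0, T] ->
    `|\int[leb]_(s in [set` i]) running P D L X s w| <= G w.
Proof.
have [C [r [C0 r1 rq g]]] := running_growth.
have [B HB] := forward_moment T0 cP bmW rX0 iX0 X0q mD lipD VL solX r1 rq.
have r0 : 0 <= r by exact: le_trans r1.
pose f s w : R := C * (1 + `|X s w| `^ r).
have f0 s w : 0 <= f s w by rewrite mulr_ge0// addr_ge0// powR_ge0.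
have mf : measurable_fun (`[0, T] `*` setT : set (measurableTypeR R * Omega)) (fun p => f p.1 p.2).
  apply: measurable_funM; first exact: measurable_cst.
  apply: measurable_funD; first exact: measurable_cst.
  apply: (@measurableT_comp _ _ _ _ _ _ (@powR R ^~ r)) => //.
  apply: measurable_mx_norm => j; exact: (S2_joint cP bmW rX0 SX j).
have fP w s : 0 <= s <= T -> `|f s w| <= C * (1 + path_sup T X w `^ r).
  move=> sT; rewrite ger0_norm// ler_wpM2l// lerD2l ge0_ler_powR ?nnegrE//.
    exact: (path_sup_ge0 (ltW T0) (S2_path SX)).
  exact: (S2_le_sup T0 SX).
have fint w (i : interval R) : [set` i] `<=` `[0, T] -> leb.-integrable [set` i] (fun s => (f s w)%:E).
  move=> iT; apply: (bounded_leb_integrable iT _ (fP w)).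
  exact: (measurable_path mT mf).
have fin w : (\int[leb]_(s in `[0%R, T]) (f s w)%:E \is a fin_num)%E.
  by apply: integrable_fin_num => //; exact: fint.
exists (fun w => \int[leb]_(s in `[0, T]) f s w); split.
  apply/integrableP; split.
    apply/measurable_EFinP; apply: measurableT_comp; first exact: fine_measurable.
    exact: (measurable_path_integral mT mf mT).
  rewrite (_ : (fun w => _) = fun w => \int[leb]_(s in `[0%R, T]) (f s w)%:E)%E; last first.
    apply/funext => w; rewrite gee0_abs ?fineK//.
    by apply: integral_ge0 => s _; rewrite lee_fin.
  rewrite tonelli_path_integral//.
  apply: (@le_lt_trans _ _ (\int[leb]_(s in `[0%R, T]) (C * (1 + B))%:E)%E).
    apply: le_integral_nomeas => s; rewrite /= in_itv/= => sT.
    have mX : measurable_fun setT (fun w => `|X s w| `^ r).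
      apply: (@measurableT_comp _ _ _ _ _ _ (@powR R ^~ r)) => //.
      by apply: measurable_mx_norm => j; exact: (S2_measurable cP bmW rX0 SX).
    under eq_integral do rewrite EFinM.
    have m1X : measurable_fun setT (fun w => (1 + `|X s w| `^ r)%:E).
      by apply/measurable_EFinP; apply: measurable_funD => //; exact: measurable_cst.
    rewrite ge0_integralZl_EFin//.
    rewrite EFinM lee_wpmul2l ?lee_fin//.
    under eq_integral do rewrite EFinD.
    have mX' : measurable_fun setT (fun w => (`|X s w| `^ r)%:E) by exact/measurable_EFinP.
    rewrite ge0_integralD//.
    by rewrite integral_cst//= probability_setT mul1e EFinD leeD2l// HB.
  by have /integrableP[_] := integrable_cst_itv (i := `[0, T]) (C * (1 + B)) (@subset_refl _ `[0, T]%classic);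
    apply: le_lt_trans; apply: le_integral_nomeas => s _; rewrite lee_abs.
move=> i w iT; apply: (@le_trans _ _ (\int[leb]_(s in [set` i]) f s w)).
  apply: Rintegral_abs_le => //; last exact: fint.
  by move=> s /iT; rewrite /= in_itv/=; exact: g.
rewrite /Rintegral fine_le//.
- by apply: integrable_fin_num => //; exact: fint.
- apply: ge0_subset_integral => //.
    by have /integrableP[] := fint w `[0, T] (@subset_refl _ _).
  by move=> s _; rewrite lee_fin.
Qed.

Section obstacle.

Let phi := c_phi D.

Lemma phi_unif (e : R) : 0 < e -> exists2 h : R, 0 < h & forall a b : R,
  - T <= a <= T -> - T <= b <= T -> `|a - b| < h -> `|phi a - phi b| < e.
Proof.
move=> e0; have [_ [_ [cphi _]]] := regD.
(* Translation by T gives a path on [0, 2 T], to which uniform continuity of paths applies. *)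
pose g x := phi (x - T).
have cg : path_cont (2 * T) g.
  move=> x xT e' e'0; have := (subspace_continuousP _ _).1 cphi (x - T).
  have xT' : `[- T, T]%classic (x - T) by rewrite /= in_itv/=; apply/andP; split; lra.
  move=> /(_ xT') /cvgr_distC_lt /(_ _ e'0); rewrite near_withinE => /nbhs_ballP[h /= h0 hf].
  exists h => // y yT yx; apply: hf.
    by rewrite /ball /= (_ : x - T - (y - T) = x - y) 1?distrC//; ring.
  by rewrite /= in_itv/=; apply/andP; split; lra.
have [h h0 H] := path_unif cg e0; exists h => // a b aT bT ab.
have := H (a + T) (b + T); rewrite /g !addrK; apply; try (apply/andP; split; lra).
by rewrite (_ : _ - _ = a - b)//; ring.
Qed.

Lemma phi_path t : 0 <= t <= T -> path_cont T (fun s => phi (t - s)).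
Proof.
move=> tT x xT e e0; have [h h0 H] := phi_unif e0; exists h => // y yT yx.
apply: H; try (apply/andP; split; lra).
by rewrite (_ : _ - _ = x - y) 1?distrC//; ring.
Qed.

Let T00 : 0 <= (0 : R) <= T. Proof. by rewrite lexx ltW. Qed.
(** Vacuous: starting at time 0, the requirement that the control be 1 earlier is taken over by the
    convention L_{0-} = 1. *)
Let lt0 w (s : R) : 0 <= s -> s < 0 -> L s w = 1.
Proof. by move=> s0; rewrite ltNge s0. Qed.

Definition phi_int t w := \int[neg_dmeasure T (L ^~ w)]_(s in `[0, T]) phi (t - s).

(** The measure of integration depends on the outcome; in the Riemann sums the outcome enters only
    through finitely many values of L. *)
Lemma phi_int_measurable t : 0 <= t <= T -> measurable_fun setT (phi_int t).
Proof.
move=> tT; have V w := in_V_path w VL.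
apply: (measurable_fun_cvg (h := fun n w => phi (t - 0) * (1 - L 0 w) +
  \sum_(i < n.+1) phi (t - ugrid T 0 n i.+1) * (L (ugrid T 0 n i) w - L (ugrid T 0 n i.+1) w))).
  move=> n; have mL s : 0 <= s <= T -> measurable_fun setT (L s).
    move=> sT; have /andP[_ sT'] := sT.
    exact: (filt_measurable_fun cP bmW rX0 sT' (V_Fmeas VL sT)).
  apply: measurable_funD.
    by apply: measurable_funM => //; apply: measurable_funB => //; exact: mL.
  apply: measurable_sum => i; apply: measurable_funM => //; apply: measurable_funB; apply: mL.
    by apply: ugrid_itv => //; exact: ltnW.
  exact: ugrid_itv.
move=> w _; exact: (riemann_cvg T0 (V w) T00 (@lt0 w) (phi_path tT)).
Qed.

Lemma phi_int_dist t u (e : R) w : 0 <= t <= T -> 0 <= u <= T ->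
  (forall s, 0 <= s <= T -> `|phi (t - s) - phi (u - s)| <= e) ->
  `|phi_int t w - phi_int u w| <= e.
Proof.
move=> tT uT h; have V := in_V_path w VL.
have i1 c : 0 <= c <= T -> (neg_dmeasure T (L ^~ w)).-integrable `[0, T]%classic (fun s => (phi (c - s))%:E).
  by move=> cT; apply: (V_mu_path_integrable T0 V T00 (@lt0 w) _ _ (phi_path cT)).
have mu1 := V_mu_total T0 V T00 (@lt0 w).
rewrite /phi_int -RintegralB//; [|exact: i1|exact: i1].
apply: (@le_trans _ _ (\int[neg_dmeasure T (L ^~ w)]_(s in `[0, T]) e)).
  apply: Rintegral_abs_le; [exact: mT|by move=> s; rewrite /= in_itv/=; exact: h|].
  apply: (V_mu_integrable T0 V T00 (@lt0 w) (M := `|e|)) => //.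
by rewrite Rintegral_cst// mu1 mulr1.
Qed.

Lemma phi_int_bounded t : 0 <= t <= T -> exists M : R, forall w, `|phi_int t w| <= M.
Proof.
move=> tT; have [M M0 H] := path_bounded (phi_path tT); exists M => w.
have V := in_V_path w VL.
have mu1 := V_mu_total T0 V T00 (@lt0 w).
apply: (@le_trans _ _ (\int[neg_dmeasure T (L ^~ w)]_(s in `[0, T]) M)).
  apply: Rintegral_abs_le; [exact: mT|by move=> s; rewrite /= in_itv/=; exact: H|].
  apply: (V_mu_integrable T0 V T00 (@lt0 w) (M := `|M|)) => //.
by rewrite Rintegral_cst// mu1 mulr1.
Qed.

(** The measures -dL have mass one, so the modulus of continuity of phi passes through both
    integrals. *)
Lemma phi_mean_path : path_cont T (fun t => \int[P]_w int_d T 0 (L ^~ w) (fun s => phi (t - s))).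
Proof.
have ip t : 0 <= t <= T -> P.-integrable setT (fun w => (phi_int t w)%:E).
  move=> tT; have [M hM] := phi_int_bounded tT.
  apply: sqint_integrable.
  by have := sqint_bounded (sqint_cst P 1) (phi_int_measurable tT) hM; under eq_fun do rewrite mulr1.
have E t : 0 <= t <= T -> \int[P]_w int_d T 0 (L ^~ w) (fun s => phi (t - s)) = - \int[P]_w phi_int t w.
  move=> tT; rewrite -mulN1r -RintegralZl//; last exact: ip.
  by apply: eq_Rintegral => w _; rewrite mulN1r.
move=> x xT e e0; have e20 : 0 < e / 2 by rewrite divr_gt0.
have [h h0 H] := phi_unif e20; exists h => // y yT yx.
rewrite !E// opprK addrC -RintegralB//; [|exact: ip|exact: ip].
apply: (@le_lt_trans _ _ (\int[P]_w (e / 2))).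
  apply: Rintegral_abs_le => //; last exact: (sqint_integrable (sqint_cst P (e / 2))).
  move=> w _; apply: phi_int_dist => // s sT; apply: ltW; apply: H; try (apply/andP; split; lra).
  by rewrite (_ : _ - _ = x - y) 1?distrC//; ring.
by rewrite Rintegral_cst//= probability_setT mulr1 gtr_pMr//; lra.
Qed.

Lemma obstacle_path w : path_cont T (fun t => obstacle P T D L X t w).
Proof.
have [_ [ch _]] := regD.
apply/path_contP/subspace_continuousP => x xT.
have := (subspace_continuousP _ _).1 ch
  (x, X x w, \int[P]_w' int_d T 0 (L ^~ w') (fun s => phi (x - s))).
have D0 (y : R) z z' : `[0, T]%classic y -> (`[0, T] `*` setT `*` setT : set (R * 'rV[R]_d * R)) (y, z, z').
  by move=> yT; split => //; split.
move=> /(_ (D0 _ _ _ xT)) hc.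
pose gam (y : R) := (y, X y w, \int[P]_w' int_d T 0 (L ^~ w') (fun s => phi (y - s))).
have gc : gam y @[y --> within `[0, T] (nbhs x)] --> gam x.
  have c1 : y @[y --> within `[0, T] (nbhs x)] --> x by apply: cvg_within_filter; exact: cvg_id.
  have c2 := (subspace_continuousP _ _).1 ((path_contP _ _).2 (S2_path SX w)) x xT.
  have c3 := (subspace_continuousP _ _).1 ((path_contP _ _).2 phi_mean_path) x xT.
  exact: cvg_pair (cvg_pair c1 c2) c3.
apply: (@cvg_comp _ _ _ gam (fun p => c_h D p.1.1 p.1.2 p.2) (within `[0, T] (nbhs x)) _ _ _ hc).
move=> A; rewrite /= !nbhs_simpl => hA.
have hA' : \forall p \near gam x, (`[0, T] `*` setT `*` setT : set (R * 'rV[R]_d * R)) p -> A p.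
  exact: hA.
have : \forall y \near within `[0, T] (nbhs x), (`[0, T] `*` setT `*` setT : set (R * 'rV[R]_d * R)) (gam y) -> A (gam y).
  exact: gc hA'.
rewrite !near_withinE; apply: filterS => y hy yT; apply: hy => //; exact: D0.
Qed.

Lemma obstacle_Fmeas t : 0 <= t <= T -> Fmeas t (obstacle P T D L X t).
Proof.
move=> tT.
apply: (@measurable_fun_comp3R _ _ (g_sigma_algebraType (filt t)) setT measurableT T _ (c_h D)
  (fun=> t) (X t) (fun=> _)).
- by case: mD => _ [].
- exact: measurable_cst.
- by [].
- by move=> j; exact: (S2_adapted SX).
- exact: measurable_cst.
Qed.

End obstacle.

End coefficients.

(** * Rewards of stopping controls *)

(** By monotonicity every value before t is at least the left limit 1. *)
Lemma started_left_value (R : realType) (T t : R) (l : R -> R) : V_path T l ->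
  0 <= t <= T -> (0 < t -> cvg (l s @[s --> t^'-])) -> left_value l t = 1 ->
  forall s, 0 <= s -> s < t -> l s = 1.
Proof.
move=> [l01 lnd _ _] /andP[t0 tT] cl; rewrite /left_value; case: eqP => [->|/eqP tn0].
  by move=> _ s s0; rewrite ltNge s0.
have tp : 0 < t by rewrite lt_neqAle eq_sym tn0.
move=> lim1 s s0 st; apply/eqP; rewrite eq_le; apply/andP; split.
  by have /andP[] := l01 s ltac:(by rewrite s0 (le_trans (ltW st))).
rewrite -lim1; apply: limr_le; first exact: cl.
near=> u; apply: lnd => //.
  by apply: ltW; near: u; exact: nbhs_left_gt.
by rewrite (le_trans _ tT)//; near: u; exact: nbhs_left_le.
Unshelve. all: by end_near. Qed.

Section reward.
Variables (R : realType) (disp : measure_display) (Omega : measurableType disp).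
Variables (P : probability Omega R) (T q : R) (d k m : nat).
Variables (X0 : Omega -> 'rV[R]_d) (W : R -> Omega -> 'rV[R]_m).
Variable D : data R d k m.
Hypothesis T0 : 0 < T.
Hypothesis q4 : 4 <= q.
Hypothesis cP : measure_is_complete P.
Hypothesis bmW : brownian_motion P T W.
Hypothesis rX0 : random_vector X0.
Hypothesis iX0 : indep_gens P (rv_gens [set tt] (fun _ => X0)) (rv_gens `[0, T] W).
Hypothesis X0q : (\int[P]_w (enorm (X0 w) `^ q)%:E < +oo)%E.
Hypothesis mD : measurable_data T D.
Hypothesis lipD : forward_lipschitz T D.
Hypothesis regD : backward_regular T q D.
Variables (L : R -> Omega -> R) (X : R -> Omega -> 'rV[R]_d).
Hypothesis VL : in_V P T X0 W L.
Hypothesis solX : forward_solution P T X0 W D L X.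
Variables (Y A I : R -> Omega -> R) (Z : R -> Omega -> 'rV[R]_m).
Hypothesis SY : in_S2 P T X0 W (fun t w => vec1 (Y t w)).
Hypothesis SA : in_A2 P T X0 W A.
Hypothesis itoI : is_ito_integral P T X0 W Z I.

Local Notation leb := (@lebesgue_measure R).
Local Notation filt := (filt P X0 W).
Local Notation Fmeas t f :=
  (measurable_fun (setT : set (g_sigma_algebraType (filt t))) (f : Omega -> R)).
Local Notation run := (running P D L X).
Local Notation obs := (obstacle P T D L X).

Definition reflected_path w :=
  [/\ forall u, 0 <= u <= T -> Y u w = obs T w + \int[leb]_(s in `[u, T]) run s w
        + A T w - A u w - (I T w - I u w),
      forall u, 0 <= u <= T -> obs u w <= Y u w &
      (\int[dmeasure T (A ^~ w)]_(u in `[0%R, T]) (Y u w - obs u w)%:E = 0)%E].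

Hypothesis refl : {ae P, forall w, reflected_path w}.

Variable t : R.
Hypothesis tT : 0 <= t <= T.

Let t0 : 0 <= t. Proof. by case/andP: tT. Qed.
Let tT' : t <= T. Proof. by case/andP: tT. Qed.

Lemma scalar_path (S : R -> Omega -> R) w : continuous_paths T (fun t w => vec1 (S t w)) -> path_cont T (S ^~ w).
Proof.
move=> cS x xT e e0.
have /path_contP H := cS w; have [h h0 hf] := H x xT e e0; exists h => // y yT yx.
by apply: le_lt_trans (hf y yT yx); have := le_entry_norm (vec1 (S y w) - vec1 (S x w)) ord0; rewrite !mxE.
Qed.

Let pY w : path_cont T (Y ^~ w). Proof. by apply: scalar_path; case: SY. Qed.
Let pA w : path_cont T (A ^~ w). Proof. by apply: scalar_path; case: SA => -[]. Qed.
Let pI w : path_cont T (I ^~ w). Proof. by apply: scalar_path; case: itoI. Qed.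
Arguments pI w [x] _ [e] _.

Lemma primitive_running w u : reflected_path w -> t <= u <= T ->
  \int[leb]_(s in `[t, u]) run s w = Y t w - Y u w - (A u w - A t w) + (I u w - I t w).
Proof.
move=> [eqY _ _] /andP[tu uT].
have [M HM] := running_bounded T0 q4 cP bmW rX0 iX0 X0q mD lipD regD VL solX w.
have mr := running_measurable T0 cP bmW rX0 mD VL solX w.
have sT : `[t, T] `<=` `[0, T].
  by move=> s; rewrite /= !in_itv/= => /andP[h ->]; rewrite (le_trans t0 h).
have sT' : `[u, T] `<=` `[0, T].
  by move=> s; rewrite /= !in_itv/= => /andP[h ->]; rewrite (le_trans t0) ?(le_trans tu).
have ir := bounded_leb_integrable sT mr HM.
have ir' := bounded_leb_integrable sT' mr HM.
have E : \int[leb]_(s in `[t, T]) run s w = \int[leb]_(s in `[t, u]) run s w + \int[leb]_(s in `[u, T]) run s w.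
  rewrite -[\int[leb]_(s in `[u, T]) _]Rintegral_itv_obnd_cbnd; last first.
    by apply: integrableS ir' => //; [exact: measurable_itv..|move=> s; rewrite /= !in_itv/= => /andP[/ltW -> ->]].
  by rewrite -(Rintegral_itvB (x := u) ir) ?bnd_simp//; ring.
have uT' : 0 <= u <= T by rewrite (le_trans t0 tu).
have := eqY t tT; have := eqY u uT'; move: E.
move: (\int[leb]_(s in `[t, T]) run s w) (\int[leb]_(s in `[t, u]) run s w)
  (\int[leb]_(s in `[u, T]) run s w) (obs T w) => a b c e ->; lra.
Qed.

Variable Lh : R -> Omega -> R.
Hypothesis VLh : in_V_at P T X0 W t Lh.

Let VLh' : in_V P T X0 W Lh. Proof. by case: VLh. Qed.
Let Vl w : V_path T (Lh ^~ w) := in_V_path w VLh'.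

Definition started w := forall s, 0 <= s -> s < t -> Lh s w = 1.

Lemma started_ae : {ae P, forall w, started w}.
Proof.
case: VLh => _; apply: filterS => w lv.
apply: (started_left_value (Vl w) tT) lv => tp.
by case: VLh' => _ _ _ _ [_ h _]; apply: h.
Qed.

(** Being null, this set belongs to F_t by augmentation. Removing it from a test set preserves
    F_t-measurability and leaves only outcomes at which the pathwise identities hold. *)
Definition exceptional := [set w | ~ (reflected_path w /\ started w)].

Lemma exceptional_negligible : P.-negligible exceptional.
Proof.
have : {ae P, forall w, reflected_path w /\ started w}.
  by apply: filterS2 refl started_ae => w; split.
by rewrite /almost_everywhere; apply: negligibleS.
Qed.

Local Notation mu w := (neg_dmeasure T (Lh ^~ w)).

(** I is centred at time t, so that the integrand vanishes at the start, as summation by parts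
    requires. *)
Definition martingale_part w := \int[mu w]_(s in `[t, T]) (I s w - I t w).

Let pJ w : path_cont T (fun s => I s w - I t w).
Proof.
move=> x xT e e0; have [h h0 H] := pI w xT e0; exists h => // y yT yx.
by rewrite opprB addrA subrK; exact: H.
Qed.

Let mLh w : measurable_fun (`[0, T] : set (measurableTypeR R)) (Lh ^~ w).
Proof.
have mT : measurable (`[0, T] : set (measurableTypeR R)) by exact: measurable_itv.
exact: (measurable_path mT (V_joint T0 cP bmW rX0 VLh') w).
Qed.

Lemma rewardE w : reflected_path w -> started w ->
  stopping_reward P T D L X t Lh w = Y t w + martingale_part w
    - \int[mu w]_(u in `[t, T]) ((Y u w - obs u w) + (A u w - A t w)).
Proof.
move=> rw sw; rewrite /stopping_reward /int_d opprK.
have [M HM] := running_bounded T0 q4 cP bmW rX0 iX0 X0q mD lipD regD VL solX w.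
have mr := running_measurable T0 cP bmW rX0 mD VL solX w.
rewrite (stieltjes_fubini T0 (Vl w) tT sw mr HM (mLh w)).
have pobs := obstacle_path T0 cP bmW rX0 regD VL solX w.
have mtT : measurable (`[t, T] : set (measurableTypeR R)) by exact: measurable_itv.
have ip g : path_cont T g -> (mu w).-integrable `[t, T]%classic (fun s => (g s)%:E).
  by move=> cg; exact: (V_mu_path_integrable T0 (Vl w) tT sw mtT (@subset_refl _ _) cg).
have ic c : (mu w).-integrable `[t, T]%classic (fun=> (c : R)%:E).
  apply: (V_mu_integrable T0 (Vl w) tT sw (M := `|c|)) => //.
have iF := ip _ (primitive_cont tT mr HM).
have iobs := ip _ pobs; have iY := ip _ (pY w); have iA := ip _ (pA w); have iJ := ip _ (pJ w).
have iYo := integrable_EFinB mtT iY iobs.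
have iAA := integrable_EFinB mtT iA (ic (A t w)).
have iD := integrable_EFinD mtT iYo iAA.
have iYJ := integrable_EFinD mtT (ic (Y t w)) iJ.
have mu1 := V_mu_total T0 (Vl w) tT sw.
rewrite -RintegralD//.
have -> : Y t w + martingale_part w = \int[mu w]_(s in `[t, T]) (Y t w + (I s w - I t w)).
  by rewrite (RintegralD mtT (ic (Y t w)) iJ) Rintegral_cst// mu1 mulr1.
rewrite -RintegralB//; apply: eq_Rintegral => u; rewrite inE /= in_itv/= => ut.
by rewrite (primitive_running rw ut); ring.
Qed.

Lemma ito_increment_dominated : exists g : Omega -> R, P.-integrable setT (fun w => (g w)%:E) /\
  forall w, reflected_path w -> forall u, t <= u <= T -> `|I u w - I t w| <= g w.
Proof.
have [G [iG GB]] := running_dominated T0 q4 cP bmW rX0 iX0 X0q mD lipD regD VL solX.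
have SA' : in_S2 P T X0 W (fun t w => vec1 (A t w)) by case: SA.
pose sY := path_sup T (fun t w => vec1 (Y t w)); pose sA := path_sup T (fun t w => vec1 (A t w)).
have iY := sqint_integrable (S2_sqint T0 cP bmW rX0 SY).
have iA := sqint_integrable (S2_sqint T0 cP bmW rX0 SA').
exists (fun w => 2 * sY w + 2 * sA w + G w); split.
  apply: (integrable_EFinD measurableT) iG.
  exact: (integrable_EFinD measurableT (integrable_EFinZl measurableT 2 iY) (integrable_EFinZl measurableT 2 iA)).
move=> w rw u ut; have /andP[tu uT] := ut; have uT' : 0 <= u <= T by rewrite (le_trans t0 tu).
have le1 S v : `|S v w| <= path_sup T (fun t w => vec1 (S t w)) w -> - path_sup T (fun t w => vec1 (S t w)) w <= S v w <= path_sup T (fun t w => vec1 (S t w)) w.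
  by rewrite ler_norml.
have bS S (SS : in_S2 P T X0 W (fun t w => vec1 (S t w))) v : 0 <= v <= T ->
    - path_sup T (fun t w => vec1 (S t w)) w <= S v w <= path_sup T (fun t w => vec1 (S t w)) w.
  move=> vT; apply: le1; apply: le_trans (S2_le_sup T0 SS w vT).
  by have := le_entry_norm (vec1 (S v w)) ord0; rewrite mxE.
have h1 := bS _ SY t tT; have h2 := bS _ SY u uT'.
have h3 := bS _ SA' t tT; have h4 := bS _ SA' u uT'.
have sT : `[t, u] `<=` `[0, T].
  by move=> s; rewrite /= !in_itv/= => /andP[a b]; rewrite (le_trans t0 a) (le_trans b).
have := GB `[t, u] w sT; rewrite (primitive_running rw ut) !ler_norml.
rewrite -/(sY w) -/(sA w) in h1 h2 h3 h4 *.
move: h1 h2 h3 h4 => /andP[? ?] /andP[? ?] /andP[? ?] /andP[? ?] /andP[? ?].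
by apply/andP; split; lra.
Qed.

Lemma martingale_part_mean (B : set Omega) : <<s filt t>> B ->
  P.-integrable setT (fun w => (\1_(B `\` exceptional) w * martingale_part w)%:E) /\
  \int[P]_w (\1_(B `\` exceptional) w * martingale_part w) = 0.
Proof.
move=> mB; set E := B `\` exceptional.
have mE : <<s filt t>> E.
  have mN : <<s filt t>> exceptional by apply: filt_negligible; exact: exceptional_negligible.
  exact: (@measurableD _ (g_sigma_algebraType (filt t)) B exceptional mB mN).
have fchi : Fmeas t (\1_E : Omega -> R).
  exact: (@measurable_indic _ (g_sigma_algebraType (filt t)) R setT E mE).
have [g [ig gI]] := ito_increment_dominated.
have chi01 w : 0 <= (\1_E w : R) <= 1 by rewrite indicE ler0n lern1 leq_b1.
pose u := ugrid T t.
have uT n i : (i <= n.+1)%N -> 0 <= u n i <= T.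
  by move=> /(ugrid_itv tT) /andP[h1 ->]; rewrite (le_trans t0).
(* Riemann sums after summation by parts: the weight of an increment of I is the indicator times the
   control, both known at the left end of the step, so each term has mean zero. *)
pose J n w := \1_E w * \sum_(i < n.+1) ((I (u n i.+1) w - I t w) - (I (u n i) w - I t w)) * Lh (u n i) w.
have JE n w : J n w = \sum_(i < n.+1) (\1_E w * Lh (u n i) w) * (I (u n i.+1) w - I (u n i) w).
  by rewrite /J mulr_sumr; apply: eq_bigr => i _; ring.
have eta_m n i : (i <= n.+1)%N -> Fmeas (u n i) (fun w => \1_E w * Lh (u n i) w).
  move=> iN; apply: measurable_funM.
    by apply: (filt_fun_mono _ fchi); have /andP[] := ugrid_itv tT iN.
  exact: (V_Fmeas VLh' (uT n i iN)).
have l01 n i w : (i <= n.+1)%N -> 0 <= Lh (u n i) w <= 1.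
  by move=> iN; have [h _ _ _] := Vl w; exact: h (uT n i iN).
have eta_b n i w : (i <= n.+1)%N -> `|\1_E w * Lh (u n i) w| <= 1.
  move=> /(l01 n i w) /andP[a b]; have /andP[a' b'] := chi01 w.
  by rewrite ger0_norm ?mulr_ge0// mulr_ile1.
have term n i : (i < n.+1)%N -> sqint P (fun w => (\1_E w * Lh (u n i) w) * (I (u n i.+1) w - I (u n i) w)).
  move=> iN; have /andP[a b] := uT n i (ltnW iN); have /andP[a' b'] := uT n i.+1 iN.
  apply: (sqint_bounded (M := 1)).
  - exact: (sqint_ito_sub cP bmW rX0 iX0 itoI a (ugrid_homo tT n (leqnSn i)) b').
  - exact: (filt_measurable_fun cP bmW rX0 b (eta_m n i (ltnW iN))).
  - by move=> w; exact: eta_b (ltnW iN).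
have Jfun n : J n = fun w => \sum_(i < n.+1) (\1_E w * Lh (u n i) w) * (I (u n i.+1) w - I (u n i) w).
  by apply/funext => w; exact: JE.
have sJ n : sqint P (J n).
  by rewrite Jfun; apply: sqint_sum => i _; exact: term.
have J0 n : \int[P]_w J n w = 0.
  rewrite Jfun Rintegral_sum//; last by move=> i _; exact: sqint_integrable (term n i (ltn_ord i)).
  rewrite big1// => i _; have iN := ltn_ord i.
  have /andP[a b] := uT n i (ltnW iN); have /andP[a' b'] := uT n i.+1 iN.
  apply: (ito_mean0 cP bmW rX0 iX0 itoI a (ugrid_homo tT n (leqnSn i)) b').
    exact: eta_m (ltnW iN).
  have := sqint_bounded (sqint_cst P 1) (filt_measurable_fun cP bmW rX0 b (eta_m n i (ltnW iN)))
    (fun w => eta_b n i w (ltnW iN)).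
  by under eq_fun do rewrite mulr1.
have Eg w : E w -> reflected_path w /\ started w.
  by move=> [_ h]; apply: contrapT.
have cJ w : J n w @[n --> \oo] --> \1_E w * martingale_part w.
  rewrite indicE; case: (boolP (w \in E)) => wE; last first.
    rewrite mul0r (_ : (fun n => _) = fun=> 0); first exact: cvg_cst.
    by apply/funext => n; rewrite /J indicE (negbTE wE) mul0r.
  have [rw sw] := Eg w (set_mem wE).
  rewrite mul1r (_ : (fun n => _) = fun n => \sum_(i < n.+1) ((I (u n i.+1) w - I t w) - (I (u n i) w - I t w)) * Lh (u n i) w).
    by apply: (riemann_abel_cvg T0 (Vl w) tT sw (pJ w)); rewrite subrr.
  by apply/funext => n; rewrite /J indicE wE mul1r.
have Jg n w : `|J n w| <= `|g w|.
  rewrite /J indicE; case: (boolP (w \in E)) => wE; last by rewrite mul0r normr0.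
  have [rw sw] := Eg w (set_mem wE).
  have [h01 lnd _ lT] := Vl w.
  (* For the domination the summation by parts is undone: the increments of the control are
     nonnegative and add up to Lh t <= 1, while g bounds their factors. *)
  rewrite mul1r -(@abel_stieltjes _ (fun i => I (u n i) w - I t w) (fun i => Lh (u n i) w)); first last.
  - by rewrite /u ugridT.
  - by rewrite /u ugrid0 subrr.
  have g0 : 0 <= g w by apply: le_trans (gI w rw t _); rewrite ?lexx.
  rewrite (ger0_norm g0); apply: (le_trans (ler_norm_sum _ _ _)).
  apply: (@le_trans _ _ (\sum_(i < n.+1) g w * (Lh (u n i) w - Lh (u n i.+1) w))).
    apply: ler_sum => i _; have iN := ltn_ord i.
    have /andP[a b] := uT n i (ltnW iN); have /andP[a' b'] := uT n i.+1 iN.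
    have l1 := lnd _ _ a (ugrid_homo tT n (leqnSn i)) b'.
    rewrite normrM [X in _ * X]ger0_norm ?subr_ge0// ler_wpM2r ?subr_ge0//.
    by apply: gI => //; exact: ugrid_itv.
  rewrite -mulr_sumr; have -> : \sum_(i < n.+1) (Lh (u n i) w - Lh (u n i.+1) w) = Lh t w.
    have := @telescope_sumr _ 0 n.+1 (fun i => - Lh (u n i) w) (leq0n _).
    rewrite big_mkord opprK /u ugridT lT oppr0 add0r ugrid0 => <-.
    by apply: eq_bigr => i _; rewrite opprK addrC.
  by have /andP[_ b] := h01 t tT; rewrite ler_piMr.
have ig' : P.-integrable setT (fun w => (`|g w|)%:E).
  by have := integrable_abse ig; apply: eq_integrable => // w _.
have mJ : measurable_fun setT (fun w => \1_E w * martingale_part w).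
  by apply: (measurable_fun_cvg (h := J)) => // n; exact: (sJ n).1.
split.
  apply: (le_integrable_EFin measurableT mJ _ ig') => w _.
  by apply: (ler_cvg_to (cvg_norm (cJ w)) (cvg_cst `|g w|)); exact: nearW.
have := dominated_Rintegral_cvg (fun n => (sJ n).1) cJ ig' Jg.
under eq_fun do rewrite J0.
by move=> /(cvg_lim (@Rhausdorff R)); rewrite lim_cst.
Qed.

End reward.

(** * First contact and the control stopping there *)

Lemma first_passage (R : realType) (T t : R) (f : R -> R) : path_cont T f -> 0 <= t <= T ->
  exists tau, [/\ t <= tau <= T, forall u, t <= u -> u < tau -> 0 < f u & tau = T \/ f tau <= 0].
Proof.
move=> cf /andP[t0 tT].
pose S := [set u : R | t <= u <= T /\ f u <= 0].
have [S0|/set0P/negP/negPn/eqP S0] := pselect (S !=set0); last first.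
  exists T; split; [by rewrite tT lexx| |by left].
  move=> u tu uT; rewrite ltNge; apply/negP => fu.
  have : S u by split => //; rewrite tu ltW.
  by rewrite S0.
have lbS : lbound S t by move=> u [/andP[]].
have iS : has_inf S by split => //; exists t.
have tS : t <= inf S by apply: lb_le_inf.
have ST : inf S <= T.
  by case: S0 => u Su; have [/andP[_ uT] _] := Su; apply: le_trans uT; apply: ge_inf => //; exists t.
exists (inf S); split; first by rewrite tS.
  move=> u tu uS; rewrite ltNge; apply/negP => fu.
  have Su : S u by split => //; rewrite tu (le_trans (ltW uS)).
  have : inf S <= u by apply: ge_inf => //; exists t.
  by rewrite leNgt uS.
(* Otherwise continuity would keep f positive just after inf S, where S has points. *)
right; rewrite leNgt; apply/negP => fS.
have ST' : 0 <= inf S <= T by rewrite (le_trans t0).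
have [h h0 H] := cf _ ST' _ fS.
have [u Su uh] := inf_adherent h0 iS.
have Su' : inf S <= u by apply: ge_inf => //; exists t.
have [/andP[tu uT] fu] := Su.
have := H u; rewrite (le_trans t0 tu) uT => /(_ isT).
rewrite ger0_norm ?subr_ge0// => /(_ ltac:(lra)); rewrite ltr_norml => /andP[h1 _].
by move: h1; lra.
Qed.

Lemma dmeasure_itvoc (R : realType) (T : R) (a : R -> R) : 0 < T -> path_cont T a ->
  {in `[0, T] &, {homo a : s t / s <= t}} -> forall x y, 0 <= x -> x <= y -> y <= T ->
  dmeasure T a `]x, y]%classic = (a y - a x)%:E.
Proof.
move=> T0 ca nda x y x0 xy yT.
have cl s : 0 <= Num.max 0 (Num.min s T) <= T.
  by rewrite le_max lexx /= ge_max (ltW T0) ge_min lexx orbT.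
rewrite /dmeasure stieltjes_itvoc//.
- have y0 := le_trans x0 xy; have xT := le_trans xy yT.
  by rewrite !min_l// !max_r.
- move=> s u su; apply: nda; rewrite ?in_itv//=.
  rewrite ge_max !le_max lexx /=; apply/orP; right.
  by rewrite le_min !ge_min su lexx /= orbT.
- move=> s; apply/cvgrPdist_lt => e e0.
  have [h h0 H] := ca _ (cl s) e e0.
  near=> u; rewrite distrC; apply: H => //.
  have su : s < u by near: u; exact: nbhs_right_gt.
  have ush : u - s < h.
    by rewrite ltrBlDl; near: u; apply: nbhs_right_lt; rewrite ltrDl.
  (* Clamping to [0, T] is nondecreasing and 1-Lipschitz. *)
  have /andP[h1 h2] : 0 <= Num.max 0 (Num.min u T) - Num.max 0 (Num.min s T) <= u - s.
    by case: (ltP u T) => h1; case: (ltP s T) => h2; rewrite ?(min_l (ltW _)) ?min_r//;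
     rewrite /Num.max; do 2 case: ltP => ?; apply/andP; split; lra.
  by rewrite ger0_norm//; exact: le_lt_trans ush.
Unshelve. all: by end_near. Qed.

(** For s < tau, the continuous f has a positive minimum on [t, s], and this minimum times a s - a t
    is at most the integral of f, which is 0. The endpoint tau follows from the continuity of a. *)
Lemma flat_off_contact (R : realType) (T : R) (a f : R -> R) : 0 < T -> path_cont T a ->
  {in `[0, T] &, {homo a : s t / s <= t}} -> path_cont T f -> (forall s, 0 <= s <= T -> 0 <= f s) ->
  (\int[dmeasure T a]_(s in `[0%R, T]) (f s)%:E = 0)%E ->
  forall t tau, 0 <= t -> t <= tau -> tau <= T -> (forall u, t <= u -> u < tau -> 0 < f u) ->
  a tau = a t.
Proof.
move=> T0 ca nda cf f0 int0 t tau t0 ttau tauT fpos.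
have flat s : t <= s -> s < tau -> a s = a t.
  move=> ts stau; have sT : s <= T by rewrite (le_trans (ltW stau)).
  have cfs : {within `[t, s], continuous f}.
    have /path_contP := cf; apply: continuous_subspaceW => u; rewrite /= !in_itv/= => /andP[h1 h2].
    by rewrite (le_trans t0 h1) (le_trans h2).
  have [c] := EVT_min ts cfs; rewrite in_itv/= => /andP[tc cs] fc.
  have fc0 : 0 < f c by apply: fpos => //; exact: le_lt_trans stau.
  have mS : measurable (`]t, s] : set (measurableTypeR R)) by exact: measurable_itv.
  have mu_s := dmeasure_itvoc T0 ca nda t0 ts sT.
  have sub : `]t, s] `<=` `[0, T].
    by move=> u; rewrite /= !in_itv/= => /andP[/ltW h1 h2]; rewrite (le_trans t0 h1) (le_trans h2).
  have : ((f c * (a s - a t))%:E <= 0)%E.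
    rewrite -[leRHS]int0.
    apply: (@le_trans _ _ (\int[dmeasure T a]_(u in `]t, s]) (f c)%:E)%E).
      by rewrite integral_cst//= mu_s EFinM.
    apply: (@le_trans _ _ (\int[dmeasure T a]_(u in `]t, s]) (f u)%:E)%E).
      apply: le_integral_nomeas => u; rewrite /= in_itv/= => /andP[/ltW h1 h2].
      by rewrite lee_fin fc// in_itv/= h1.
    apply: ge0_subset_integral => //.
      by apply/measurable_EFinP; exact: path_cont_measurable cf.
  rewrite lee_fin pmulr_rle0// subr_le0 => h1.
  apply/eqP; rewrite eq_le h1 /= nda// in_itv/= ?t0 ?(le_trans ts)//.
  by rewrite (le_trans t0 ts).
move: ttau; rewrite le_eqVlt => /predU1P[->//|ttau].
apply/eqP; rewrite -subr_eq0 -normr_le0; apply/ler_addgt0Pr => e e0; rewrite add0r.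
have tauT' : 0 <= tau <= T by rewrite tauT (le_trans t0 (ltW ttau)).
have [h h0 H] := ca tau tauT' e e0.
pose s := Num.max t (tau - h / 2).
have stau : s < tau by rewrite /s gt_max ttau /= ltrBlDr ltrDl divr_gt0.
have ts : t <= s by rewrite /s le_max lexx.
have sh : tau - h / 2 <= s by rewrite /s le_max lexx orbT.
rewrite -(flat s ts stau) distrC ltW// H//.
  by rewrite (le_trans t0 ts) (le_trans (ltW stau)).
by rewrite distrC ger0_norm ?subr_ge0 ?ltW//; lra.
Qed.

(* Integration against the Dirac mass carried by the jump of [s |-> 1_(s < tau)]. *)
Lemma stopping_stieltjes (R : realType) (T t tau : R) (l g : R -> R) : 0 < T -> V_path T l ->
  0 <= t -> t <= tau -> tau <= T -> (forall s, 0 <= s -> l s = (s < tau)%R%:R) -> path_cont T g ->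
  \int[neg_dmeasure T l]_(s in `[t, T]) g s = g tau.
Proof.
move=> T0 Vl t0 ttau tauT lE cg.
have tT : 0 <= t <= T by rewrite t0 (le_trans ttau).
have tauT' : 0 <= tau <= T by rewrite tauT (le_trans t0).
have st : forall s, 0 <= s -> s < t -> l s = 1.
  by move=> s s0 st; rewrite lE// (lt_le_trans st).
have stau : forall s, 0 <= s -> s < tau -> l s = 1 by move=> s s0 h; rewrite lE// h.
pose mu := neg_dmeasure T l.
have m1 : mu [set tau] = 1%E.
  by have := V_mu_set1 T0 Vl tauT' stau; rewrite (lE tau) ?ltxx ?subr0//; case/andP: tauT'.
have mT : mu `[t, T]%classic = 1%E by exact: (V_mu_total T0 Vl tT st).
have ms : measurable ([set tau] : set (measurableTypeR R)) by exact: measurable_set1.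
have mtT : measurable (`[t, T] : set (measurableTypeR R)) by exact: measurable_itv.
have sp : `[t, T]%classic = [set tau] `|` (`[t, T] `\` [set tau]).
  by rewrite setDUK// => s ->; rewrite /= in_itv/= ttau.
have md : measurable (`[t, T] `\` [set tau] : set (measurableTypeR R)) by exact: measurableD.
have m0 : mu (`[t, T] `\` [set tau])%classic = 0%E.
  have : (mu [set tau] + mu (`[t, T] `\` [set tau])%classic = 1%E)%E.
    by rewrite -mT [in RHS]sp; apply/esym; rewrite measureU// setDIK.
  rewrite m1; case: (mu (_ `\` _)) => [r| |] //= => -[].
  by move=> h; congr EFin; lra.
have ig := V_mu_path_integrable T0 Vl tT st mtT (@subset_refl _ _) cg.
rewrite -/mu sp Rintegral_setU//; first last.
- by apply/eqP; rewrite setDIK.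
- by rewrite -sp.
have -> : \int[mu]_(x in `[t, T] `\` [set tau]) g x = 0.
  have [M M0 gM] := path_bounded cg.
  apply/eqP; rewrite -normr_le0.
  apply: (@le_trans _ _ (\int[mu]_(x in `[t, T] `\` [set tau]) M)); last by rewrite Rintegral_cst// m0 mulr0.
  apply: Rintegral_abs_le => //.
    by move=> s [+ _]; rewrite /= in_itv/= => /andP[h1 h2]; rewrite gM// (le_trans t0 h1).
  apply: (V_mu_integrable T0 Vl tT st (M := `|M|)) => //.
rewrite addr0; transitivity (\int[mu]_(s in [set tau]) (g tau)).
  by apply: eq_Rintegral => s; rewrite inE /= => ->.
by rewrite Rintegral_cst// m1 mulr1.
Qed.

Lemma stopping_V_path (R : realType) (T tau : R) : 0 < T -> 0 <= tau -> tau <= T ->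
  V_path T (fun s => (s < tau)%R%:R : R).
Proof.
move=> T0 tau0 tauT; split.
- by move=> s _; rewrite ler0n lern1 leq_b1.
- move=> s u _ su _; rewrite ler_nat; case: (ltP u tau) => // ut.
  by rewrite (le_lt_trans su ut).
- move=> s s0 sT; apply: (@cvg_trans _ ((fun=> (s < tau)%R%:R : R) u @[u --> s^'+])); last exact: cvg_cst.
  apply: near_eq_cvg; case: (ltP s tau) => h.
    by near=> u; suff -> : u < tau by []; near: u; exact: nbhs_right_lt.
  near=> u; have su : s < u by near: u; exact: nbhs_right_gt.
  by rewrite [u < tau]ltNge (le_trans h (ltW su)).
- by rewrite ltNge tauT.
Unshelve. all: by end_near. Qed.

Section optimal_control.
Variables (R : realType) (disp : measure_display) (Omega : measurableType disp).
Variables (P : probability Omega R) (T : R) (d m : nat).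
Variables (X0 : Omega -> 'rV[R]_d) (W : R -> Omega -> 'rV[R]_m).
Hypothesis T0 : 0 < T.
Variable t : R.
Hypothesis tT : 0 <= t <= T.

Local Notation leb := (@lebesgue_measure R).
Local Notation filt := (filt P X0 W).
Local Notation Fmeas t f :=
  (measurable_fun (setT : set (g_sigma_algebraType (filt t))) (f : Omega -> R)).

Let t0 : 0 <= t. Proof. by case/andP: tT. Qed.
Let tT' : t <= T. Proof. by case/andP: tT. Qed.

Variable f : R -> Omega -> R.
Hypothesis cf : forall w, path_cont T (f ^~ w).
Hypothesis af : forall s, 0 <= s <= T -> Fmeas s (f s).

(** Equivalent to s < tau, but written in terms of f up to time s, which makes it an event of F_s.
    The condition s < T forces the value 0 at T for paths without contact. *)
Definition alive s w : bool := `[< s < t \/ (s < T /\ forall u, t <= u <= s -> 0 < f u w) >].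

Definition stopping_control s w : R := (alive s w)%:R.

Lemma aliveP w : exists tau, [/\ t <= tau <= T, forall u, t <= u -> u < tau -> 0 < f u w,
  tau = T \/ f tau w <= 0 & forall s, alive s w = (s < tau)].
Proof.
have [tau [/andP[ttau tauT] fpos ftau]] := first_passage (@cf w) tT; exists tau; split => //.
  by rewrite ttau.
move=> s; apply/asboolP/idP.
  move=> [st|[sT fs]]; first exact: lt_le_trans st ttau.
  rewrite ltNge; apply/negP => taus; case: ftau => [e|].
    by move: sT; rewrite ltNge -e taus.
  by rewrite leNgt fs// ttau.
move=> stau; case: (ltP s t) => st; [by left|right]; split; first exact: lt_le_trans stau tauT.
by move=> u /andP[tu us]; apply: fpos => //; exact: le_lt_trans stau.
Qed.

Let alive_measurable s : 0 <= s <= T -> <<s filt s>> [set w | alive s w].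
Proof.
move=> /andP[s0 sT].
have mT : <<s filt s>> setT by exact: (@measurableT _ (g_sigma_algebraType (filt s))).
case: (ltP s t) => st.
  rewrite (_ : [set w | _] = setT)//; apply/seteqP; split => // w _ /=.
  by apply/asboolP; left.
move: sT; rewrite le_eqVlt => /predU1P[sT|sT].
  rewrite (_ : [set w | _] = set0).
    exact: (@measurable0 _ (g_sigma_algebraType (filt s))).
  apply/seteqP; split => // w /asboolP[]; first by rewrite ltNge st.
  by rewrite sT ltxx => -[].
(* On the compact [t, s], positivity of a continuous path means a lower bound 1/(k+1) for some k,
   which can be tested on countably many times. The [v n] are such times, clamped to [t, s]. *)
pose v n := Num.max t (Num.min s (itv_point T n)).
have vts n : t <= v n <= s by rewrite /v le_max lexx /= ge_max st ge_min lexx.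
pose B k n := [set w | k.+1%:R^-1 <= f (v n) w].
have mB k n : <<s filt s>> (B k n).
  have /andP[h1 h2] := vts n.
  have vT : 0 <= v n <= T by rewrite (le_trans t0 h1) (le_trans h2)// ltW.
  have mf := filt_fun_mono h2 (af vT).
  have := measurable_fun_ler (f := fun=> k.+1%:R^-1 : R) (@measurable_cst _ _ (g_sigma_algebraType (filt s)) _ setT _) mf.
  move=> /(_ measurableT [set true]); rewrite setTI.
  rewrite (_ : _ @^-1` _ = B k n) //.
  exact.
rewrite (_ : [set w | _] = \bigcup_k \bigcap_n B k n).
  apply: (@bigcupT_measurable _ (g_sigma_algebraType (filt s))) => k.
  by apply: (@bigcapT_measurable _ (g_sigma_algebraType (filt s))) => n; exact: mB.
apply/seteqP; split => w.
  move=> /asboolP[|[_ fpos]]; first by rewrite ltNge st.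
  have cfs : {within `[t, s], continuous (f ^~ w)}.
    have /path_contP := @cf w; apply: continuous_subspaceW => u; rewrite /= !in_itv/= => /andP[h1 h2].
    by rewrite (le_trans t0 h1) (le_trans h2)// ltW.
  have [c] := EVT_min st cfs; rewrite in_itv/= => ct fc.
  have [N _ HN] := @near_infty_natSinv_lt R (PosNum (fpos c ct)).
  exists N => // n _; rewrite /B /=; apply: (le_trans (ltW (HN N (leqnn N)))).
  by apply: fc; rewrite in_itv/=; exact: vts.
move=> [k _ Bk]; apply/asboolP; right; split => // u /andP[tu us].
have uT : 0 <= u <= T by rewrite (le_trans t0 tu) (le_trans us)// ltW.
have k0 : 0 < k.+1%:R^-1 :> R by rewrite invr_gt0.
have k20 : 0 < k.+1%:R^-1 / 2 :> R by rewrite divr_gt0.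
have [h h0 H] := cf w uT k20.
have [n nu] := itv_point_dense uT h0.
(* Clamping to [t, s] fixes u and does not increase distances. *)
have vu : `|v n - u| < h.
  apply: le_lt_trans nu; rewrite /v /Num.max /Num.min.
  by case: (ltP s _) => h1; case: (ltP t _) => h2; rewrite ler_norml; case: (ger0P (itv_point T n - u)); lra.
have /andP[v1 v2] := vts n.
have vT : 0 <= v n <= T by rewrite (le_trans t0 v1) (le_trans v2)// ltW.
have b1 : k.+1%:R^-1 <= f (v n) w := Bk n Logic.I.
have := H _ vT vu; rewrite ltr_norml => /andP[_].
move: b1 k0; move: (f (v n) w) (f u w) (k.+1%:R^-1 : R) => a b c; lra.
Qed.

Let alive_mono s u w : s <= u -> alive u w -> alive s w.
Proof.
by have [tau [_ _ _ E]] := aliveP w; rewrite !E => su; exact: le_lt_trans.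
Qed.

Lemma stopping_control_Fmeas s : 0 <= s <= T -> Fmeas s (stopping_control s).
Proof.
move=> sT; rewrite (_ : stopping_control s = \1_[set w | alive s w]).
  exact: (@measurable_indic _ (g_sigma_algebraType (filt s)) R setT _ (alive_measurable sT)).
apply/funext => w; rewrite indicE /stopping_control; congr (_%:R); congr nat_of_bool.
by apply/idP/idP => [h|/set_mem//]; exact/mem_set.
Qed.

Lemma stopping_control_progressive : progressive P T X0 W (fun s w => vec1 (stopping_control s w)).
Proof.
move=> c; rewrite in_itv/= => cT i j.
have /andP[c0 cT'] := cT.
pose G := g_sigma_algebraType (filt c).
(* Since [alive] is nonincreasing in time, a point (s, w) with s < c is alive exactly when w is
   alive at some enumerated time not before s. The final time c has a slice of its own. *)
pose S : set (measurableTypeR R * G) :=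
  (\bigcup_n (`[0, itv_point c n]%classic `*` [set w | alive (itv_point c n) w]))
  `|` ([set c] `*` [set w | alive c w]).
have malive s : 0 <= s <= c -> measurable ([set w | alive s w] : set G).
  move=> /andP[s0 sc]; apply: (filt_mono sc); apply: alive_measurable.
  by rewrite s0 (le_trans sc).
have mS : measurable S.
  apply: measurableU.
    apply: bigcupT_measurable => n; apply: measurableX; first exact: measurable_itv.
    by apply: malive; exact: itv_pointP.
  by apply: measurableX; [exact: measurable_set1|apply: malive; rewrite c0 lexx].
have : measurable_fun (`[0, c] `*` setT : set (measurableTypeR R * G)) (\1_S : _ -> R).
  by apply: measurable_funTS; exact: measurable_indic.
apply: eq_measurable_fun => -[s w] /set_mem[/= sc _]; rewrite in_itv/= in sc.
rewrite mxE indicE /stopping_control; congr (_%:R); congr nat_of_bool.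
apply/idP/idP => [/set_mem[[n _ [/= sn an]]|[/= -> //]]|al].
  by apply: alive_mono an; move: sn; rewrite in_itv/= => /andP[].
apply/mem_set; have /andP[s0 sc'] := sc.
move: sc'; rewrite le_eqVlt => /predU1P[e|sltc]; first by right; rewrite -e.
left; have [tau [_ _ _ E]] := aliveP w.
move: al; rewrite E => stau.
(* The midpoint of s and min tau c: an enumerated time near it is after s and before tau. *)
pose p := (s + Num.min tau c) / 2.
have sm : s < Num.min tau c by rewrite lt_min stau.
have mc : Num.min tau c <= c by rewrite ge_min lexx orbT.
have mtau : Num.min tau c <= tau by rewrite ge_min lexx.
have pc : 0 <= p <= c by rewrite /p; apply/andP; split; lra.
have e0 : 0 < (Num.min tau c - s) / 2 by rewrite divr_gt0// subr_gt0.
have [n] := itv_point_dense pc e0; rewrite /p ltr_norml => /andP[h1 h2].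
exists n => //; split => /=; first by rewrite in_itv/= s0; lra.
by rewrite E; lra.
Qed.

Lemma stopping_control_path w : exists tau, [/\ t <= tau <= T, forall u, t <= u -> u < tau -> 0 < f u w,
  tau = T \/ f tau w <= 0 & stopping_control ^~ w = fun s => (s < tau)%R%:R].
Proof.
have [tau [h1 h2 h3 E]] := aliveP w; exists tau; split => //.
by apply/funext => s; rewrite /stopping_control E.
Qed.

Lemma stopping_control_V : in_V_at P T X0 W t stopping_control.
Proof.
have Vw w : V_path T (stopping_control ^~ w).
  have [tau [/andP[ttau tauT] _ _ ->]] := stopping_control_path w.
  by apply: stopping_V_path => //; exact: le_trans ttau.
split; first split.
- split; first exact: stopping_control_progressive.
  apply: (@le_lt_trans _ _ (\int[P]_w \int[leb]_(s in `[0%R, T]) 1%:E)%E).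
    apply: le_integral_nomeas => w _; apply: le_integral_nomeas => s; rewrite /= in_itv/= => sT.
    rewrite lee_fin sqr_enorm !big_ord1 mxE; have [h _ _ _] := Vw w.
    by have /andP[a b] := h s sT; rewrite exprn_ile1.
  have -> : (\int[leb]_(s in `[0%R, T]) 1%:E = T%:E)%E.
    by rewrite integral_cst//= lebesgue_measure_itv/= lte_fin T0 mul1e sube0.
  by rewrite integral_cst//= probability_setT mule1 ltry.
- move=> s; rewrite in_itv/= => sT i j; have := stopping_control_Fmeas sT.
  by congr (measurable_fun _ _); apply/funext => w; rewrite mxE.
- by move=> w s; rewrite in_itv/=; have [h _ _ _] := Vw w; exact: h.
- move=> w s u; rewrite !in_itv/= => /andP[s0 _] /andP[_ uT] su; have [_ h _ _] := Vw w; exact: h.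
- split.
  + by move=> w; have [_ _ h _] := Vw w.
  + move=> w s s0 sT; have [tau [_ _ _ ->]] := stopping_control_path w.
    case: (leP s tau) => stau.
      apply: (cvgP (1 : R)); apply: cvg_near_cst; near=> u.
      suff -> : u < tau by [].
      by apply: lt_le_trans stau; near: u; exact: nbhs_left_lt.
    apply: (cvgP (0 : R)); apply: cvg_near_cst; near=> u.
    suff /ltW : tau < u by rewrite leNgt => /negbTE ->.
    by near: u; exact: nbhs_left_gt.
  + by move=> w; have [_ _ _ h] := Vw w.
- apply: aeW => w; rewrite /left_value; case: eqP => // /eqP tn0.
  have tp : 0 < t by rewrite lt_neqAle eq_sym tn0.
  apply: cvg_lim => //; apply: cvg_near_cst; near=> u.
  rewrite /stopping_control (_ : alive u w)//; apply/asboolP; left.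
  by near: u; exact: nbhs_left_lt.
Unshelve. all: by end_near. Qed.

End optimal_control.

(** * The essential supremum *)

Lemma Rintegral_indic_mul d (T : measurableType d) (R : realType)
    (mu : {measure set T -> \bar R}) (A : set T) (f : T -> R) :
  \int[mu]_(x in A) f x = \int[mu]_x (\1_A x * f x).
Proof.
rewrite /Rintegral; congr fine; rewrite integral_mkcond; apply: eq_integral => x _.
by rewrite patchE indicE; case: (x \in A); rewrite ?mul1r ?mul0r.
Qed.

Lemma integrable_indic_mul d (T : measurableType d) (R : realType)
    (mu : {measure set T -> \bar R}) (A : set T) (f : T -> R) : measurable A ->
  mu.-integrable setT (fun x => (\1_A x * f x)%:E) <-> mu.-integrable A (fun x => (f x)%:E).
Proof.
move=> mA; rewrite [X in _ <-> X](integrable_mkcond _ mA).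
suff -> : (fun x => (\1_A x * f x)%:E) = ((fun x => (f x)%:E) \_ A)%E by [].
by apply/funext => x; rewrite patchE indicE; case: (x \in A); rewrite ?mul1r ?mul0r.
Qed.

Section snell_envelope.
Variables (R : realType) (disp : measure_display) (Omega : measurableType disp).
Variables (P : probability Omega R) (T q : R) (d k m : nat).
Variables (X0 : Omega -> 'rV[R]_d) (W : R -> Omega -> 'rV[R]_m).
Variable D : data R d k m.
Hypothesis T0 : 0 < T.
Hypothesis q4 : 4 <= q.
Hypothesis cP : measure_is_complete P.
Hypothesis bmW : brownian_motion P T W.
Hypothesis rX0 : random_vector X0.
Hypothesis iX0 : indep_gens P (rv_gens [set tt] (fun _ => X0)) (rv_gens `[0, T] W).
Hypothesis X0q : (\int[P]_w (enorm (X0 w) `^ q)%:E < +oo)%E.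
Hypothesis mD : measurable_data T D.
Hypothesis lipD : forward_lipschitz T D.
Hypothesis regD : backward_regular T q D.
Variables (L : R -> Omega -> R) (X : R -> Omega -> 'rV[R]_d).
Hypothesis VL : in_V P T X0 W L.
Hypothesis solX : forward_solution P T X0 W D L X.
Variables (Y A I : R -> Omega -> R) (Z : R -> Omega -> 'rV[R]_m).
Hypothesis SY : in_S2 P T X0 W (fun t w => vec1 (Y t w)).
Hypothesis SA : in_A2 P T X0 W A.
Hypothesis itoI : is_ito_integral P T X0 W Z I.
Hypothesis refl : {ae P, forall w, reflected_path P T D L X Y A I w}.
Variable t : R.
Hypothesis tT : 0 <= t <= T.

Local Notation leb := (@lebesgue_measure R).
Local Notation filt := (filt P X0 W).
Local Notation Fmeas t f :=
  (measurable_fun (setT : set (g_sigma_algebraType (filt t))) (f : Omega -> R)).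
Local Notation obs := (obstacle P T D L X).
Local Notation exc Lh := (exceptional P T D L X Y A I t Lh).

Let tT' : t <= T. Proof. by case/andP: tT. Qed.

Let Y_Fmeas s : 0 <= s <= T -> Fmeas s (Y s).
Proof. by move=> sT; have := S2_adapted SY ord0 sT; under eq_fun do rewrite mxE. Qed.

Let Y_measurable : measurable_fun setT (Y t).
Proof. exact: (filt_measurable_fun cP bmW rX0 tT' (Y_Fmeas tT)). Qed.

Let Y_integrable : P.-integrable setT (fun w => (Y t w)%:E).
Proof.
apply: sqint_integrable; apply: (sqint_le Y_measurable (S2_sqint T0 cP bmW rX0 SY)) => w.
rewrite [leRHS]ger0_norm; last exact: (path_sup_ge0 (ltW T0) (S2_path SY)).
apply: le_trans (S2_le_sup T0 SY w tT).
by have := le_entry_norm (vec1 (Y t w)) ord0; rewrite mxE.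
Qed.

Section upper_bound.
Variable Lh : R -> Omega -> R.
Hypothesis VLh : in_V_at P T X0 W t Lh.

Lemma reward_le w : ~ exc Lh w ->
  stopping_reward P T D L X t Lh w <= Y t w + martingale_part T I t Lh w.
Proof.
move=> /contrapT [rw sw].
rewrite (rewardE T0 q4 cP bmW rX0 iX0 X0q mD lipD regD VL solX SY SA itoI tT VLh rw sw).
rewrite gerDl oppr_le0; apply: Rintegral_ge0 => u; rewrite /= in_itv/= => /andP[tu uT].
have uT' : 0 <= u <= T by case/andP: tT => t0 _; rewrite (le_trans t0 tu).
have [_ h _] := rw; rewrite addr_ge0 ?subr_ge0 ?h//.
by case: SA => _ hA _; apply: hA; rewrite ?in_itv.
Qed.

(** V is tested on the F_t-sets [B n] where it exceeds Y_t by at least 1/(n+1). There the martingale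
    part has mean zero and the reward is only compared from above, so 1/(n+1) times the probability
    of [B n] is at most 0. *)
Lemma cond_exp_le V : is_cond_exp P (filt t) (stopping_reward P T D L X t Lh) V ->
  {ae P, forall w, (V w <= (Y t w)%:E)%E}.
Proof.
move=> [mV EV].
have Nexc := exceptional_negligible refl tT VLh.
pose B n : set Omega := [set w | ((Y t w + n.+1%:R^-1)%:E <= V w)%E] `\` exc Lh.
have mB n : <<s filt t>> (B n).
  have m1 : <<s filt t>> [set w | ((Y t w + n.+1%:R^-1)%:E <= V w)%E].
    have mYn : measurable_fun (setT : set (g_sigma_algebraType (filt t)))
        (fun w => (Y t w + n.+1%:R^-1)%:E).
      by apply/measurable_EFinP; apply: measurable_funD; [exact: Y_Fmeas|exact: measurable_cst].
    have := emeasurable_fun_le (@measurableT _ (g_sigma_algebraType (filt t))) mYn mV.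
    by rewrite setTI.
  have mN : <<s filt t>> (exc Lh) by apply: filt_negligible; exact: Nexc.
  exact: (@measurableD _ (g_sigma_algebraType (filt t)) _ _ m1 mN).
have mB' n : measurable (B n) := filt_measurable_set cP bmW rX0 tT' (mB n).
have PB n : P (B n) = 0%E.
  have [iJ J0] := martingale_part_mean T0 q4 cP bmW rX0 iX0 X0q mD lipD regD VL solX SY SA itoI refl tT VLh (mB n).
  rewrite (_ : B n `\` exc Lh = B n) in iJ J0; last by rewrite /B setDDl setUid.
  have {}iJ := (integrable_indic_mul P _ (mB' n)).1 iJ.
  rewrite -Rintegral_indic_mul in J0.
  have iY : P.-integrable (B n) (fun w => (Y t w)%:E).
    by apply: integrableS Y_integrable.
  have ic c : P.-integrable (B n) (fun=> (c : R)%:E).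
    by apply: integrableS (sqint_integrable (sqint_cst P c)).
  have iYn := integrable_EFinD (mB' n) iY (ic n.+1%:R^-1).
  have iYJ := integrable_EFinD (mB' n) iY iJ.
  have h : (\int[P]_(w in B n) (Y t w + n.+1%:R^-1)%:E <=
      \int[P]_(w in B n) (Y t w + martingale_part T I t Lh w)%:E)%E.
    apply: (@le_trans _ _ (\int[P]_(w in B n) V w)%E).
      by apply: le_integral_nomeas => w [].
    rewrite EV//; apply: le_integral_nomeas => w [_ wN].
    by rewrite lee_fin reward_le.
  have {}h : \int[P]_(w in B n) (Y t w + n.+1%:R^-1) <=
      \int[P]_(w in B n) (Y t w + martingale_part T I t Lh w).
    exact: fine_le (integrable_fin_num (mB' n) iYn) (integrable_fin_num (mB' n) iYJ) h.
  move: h; rewrite (RintegralD (mB' n) iY (ic _)) (RintegralD (mB' n) iY iJ).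
  rewrite J0 addr0 gerDl Rintegral_cst// => h.
  have Pfin : P (B n) \is a fin_num by rewrite fin_num_measure.
  apply/eqP; rewrite eq_le measure_ge0 andbT -(fineK Pfin) lee_fin.
  by move: h; rewrite pmulr_rle0// invr_gt0.
have : P.-negligible (exc Lh `|` \bigcup_n B n).
  apply: negligibleU => //; apply: negligible_bigcup => n.
  by apply/negligibleP; [exact: mB'|exact: PB].
apply: negligibleS => w /= /negP; rewrite -ltNge => VY.
have [|wN] := pselect (exc Lh w); first by left.
right; suff [n hn] : exists n, ((Y t w + n.+1%:R^-1)%:E <= V w)%E by exists n.
case: (V w) VY => [v| |] //; last by exists 0%N; rewrite leey.
rewrite lte_fin => Yv; have v0 : 0 < v - Y t w by rewrite subr_gt0.
have [N _ HN] := @near_infty_natSinv_lt R (PosNum v0).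
exists N; rewrite lee_fin -lerBrDl; apply: ltW; exact: HN (leqnn N).
Qed.

End upper_bound.

Let gap s w := Y s w - obs s w.

Let gap_path w : path_cont T (gap ^~ w).
Proof.
have pY : path_cont T (Y ^~ w) by apply: scalar_path; case: SY.
have po := obstacle_path T0 cP bmW rX0 regD VL solX w.
apply/path_contP; have /path_contP c1 := pY; have /path_contP c2 := po.
by move=> x; exact: (cvgB (c1 x) (c2 x)).
Qed.

Let gap_Fmeas s : 0 <= s <= T -> Fmeas s (gap s).
Proof.
move=> sT; apply: measurable_funB; first exact: Y_Fmeas.
exact: (obstacle_Fmeas mD solX sT).
Qed.

Local Notation Ls := (stopping_control T t gap).

Let VLs : in_V_at P T X0 W t Ls.
Proof. exact: (stopping_control_V T0 tT gap_path gap_Fmeas). Qed.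

Lemma stopping_control_reward w : ~ exc Ls w ->
  stopping_reward P T D L X t Ls w = Y t w + martingale_part T I t Ls w.
Proof.
move=> /contrapT [rw sw].
rewrite (rewardE T0 q4 cP bmW rX0 iX0 X0q mD lipD regD VL solX SY SA itoI tT VLs rw sw).
have [tau [/andP[ttau tauT] gpos gtau LE]] := stopping_control_path tT gap_path w.
have /andP[t0 _] := tT.
have tauT' : 0 <= tau <= T by rewrite tauT (le_trans t0).
have [SA' ndA _] := SA.
have pA : path_cont T (A ^~ w) by apply: scalar_path; case: SA'.
have [eqY oY dA0] := rw.
have Vw : V_path T (Ls ^~ w) by exact: in_V_path w VLs.1.
(* Without contact tau is T, and the terminal condition closes the gap there. *)
have g0 : gap tau w = 0.
  case: gtau => [->|gt0]; last first.
    by apply/eqP; rewrite eq_le gt0 /= subr_ge0 oY.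
  rewrite /gap (eqY T); last by rewrite lexx ltW.
  by rewrite set_itv1 Rintegral_set1; ring.
have A0 : A tau w = A t w.
  apply: (flat_off_contact T0 pA (ndA w) (gap_path w) _ dA0 t0 ttau tauT gpos) => s sT.
  by rewrite subr_ge0 oY.
rewrite (stopping_stieltjes (tau := tau) (g := fun u => gap u w + (A u w - A t w)) T0 Vw t0 ttau tauT).
- by rewrite g0 A0 subrr addr0 subr0.
- by move=> s _; rewrite (congr1 (@^~ s) LE).
- apply/path_contP; have /path_contP c1 := gap_path w; have /path_contP c2 := pA.
  by move=> x; exact: (cvgD (c1 x) (cvgB (c2 x) (cvg_cst (A t w)))).
Qed.

Lemma stopping_control_cond_exp :
  is_cond_exp P (filt t) (stopping_reward P T D L X t Ls) (fun w => (Y t w)%:E).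
Proof.
split; first by apply/measurable_EFinP; exact: Y_Fmeas.
move=> B mB; have mB' : measurable B := filt_measurable_set cP bmW rX0 tT' mB.
have [iJ J0] := martingale_part_mean T0 q4 cP bmW rX0 iX0 X0q mD lipD regD VL solX SY SA itoI refl tT VLs mB.
have Nexc := exceptional_negligible refl tT VLs.
set E := B `\` _ in iJ J0.
pose J' w := \1_E w * martingale_part T I t Ls w.
have iY : P.-integrable B (fun w => (Y t w)%:E) by apply: integrableS Y_integrable.
have iJ' : P.-integrable B (fun w => (J' w)%:E) by apply: integrableS iJ.
have iYJ := integrable_EFinD mB' iY iJ'.
have ae_eq : ae_eq P B (fun w => (Y t w + J' w)%:E)
    (fun w => (stopping_reward P T D L X t Ls w)%:E).
  have : {ae P, forall w, ~ exc Ls w}.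
    by apply: negligibleS Nexc => w /contrapT.
  apply: filterS => w wN Bw; rewrite stopping_control_reward//.
  by rewrite /J' indicE mem_set ?mul1r//; split.
have mYJ : measurable_fun B (fun w => (Y t w + J' w)%:E) by case/integrableP: iYJ.
(* The reward equals Y_t + J' almost everywhere on B; completeness hands it the measurability needed
   to equate the integrals. *)
rewrite -(ae_eq_integral _ _ mB' mYJ (ae_measurable_fun cP ae_eq mYJ) ae_eq).
rewrite -(fineK (integrable_fin_num mB' iY)) -(fineK (integrable_fin_num mB' iYJ)).
congr EFin; rewrite -!/(Rintegral _ _ _) RintegralD//.
suff -> : \int[P]_(w in B) J' w = 0 by rewrite addr0.
rewrite Rintegral_indic_mul -[RHS]J0; apply: eq_Rintegral => w _.
rewrite /J' !indicE; case: (boolP (w \in E)) => [/set_mem[Bw _]|_]; last by rewrite !mul0r mulr0.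
by rewrite (mem_set Bw) mul1r.
Qed.

(** Y_t is itself a member of the family, through the control [Ls], so every almost sure upper bound
    of the family dominates it. *)
Lemma reflected_ess_sup :
  is_family_ess_sup P
    [set V : Omega -> \bar R |
      exists2 Lh : R -> Omega -> R, in_V_at P T X0 W t Lh &
        is_cond_exp P (filt t) (stopping_reward P T D L X t Lh) V]
    (fun w => (Y t w)%:E).
Proof.
split; first exact/measurable_EFinP.
- by move=> V [Lh VLh cV]; exact: cond_exp_le cV.
- move=> H' _; apply; exists Ls; first exact: VLs.
  exact: stopping_control_cond_exp.
Qed.

End snell_envelope.

Theorem theorem3p2 (R : realType) (disp : measure_display)
    (Omega : measurableType disp) (P : probability Omega R)
    (T q : R) (d k m : nat)
    (W : R -> Omega -> 'rV[R]_m) (X0 : Omega -> 'rV[R]_d)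
    (D : data R d k m) :
  0 < T -> (1 <= d)%N -> (1 <= k)%N -> (1 <= m)%N -> 4 <= q ->
  measure_is_complete P ->
  brownian_motion P T W ->
  random_vector X0 ->
  indep_gens P (rv_gens [set tt] (fun _ => X0)) (rv_gens `[0, T] W) ->
  (\int[P]_w (enorm (X0 w) `^ q)%:E < +oo)%E ->
  measurable_data T D ->
  forward_lipschitz T D ->
  backward_regular T q D ->
  forall L : R -> Omega -> R, in_V P T X0 W L ->
  forall X : R -> Omega -> 'rV[R]_d, forward_solution P T X0 W D L X ->
  forall (Y : R -> Omega -> R) (Z : R -> Omega -> 'rV[R]_m)
    (A : R -> Omega -> R),
  reflected_solution P T X0 W D L X Y Z A ->
  forall t : R, 0 <= t <= T ->
  is_family_ess_sup P
    [set V : Omega -> \bar R |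
      exists2 Lh : R -> Omega -> R, in_V_at P T X0 W t Lh &
        is_cond_exp P (filt P X0 W t) (stopping_reward P T D L X t Lh) V]
    (fun w => (Y t w)%:E).
Proof.
move=> T0 _ _ _ q4 cP bmW rX0 iX0 X0q mD lipD regD L VL X solX Y Z A.
move=> [SY _ SA [I itoI eqY] [obsY contact]] t tT.
apply: (@reflected_ess_sup _ _ _ P T q d k m X0 W D T0 q4 cP bmW rX0 iX0 X0q mD lipD regD
  L X VL solX Y A I Z) => //.
apply: filterS3 eqY obsY contact => w eqYw obsYw contactw; split => [u uT|u uT|//].
  by apply: eqYw; rewrite in_itv.
by apply: obsYw; rewrite in_itv.
Qed.
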